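(* Let $n\ge2$ and let $\xi$ be a $-\frac12$-Killing spinor on $\mathbb{S}^n$ with $|\xi|=1$. For any $k\ge1$, any $\varphi_k\in E_k$ and any $\varphi_{-k}\in E_{-k}$, $$\int_{\mathbb{S}^n}\langle\xi,\varphi_k\rangle^2\le\frac{n+k-1}{n+2k-1}\int_{\mathbb{S}^n}|\varphi_k|^2,\qquad \int_{\mathbb{S}^n}\langle\xi,\varphi_{-k}\rangle^2\le\frac{k}{n+2k-1}\int_{\mathbb{S}^n}|\varphi_{-k}|^2 .$$ Equality holds in the first inequality if and only if $\varphi_k=(n+k-1)f\xi+\mathrm{d}f\cdot\xi$ for some $f\in P_k$, and equality holds in the second if and only if $\varphi_{-k}=-kf\xi+\mathrm{d}f\cdot\xi$ for some $f\in P_k$. Moreover, for all $k,j\ge1$ with $k\ne j$, and all $\varphi_{\pm k}\in E_{\pm k}$, $\varphi_{\pm j}\in E_{\pm j}$ (for any choice of signs), $$\int_{\mathbb{S}^n}\langle\xi,\varphi_{\pm k}\rangle\langle\xi,\varphi_{\pm j}\rangle=0 .$$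
   Context: $\mathbb{S}^n$ is the unit sphere with its round metric and spin structure, with spinor bundle of complex rank $2^{[n/2]}$. $\langle\cdot,\cdot\rangle$ is the real part of the Hermitian metric on spinors, $\nabla$ the spin connection; Clifford multiplication satisfies $X\cdot Y\cdot\psi+Y\cdot X\cdot\psi=-2g(X,Y)\psi$; $\mathrm{d}f\cdot\xi$ is Clifford multiplication by the gradient of $f$. The Dirac operator is $D\psi=\sum_ie_i\cdot\nabla_{e_i}\psi$. A $-\frac12$-Killing spinor satisfies $\nabla_X\xi=-\frac12X\cdot\xi$ for all $X$ (so $D\xi=\frac n2\xi$, and $|\xi|$ is constant). For $k\ge1$, $E_k$ is the eigenspace of $D$ for the eigenvalue $\frac n2+k$, and $E_{-k}$ is the eigenspace of $D$ for the eigenvalue $-(\frac n2+k-1)$. $P_k$ is the space of real-valued eigenfunctions of $-\Delta$ on $\mathbb{S}^n$ with eigenvalue $k(n+k-1)$ (spherical harmonics of degree $k$), including $0$. *)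

(* Defs.v *)
From HB Require Import structures.
From mathcomp Require Import all_boot all_order all_algebra.
From mathcomp Require Import all_classical all_reals all_analysis.
From mathcomp Require Import complex spectral.
Set Implicit Arguments.
Unset Strict Implicit.
Unset Printing Implicit Defensive.

Import Order.TTheory GRing.Theory Num.Theory numFieldNormedType.Exports.
Local Open Scope classical_set_scope.
Local Open Scope ring_scope.
Local Open Scope complex_scope.
Local Open Scope sesquilinear_scope.

(* Functions on the unit sphere of R^(n+1) are represented by functions on
   R^(n+1) of which only the values on [sphere] matter; 'rV[R]_m carries the
   sup norm in the library, so the Euclidean structure is written with [dot]. *)
Section Sphere.
Context {R : realType}.

Definition dot {m} (u v : 'rV[R]_m) : R := \sum_i u 0 i * v 0 i.

Definition enorm {m} (u : 'rV[R]_m) : R := Num.sqrt (dot u u).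

Definition sphere {n : nat} : set 'rV[R]_n.+1 := [set x | dot x x = 1].

Definition partial {m} (i : 'I_m) (f : 'rV[R]_m -> R) : 'rV[R]_m -> R :=
  fun x => 'D_(delta_mx 0 i) f x.

Fixpoint Ck {m} (k : nat) (U : set 'rV[R]_m) (f : 'rV[R]_m -> R) : Prop :=
  if k is k'.+1 then
    (forall x, U x -> differentiable f x) /\
    (forall i, Ck k' U (partial i f))
  else forall x, U x -> {for x, continuous f}.

Definition smooth {m} (U : set 'rV[R]_m) (f : 'rV[R]_m -> R) : Prop :=
  forall k, Ck k U f.

(* The extension of f : S^n -> R that is constant along rays.  Its radial
   derivative vanishes, so that its Euclidean gradient at a point of S^n is the
   Riemannian gradient of f, and likewise for the divergence of tangent
   fields. *)
Definition radial {n} (f : 'rV[R]_n.+1 -> R) : 'rV[R]_n.+1 -> R :=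
  fun x => f ((enorm x)^-1 *: x).

Definition smooth_sphere {n} (f : 'rV[R]_n.+1 -> R) : Prop :=
  smooth [set x | x != 0] (radial f).

Definition grad {n} (f : 'rV[R]_n.+1 -> R) (x : 'rV[R]_n.+1) : 'rV[R]_n.+1 :=
  \row_i partial i (radial f) x.

Definition div {n} (Y : 'rV[R]_n.+1 -> 'rV[R]_n.+1) (x : 'rV[R]_n.+1) : R :=
  \sum_i partial i (radial (fun y => Y y 0 i)) x.

Definition laplacian {n} (f : 'rV[R]_n.+1 -> R) : 'rV[R]_n.+1 -> R :=
  div (grad f).

Definition harmonics (n k : nat) (f : 'rV[R]_n.+1 -> R) : Prop :=
  smooth_sphere f /\
  forall x, sphere x -> - laplacian f x = (k * (n + k - 1))%:R * f x.

(* Integral for the Riemannian volume: S^0 has the counting measure and, in the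
   polar coordinates x = (cos t, sin t w) with 0 <= t <= pi and w in S^(n-1),
   the round metric is dt^2 + sin(t)^2 g_{S^(n-1)}. *)
Fixpoint sphere_int (n : nat) : ('rV[R]_n.+1 -> R) -> R :=
  match n return ('rV[R]_n.+1 -> R) -> R with
  | 0 => fun f => f (const_mx 1) + f (const_mx (-1))
  | m.+1 => fun f =>
      \int[lebesgue_measure]_(t in `[0%R, pi])
        (sin t ^+ m *
         sphere_int (fun w : 'rV[R]_m.+1 =>
           f (row_mx (const_mx (cos t) : 'rV_1) (sin t *: w))))
  end.

End Sphere.

(* The spinor module Sigma_n of Cl_n: as 2 ^ n./2 is the least dimension of a
   complex Cl_n-module, such a representation is irreducible.  It is unique up
   to unitary equivalence and, for n odd, up to the sign of gamma. *)
Definition spinor_rep {R : realType} {n : nat}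
    (gamma : 'I_n -> 'M[R[i]]_(2 ^ n./2)) : Prop :=
  (forall i j, gamma i *m gamma j + gamma j *m gamma i
               = (- (2%:R *+ (i == j)))%:M) /\
  (forall i, (gamma i)^t* = - gamma i).

Notation spinor_fun R n :=
  ('M[R[i]]_(2 ^ n./2 + 2 ^ n./2) -> 'cV[R[i]]_(2 ^ n./2)).

Section SpinorBundle.
Context {R : realType} {n : nat} (gamma : 'I_n -> 'M[R[i]]_(2 ^ n./2)).

Local Notation C := R[i].
Local Notation N := (2 ^ n./2)%N.

(* The standard basis e_0, ..., e_n of R^(n+1) acting on Sigma_n + Sigma_n, which
   is a faithful module of the even part of Cl_(n+1). *)
Definition cl_basis (j : 'I_n.+1) : 'M[C]_(N + N) :=
  match unlift ord0 j with
  | None => block_mx 0 1%:M (- 1%:M) 0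
  | Some i => block_mx 0 (gamma i) (gamma i) 0
  end.

Definition cl (v : 'rV[R]_n.+1) : 'M[C]_(N + N) :=
  \sum_j (v 0 j)%:C *: cl_basis j.

(* Spin(n+1): the products of an even number of unit vectors. *)
Inductive Spin : 'M[C]_(N + N) -> Prop :=
| Spin_one : Spin 1%:M
| Spin_mul v w S : sphere v -> sphere w -> Spin S ->
    Spin (cl v *m cl w *m S).

(* The covering Spin(n+1) -> SO(n+1): S e_j S^-1 = \sum_i (frame S j)_i e_i, the
   coefficients being read off from tr (e_i e_j) = - 2 N delta_ij.  The spin
   structure of S^n is Spin(n+1) over SO(n+1), seen as the bundle of oriented
   orthonormal frames: S lies over the point [base S] and is a lift of the
   frame (tframe S 0, ..., tframe S (n-1)) of the tangent space there. *)
Definition frame (S : 'M[C]_(N + N)) (j : 'I_n.+1) : 'rV[R]_n.+1 :=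
  \row_i (- complex.Re (\tr (cl_basis i *m S *m cl_basis j *m invmx S))
            / (N + N)%:R).

Definition base (S : 'M[C]_(N + N)) : 'rV[R]_n.+1 := frame S ord0.

Definition tframe (S : 'M[C]_(N + N)) (i : 'I_n) : 'rV[R]_n.+1 :=
  frame S (lift ord0 i).

(* The structure group Spin(n) of the bundle is the stabiliser of e_0 in
   Spin(n+1).  On it [ulsubmx] is the spin representation on Sigma_n, because
   e_i e_j = block_mx (gamma i *m gamma j) 0 0 (gamma i *m gamma j)
   for i, j >= 1. *)
Definition structure_group (h : 'M[C]_(N + N)) : Prop :=
  Spin h /\ h *m cl_basis ord0 = cl_basis ord0 *m h.

Definition spin_rep (h : 'M[C]_(N + N)) : 'M[C]_N := ulsubmx h.

(* Sections of the associated bundle Spin(n+1) x_{Spin(n)} Sigma_n, as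
   equivariant functions on Spin(n+1); values outside Spin are irrelevant. *)
Definition equivariant (psi : spinor_fun R n) : Prop :=
  forall S h, Spin S -> structure_group h ->
    psi (S *m h) = invmx (spin_rep h) *m psi S.

Definition csmooth {m} (U : set 'rV[R]_m) (f : 'rV[R]_m -> C) : Prop :=
  smooth U (fun x => complex.Re (f x)) /\ smooth U (fun x => complex.Im (f x)).

(* Smoothness on the submanifold Spin(n+1) of the matrix space, tested on
   smooth maps from open subsets of R^m (in particular on local charts). *)
Definition smooth_on_Spin (psi : spinor_fun R n) : Prop :=
  forall (m : nat) (U : set 'rV[R]_m) (s : 'rV[R]_m -> 'M[C]_(N + N)),
    open U -> (forall x, U x -> Spin (s x)) ->
    (forall a b, csmooth U (fun x => s x a b)) ->
    forall a, csmooth U (fun x => psi (s x) a 0).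

Definition spinor_field (psi : spinor_fun R n) : Prop :=
  smooth_on_Spin psi /\ equivariant psi.

Definition inner (u v : 'cV[C]_N) : R := complex.Re ((u^t* *m v) 0 0).

Definition cmul (S : 'M[C]_(N + N)) (X : 'rV[R]_n.+1) (v : 'cV[C]_N) :
    'cV[C]_N :=
  \sum_i (dot X (tframe S i))%:C *: (gamma i *m v).

(* The horizontal curve S * exp (t/2 e_0 e_i).  Its base point is
   cos t *: base S + sin t *: tframe S i; the vectors tframe S j with j != i
   are constant along it and the i-th one has normal derivative, so the frame is
   parallel for the Levi-Civita connection. *)
Definition horizontal (S : 'M[C]_(N + N)) (i : 'I_n) (t : R) : 'M[C]_(N + N) :=
  S *m ((cos (t / 2))%:C%:M
        + (sin (t / 2))%:C *: (cl_basis ord0 *m cl_basis (lift ord0 i))).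

Definition cderive (f : R -> C) (t : R) : C :=
  derive1 (fun u => complex.Re (f u)) t +i* derive1 (fun u => complex.Im (f u)) t.

(* The spin connection: (nabla psi X) S represents nabla_X psi at [base S], for
   X tangent there. *)
Definition nabla (psi : spinor_fun R n) (X : 'rV[R]_n.+1)
    (S : 'M[C]_(N + N)) : 'cV[C]_N :=
  \sum_i (dot X (tframe S i))%:C *:
    \col_a cderive (fun t => psi (horizontal S i t) a 0) 0.

Definition dirac (psi : spinor_fun R n) (S : 'M[C]_(N + N)) :
    'cV[C]_N :=
  \sum_i cmul S (tframe S i) (nabla psi (tframe S i) S).

Definition killing (xi : spinor_fun R n) : Prop :=
  spinor_field xi /\
  forall S X, Spin S -> dot X (base S) = 0 ->
    nabla xi X S = (- 2^-1)%:C *: cmul S X (xi S).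

Definition eigenspinor (lambda : R) (phi : spinor_fun R n) : Prop :=
  spinor_field phi /\ forall S, Spin S -> dirac phi S = lambda%:C *: phi S.

Definition eigenvalue_index (a : int) : R :=
  if 0 < a then n%:R / 2 + a%:~R else - (n%:R / 2 - a%:~R - 1).

(* The eigenspace E_a, meaningful for a != 0. *)
Definition E (a : int) (phi : spinor_fun R n) : Prop :=
  eigenspinor (eigenvalue_index a) phi.

(* Integral over S^n of a function on Spin(n+1) that is constant on the fibres
   of [base]. *)
Definition integral_S (F : 'M[C]_(N + N) -> R) : R :=
  sphere_int (fun x => F (xget 0 [set S | Spin S /\ base S = x])).

End SpinorBundle.

(* Main.v *)
Require Import Defs.
From HB Require Import structures.
From mathcomp Require Import all_boot all_order all_algebra.
From mathcomp Require Import all_classical all_reals all_analysis.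
From mathcomp Require Import complex spectral ring lra.
Set Implicit Arguments.
Unset Strict Implicit.
Unset Printing Implicit Defensive.

Import Order.TTheory GRing.Theory Num.Theory numFieldNormedType.Exports.
Local Open Scope classical_set_scope.
Local Open Scope ring_scope.
Local Open Scope complex_scope.
Local Open Scope sesquilinear_scope.

(* Left multiplication of a section by the half-spin matrix of S trivialises
   the spinor bundle by (-1/2)-Killing spinors: Phi = S_+ phi(S) depends only on
   the base point x of S and, for phi = xi, is a constant unit vector v.
   Extended to be constant along rays, the Dirac equation with eigenvalue lambda
   becomes \sum_(j, l) x_j A_j A'_l d_l Phi = mu Phi with mu = lambda - n/2, where
   A, A' are the off-diagonal blocks of Clifford multiplication on R^(n+1).
   Applying the flat Dirac operator once more, - Delta Phi = mu (mu + n - 1) Phi,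
   so that g = <xi, phi> = <v, Phi> is a spherical harmonic; this gives the
   orthogonality.  With c = mu + n - 1, integration by parts yields
     \int |Phi - g v - c^-1 A(x) A'(grad g) v|^2
       = \int |Phi|^2 - (c + mu) / c \int g^2,
   which is the estimate; in the equality case the integrand vanishes, and
   f = g / c is the required harmonic. *)

(** * Partial derivatives and C^k functions *)

(** The trivialisation works because [horizontal] lifts a great circle by exp (t/2 e_0 e_i): read
    through S_+ along it, the connection becomes d_X - (1/2) X, so that being (-1/2)-Killing means
    having no derivative. Both eigenspaces are one case. On E_k, mu = k and c = n + k - 1; on E_-k,
    mu = - (n + k - 1) and c = - k. In each of them mu c = k (n + k - 1) is positive and c / (c +
    mu) is the claimed constant. The coefficient c^-1 in the residual is the optimal one:
    subtracting t A(x) A'(grad g) v instead contributes (t^2 mu c - 2 t mu) \int g^2, which is least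
    at t = 1 / c. The definitions shape the rest. The integral is iterated in polar coordinates,
    without any visible rotation invariance, so the divergence theorem goes by induction on the
    dimension. Lifts to Spin(n+1) are picked by choice, so smoothness has to be recovered from local
    sections. Partial derivatives are those of real functions, so Phi is tested against
    covectors. *)

Section PartialDerivatives.
Context {R : realType} {m : nat}.
Implicit Types (U V : set 'rV[R]_m) (f g : 'rV[R]_m -> R) (x : 'rV[R]_m).

Lemma near_eq_partial f g x i :
  (\near x, f x = g x) -> partial i f x = partial i g x.
Proof. exact: near_eq_derive. Qed.

Lemma near_eq_differentiable f g x :
  (\near x, f x = g x) -> differentiable f x -> differentiable g x.
Proof.
move=> fg df; have gf : \forall h \near (0 : 'rV[R]_m), g (h + x) = f (h + x).
  rewrite (near_shift x 0)/=; near=> z.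
  rewrite /= sub0r subrK; apply/esym; near: z; exact: fg.
apply/diff_locallyP; have [cdf dfE] := (diff_locallyP x f).1 df.
have fgx := nbhs_singleton fg.
have E : g \o shift x = cst (g x) + 'd f x +o_ (0 : 'rV[R]_m) id.
  apply/eqaddoP => e e0; move/eqaddoP : dfE => /(_ e e0) H.
  near=> h; have -> : (g \o shift x - (cst (g x) + 'd f x)) h =
      (f \o shift x - (cst (f x) + 'd f x)) h.
    by rewrite !fctE /= -fgx; congr (_ - _); near: h; exact: gf.
  near: h; exact: H.
have D : 'd g x = 'd f x :> ('rV[R]_m -> R) by exact: diff_unique.
by rewrite D.
Unshelve. all: by end_near. Qed.

Lemma partialD f g x i : differentiable f x -> differentiable g x ->
  partial i (fun y => f y + g y) x = partial i f x + partial i g x.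
Proof. by move=> df dg; apply: deriveD; exact: diff_derivable. Qed.

Lemma partialM f g x i : differentiable f x -> differentiable g x ->
  partial i (fun y => f y * g y) x = f x * partial i g x + g x * partial i f x.
Proof. by move=> df dg; apply: deriveM; exact: diff_derivable. Qed.

Lemma partialZ a f x i : differentiable f x ->
  partial i (fun y => a * f y) x = a * partial i f x.
Proof. by move=> df; apply: deriveZ; exact: diff_derivable. Qed.

Lemma partial_cst a x i : partial i (fun _ => a) x = 0.
Proof. exact: derive_cst. Qed.

Lemma partialV f x i : f x != 0 -> differentiable f x ->
  partial i (fun y => (f y)^-1) x = - (f x) ^- 2 * partial i f x.
Proof. by move=> fx df; apply: deriveV => //; exact: diff_derivable. Qed.

Lemma derive_sum_partial f x (v : 'rV[R]_m) : differentiable f x ->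
  'D_v f x = \sum_i v 0 i * partial i f x.
Proof.
move=> df; rewrite deriveE// {1}(row_sum_delta v) linear_sum; apply: eq_bigr => i _.
by rewrite linearZ /partial deriveE.
Qed.

Lemma partial_coord i j x : partial i (fun y => y 0 j) x = (i == j)%:R.
Proof.
rewrite /partial -[LHS]/('D_(delta_mx 0 i) (fun y : 'rV[R]_m => y 0 j) x).
rewrite /derive; apply: cvg_lim => //.
apply: cvg_near_cst.
near=> h; rewrite /= !mxE /= addrK eq_sym [_ *: _]mulrA mulVf ?mul1r//.
by near: h; exact: nbhs_dnbhs_neq.
Unshelve. all: by end_near. Qed.

Lemma CkSP k U f : Ck k.+1 U f <->
  (forall x, U x -> differentiable f x) /\ (forall i, Ck k U (partial i f)).
Proof. by []. Qed.

Lemma Ck_continuous k U f : Ck k U f -> forall x, U x -> {for x, continuous f}.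
Proof. by case: k => [//|k] [df _] x Ux; apply: differentiable_continuous; exact: df. Qed.

Lemma CkW k U f : Ck k.+1 U f -> Ck k U f.
Proof.
elim: k f => [|k IH] f; first exact: Ck_continuous.
by move=> [df pf]; split=> [x Ux|i]; [exact: df|apply: IH; exact: pf].
Qed.

Lemma Ck_sub k U V f : V `<=` U -> Ck k U f -> Ck k V f.
Proof.
move=> VU; elim: k f => [|k IH] f /=; first by move=> cf x /VU; exact: cf.
by move=> [df pf]; split => [x /VU/df//|i]; apply: IH.
Qed.

(** Partial derivatives are taken in the whole space, so each clause of [Ck] is a condition at a
    single point. This allows smoothness of the trivialisation to be checked on the domain of one
    local section at a time. *)
Lemma Ck_local k U f :
  (forall x, U x -> exists V, V x /\ Ck k V f) -> Ck k U f.
Proof.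
elim: k f => [|k IH] f H /=; first by move=> x /H[V [Vx]]; exact.
split=> [x /H[V [Vx []]]|i]; first by move=> + _; apply.
by apply: IH => x /H[V [Vx [_ pf]]]; exists V; split=> //; exact: pf.
Qed.

(** Openness turns agreement on [U] into agreement near each point of [U], which derivatives
    require. The closure properties below inherit their openness hypothesis from here. *)
Lemma Ck_ext k U f g : open U -> Ck k U f -> (forall x, U x -> f x = g x) ->
  Ck k U g.
Proof.
move=> oU + + ; elim: k f g => [|k IH] f g cf fg.
  move=> x Ux; rewrite /prop_for /continuous_at -(fg x Ux).
  have nU : nbhs x U by exact: open_nbhs_nbhs.
  apply: cvg_trans (cf x Ux); apply: (@near_eq_cvg _ _ (nbhs x)).
  by apply: filterS nU => y Uy; exact: fg.
have nfg x : U x -> \near x, f x = g x.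
  move=> Ux; have nU : nbhs x U by exact: open_nbhs_nbhs.
  by apply: filterS nU => y Uy; exact/fg.
have /CkSP[df pf] := cf; split=> [x Ux|i].
  by apply: near_eq_differentiable (df _ Ux); exact: nfg.
apply: IH (pf i) _ => x Ux; exact/near_eq_partial/nfg.
Qed.

Lemma Ck_cst k U a : Ck k U (fun _ => a).
Proof.
elim: k a => [|k IH] a; first by move=> x _; exact: (@cst_continuous _ _ a x).
split=> [x _|i]; first exact: differentiable_cst.
have -> : partial i (fun=> a) = fun _ : 'rV[R]_m => 0.
  by apply/funext => x; rewrite partial_cst.
exact: IH.
Qed.

Lemma Ck_coord k U i : Ck k U (fun x => x 0 i).
Proof.
case: k => [|k]; first by move=> x _; exact: coord_continuous.
split=> [x _|j]; first exact: differentiable_coord.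
have -> : partial j (fun x => x 0 i) = fun _ : 'rV[R]_m => (j == i)%:R.
  by apply/funext => x; rewrite partial_coord.
exact: Ck_cst.
Qed.

Lemma CkD k U f g : open U -> Ck k U f -> Ck k U g ->
  Ck k U (fun x => f x + g x).
Proof.
move=> oU; elim: k f g => [|k IH] f g.
  by move=> cf cg x Ux; apply: continuousD; [exact: cf|exact: cg].
move=> /CkSP[df pf] /CkSP[dg pg]; split=> [x Ux|i].
  by apply: differentiableD; [exact: df|exact: dg].
apply: (Ck_ext oU (IH _ _ (pf i) (pg i))) => x Ux.
by rewrite partialD//; [exact: df|exact: dg].
Qed.

Lemma CkM k U f g : open U -> Ck k U f -> Ck k U g ->
  Ck k U (fun x => f x * g x).
Proof.
move=> oU; elim: k f g => [|k IH] f g.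
  by move=> cf cg x Ux; apply: continuousM; [exact: cf|exact: cg].
move=> /[dup] /CkW cf /CkSP[df pf] /[dup] /CkW cg /CkSP[dg pg]; split=> [x Ux|i].
  by apply: differentiableM; [exact: df|exact: dg].
apply: (Ck_ext oU (CkD oU (IH _ _ cf (pg i)) (IH _ _ cg (pf i)))) => x Ux.
by rewrite partialM//; [exact: df|exact: dg].
Qed.

Lemma CkZ k U a f : open U -> Ck k U f -> Ck k U (fun x => a * f x).
Proof. by move=> oU; apply: CkM => //; exact: Ck_cst. Qed.

Lemma CkN k U f : open U -> Ck k U f -> Ck k U (fun x => - f x).
Proof.
move=> oU /(CkZ (-1) oU) cf; apply: (Ck_ext oU cf) => x _; exact: mulN1r.
Qed.

Lemma CkB k U f g : open U -> Ck k U f -> Ck k U g ->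
  Ck k U (fun x => f x - g x).
Proof. by move=> oU cf /(CkN oU); exact: CkD. Qed.

Lemma Ck_sum (I : Type) (r : seq I) (P : pred I) k U (F : I -> 'rV[R]_m -> R) :
  open U -> (forall i, Ck k U (F i)) -> Ck k U (fun x => \sum_(i <- r | P i) F i x).
Proof.
move=> oU cF; elim: r => [|i r IH].
  by apply: (Ck_ext oU (Ck_cst k U 0)) => x _; rewrite big_nil.
apply: (Ck_ext oU (CkD oU (if P i as b return Ck k U (fun x => if b then F i x else 0)
  then cF i else Ck_cst k U 0) IH)) => x _.
by rewrite big_cons; case: (P i) => //; rewrite add0r.
Qed.

(** The derivative of 1/f is a product of f' with two copies of 1/f, which the induction hypothesis
    already makes C^k. The square root below bootstraps in the same way. *)
Lemma CkV k U f : open U -> (forall x, U x -> f x != 0) -> Ck k U f ->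
  Ck k U (fun x => (f x)^-1).
Proof.
move=> oU f0; elim: k => [|k IH].
  by move=> cf x Ux; apply: continuousV; [exact: f0|exact: cf].
move=> /[dup] /CkW/IH cV /CkSP[df pf]; split=> [x Ux|i].
  by apply: differentiableV; [exact: df|exact: f0].
apply: (Ck_ext oU (CkM oU (CkN oU (CkM oU cV cV)) (pf i))) => x Ux.
by rewrite partialV ?f0//; [rewrite -expr2 exprVn|exact: df].
Qed.

Lemma partial_sqrt f x i : 0 < f x -> differentiable f x ->
  partial i (fun y => Num.sqrt (f y)) x = (2 * Num.sqrt (f x))^-1 * partial i f x.
Proof.
move=> fx df; have := is_derive1_sqrt fx => -[dv De].
have ds : differentiable (Num.sqrt : R -> R) (f x) by apply/derivable1_diffP.
rewrite /partial deriveE; last exact: differentiable_comp.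
rewrite [LHS](congr1 (fun h => h (delta_mx 0 i)) (diff_comp df ds)) /=.
rewrite deriv1E// derive1E De deriveE//; exact: mulrC.
Qed.

Lemma Ck_sqrt k U f : open U -> (forall x, U x -> 0 < f x) -> Ck k U f ->
  Ck k U (fun x => Num.sqrt (f x)).
Proof.
move=> oU f0; elim: k => [|k IH].
  move=> cf x Ux; apply: continuous_comp; [exact: cf|exact: sqrt_continuous].
move=> /[dup] /CkW/IH cV /CkSP[df pf]; split=> [x Ux|i].
  apply: (@differentiable_comp _ _ _ _ f (Num.sqrt : R -> R)); first exact: df.
  by apply/derivable1_diffP; have [] := is_derive1_sqrt (f0 x Ux).
have c2 := CkZ 2 oU cV.
have n0 x : U x -> 2 * Num.sqrt (f x) != 0.
  by move=> Ux; rewrite mulf_neq0 ?pnatr_eq0 ?sqrtr_eq0 -?ltNge ?f0.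
apply: (Ck_ext oU (CkM oU (CkV oU n0 c2) (pf i))) => x Ux.
by rewrite partial_sqrt ?f0//; exact: df.
Qed.

End PartialDerivatives.

(** * Chain rule in coordinates *)

Section ChainRule.
Context {R : realType}.

Lemma differentiable_rV (V : normedModType R) m (H : V -> 'rV[R]_m) x :
  (forall i, differentiable (fun y => H y 0 i) x) -> differentiable H x.
Proof.
move=> dH.
have -> : H = fun y => \sum_i H y 0 i *: (delta_mx 0 i : 'rV[R]_m).
  by apply/funext => y; rewrite {1}(row_sum_delta (H y)).
have -> : (fun y => \sum_i H y 0 i *: (delta_mx 0 i : 'rV[R]_m)) =
   \sum_i (fun y => H y 0 i *: (delta_mx 0 i : 'rV[R]_m)).
  by apply/funext => y; rewrite fct_sumE.
by apply: differentiable_sum => i; exact: differentiableZl.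
Qed.

(** The source is any normed module, so that one chain rule serves both curves and maps between row
    spaces. *)
Lemma is_derive_comp_rV (V : normedModType R) m (H : V -> 'rV[R]_m)
    (f : 'rV[R]_m -> R) x v (dH : 'I_m -> R) :
  (forall i, differentiable (fun y => H y 0 i) x) ->
  (forall i, 'D_v (fun y => H y 0 i) x = dH i) ->
  differentiable f (H x) ->
  is_derive x v (fun y => f (H y)) (\sum_i dH i * partial i f (H x)).
Proof.
move=> dHx DH df; have dH' := differentiable_rV dHx.
have dc := differentiable_comp dH' df.
apply: DeriveDef; first exact: diff_derivable.
rewrite deriveE// [LHS](congr1 (fun h => h v) (diff_comp dH' df)) /=.
rewrite -(deriveE v dH') derive_mx; last exact: diff_derivable.
rewrite -deriveE// derive_sum_partial//; apply: eq_bigr => i _.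
by rewrite mxE -DH.
Qed.

Lemma differentiable_comp_rV (V : normedModType R) m (H : V -> 'rV[R]_m)
    (f : 'rV[R]_m -> R) x :
  (forall i, differentiable (fun y => H y 0 i) x) ->
  differentiable f (H x) -> differentiable (fun y => f (H y)) x.
Proof. by move=> /differentiable_rV dH df; apply: differentiable_comp. Qed.

Lemma is_derive_curve m (H : R -> 'rV[R]_m) (f : 'rV[R]_m -> R) (t : R) (v : 'rV[R]_m) :
  (forall i, is_derive t 1 (fun y : R => H y 0 i) (v 0 i)) ->
  differentiable f (H t) ->
  is_derive t 1 (fun y => f (H y)) (\sum_i v 0 i * partial i f (H t)).
Proof.
move=> dH df; apply: is_derive_comp_rV => // i; last exact: derive_val.
exact/derivable1_diffP.
Qed.

End ChainRule.

(** * Symmetry of second partial derivatives *)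

Section Schwarz.
Context {R : realType} {m : nat}.
Implicit Types (U : set 'rV[R]_m) (f : 'rV[R]_m -> R).

Let e (i : 'I_m) : 'rV[R]_m := delta_mx 0 i.

Lemma is_derive_line f (x : 'rV[R]_m) (t : R) i :
  differentiable f (x + t *: e i) ->
  is_derive t 1 (fun s : R => f (x + s *: e i)) (partial i f (x + t *: e i)).
Proof.
move=> df; have := @is_derive_curve R m (fun s => x + s *: e i) f t (e i).
rewrite (bigD1 i)//= big1 ?addr0.
  rewrite [e i 0 i]mxE !eqxx mul1r; apply => // j.
  have -> : (fun y : R => (x + y *: e i) 0 j) = (fun y : R => x 0 j + e i 0 j * y).
    by apply/funext => y; rewrite !mxE mulrC.
  by apply: is_derive_eq; rewrite add0r mul1r [_%:A]mulr1.
by move=> j ji; rewrite mxE (negbTE ji) andbF mul0r.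
Qed.

(** The mean value theorem is used twice: along i for the increment of f in direction j, then along
    j for the i-th partial derivative. *)
Lemma second_difference f (x : 'rV[R]_m) (h : R) i j : 0 < h ->
  (forall s t, 0 <= s <= h -> 0 <= t <= h ->
     differentiable f (x + s *: e i + t *: e j) /\
     differentiable (partial i f) (x + s *: e i + t *: e j)) ->
  exists s t, [/\ 0 <= s <= h, 0 <= t <= h &
    f (x + h *: e i + h *: e j) - f (x + h *: e i) - (f (x + h *: e j) - f x) =
    partial j (partial i f) (x + s *: e i + t *: e j) * h ^+ 2].
Proof.
move=> h0 df; have hh : 0 <= h <= h by apply/andP; split=> //; exact: ltW.
have z0 : 0 <= (0 : R) <= h by apply/andP; split=> //; exact: ltW.
pose g s := f (x + s *: e i + h *: e j) - f (x + s *: e i).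
pose dg s := partial i f (x + s *: e i + h *: e j) - partial i f (x + s *: e i).
have gd s : 0 <= s <= h -> is_derive s 1 g (dg s).
  move=> sh; apply: is_deriveB.
    have -> : (fun s0 : R => f (x + s0 *: e i + h *: e j)) =
              fun s0 : R => f ((x + h *: e j) + s0 *: e i).
      by apply/funext => s'; rewrite addrAC.
    rewrite addrAC; apply: is_derive_line; rewrite addrAC.
    by have [] := df _ _ sh hh.
  apply: is_derive_line.
  by have [] := df _ _ sh z0; rewrite scale0r addr0.
have [|| s sh gs] := @MVT_segment _ g dg 0 h (ltW h0).
- by move=> s /subset_itv_oo_cc; rewrite in_itv/=; exact: gd.
- apply: derivable_within_continuous => s; rewrite in_itv/= => /gd dgs.
  exact: ex_derive.
pose k t := partial i f (x + s *: e i + t *: e j).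
have [||t th kt] := @MVT_segment _ k
   (fun t => partial j (partial i f) (x + s *: e i + t *: e j)) 0 h (ltW h0).
- move=> t /subset_itv_oo_cc; rewrite in_itv/= => th.
  by apply: is_derive_line; have [] := df _ _ sh th.
- apply: derivable_within_continuous => t; rewrite in_itv/= => th.
  apply: (@ex_derive _ _ _ _ _ _ _ (is_derive_line _)).
  by have [] := df _ _ sh th.
exists s, t; split => //.
have -> : f (x + h *: e i + h *: e j) - f (x + h *: e i) - (f (x + h *: e j) - f x)
   = g h - g 0.
  by rewrite /g scale0r addr0.
rewrite gs subr0 expr2 mulrA; congr (_ * _).
by move: kt; rewrite /k /dg scale0r !addr0 subr0.
Qed.

(** The second difference over a small square is symmetric in the two directions. Divided by h^2 it
    is a value of either mixed derivative at a nearby point, and both are continuous. *)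
Lemma partialC f U i j x : open U -> Ck 2 U f -> U x ->
  partial i (partial j f) x = partial j (partial i f) x.
Proof.
move=> oU /CkSP[df pf] Ux.
have dp l y : U y -> differentiable (partial l f) y.
  by have /CkSP[+ _] := pf l; exact.
have cpp k l : {for x, continuous (partial k (partial l f))}.
  by have /CkSP[_ /(_ k)] := pf l; exact.
suff H k l (eps : R) : 0 < eps -> \forall h \near 0^'+,
    exists2 c, `|c - partial l (partial k f) x| < eps &
    f (x + h *: e k + h *: e l) - f (x + h *: e k) - (f (x + h *: e l) - f x) =
    c * h ^+ 2.
  apply/eqP; rewrite -subr_eq0 -normr_le0; apply/ler_addgt0Pl => eps eps0.
  rewrite addr0; have e2 : 0 < eps / 2 by rewrite divr_gt0.
  near (0 : R)^'+ => h.
  have h0 : h != 0 by [].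
  have [] : (exists2 c, `|c - partial j (partial i f) x| < eps / 2 &
    f (x + h *: e i + h *: e j) - f (x + h *: e i) - (f (x + h *: e j) - f x) =
    c * h ^+ 2) by near: h; exact: H.
  move=> c1 c1x c1E.
  have [] : (exists2 c, `|c - partial i (partial j f) x| < eps / 2 &
    f (x + h *: e j + h *: e i) - f (x + h *: e j) - (f (x + h *: e i) - f x) =
    c * h ^+ 2) by near: h; exact: H.
  move=> c2 c2x c2E.
  have c12 : c1 = c2.
    apply: (mulIf (expf_neq0 2 h0)); rewrite -c1E -c2E (addrAC x).
    ring.
  rewrite -c12 distrC in c2x.
  rewrite (splitr eps) -(subrKA c1) (le_trans (ler_normD _ _))// lerD// ltW//.
move=> eps0.
have nU : nbhs x U by exact: open_nbhs_nbhs.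
have /cvgrPdist_lt/(_ _ eps0) nc := cpp l k.
have nn := @filterI _ _ (nbhs_filter x) _ _ nU nc.
have [d /= d0 dB] := (nbhs_ballP _ _).1 nn.
near=> h.
have h0 : 0 < h by [].
have hd : h < d / 2 by near: h; apply: nbhs_right_lt; rewrite divr_gt0.
have inB s t : 0 <= s <= h -> 0 <= t <= h -> ball x d (x + s *: e k + t *: e l).
  move=> /andP[s0 sh] /andP[t0 th]; rewrite -ball_normE /= -addrA opprD addNKr normrN.
  rewrite (le_lt_trans (ler_normD _ _))// !normrZ (splitr d).
  have ne a : `|e a| <= 1.
    rewrite /Num.Def.normr/= mx_normrE; apply: bigmax_le => // p _.
    by rewrite mxE; case: (_ && _); rewrite ?normr1 ?normr0.
  rewrite !ger0_norm//; apply: ltrD.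
    by rewrite (le_lt_trans _ hd)// (le_trans _ sh)// ler_piMr.
  by rewrite (le_lt_trans _ hd)// (le_trans _ th)// ler_piMr.
have [|s [t [sh th ->]]] := @second_difference f x h k l h0.
  by move=> s t sh th; have [Uy _] := dB _ (inB _ _ sh th); split; [exact: df|exact: dp].
exists (partial l (partial k f) (x + s *: e k + t *: e l)) => //.
by have [_] := dB _ (inB _ _ sh th); rewrite /= distrC.
Unshelve. all: by end_near. Qed.

End Schwarz.

(** * Homogeneous functions on the punctured space *)

Section Dot.
Context {R : realType} {m : nat}.
Implicit Types (x y z : 'rV[R]_m) (c : R).

Lemma dotC x y : dot x y = dot y x.
Proof. by apply: eq_bigr => i _; rewrite mulrC. Qed.

Lemma dotDr x y z : dot x (y + z) = dot x y + dot x z.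
Proof. by rewrite -big_split; apply: eq_bigr => i _; rewrite mxE mulrDr. Qed.

Lemma dotZr x c y : dot x (c *: y) = c * dot x y.
Proof. by rewrite mulr_sumr; apply: eq_bigr => i _; rewrite mxE mulrCA. Qed.

Lemma dotDl x y z : dot (x + y) z = dot x z + dot y z.
Proof. by rewrite dotC dotDr !(dotC z). Qed.

Lemma dotZl c x y : dot (c *: x) y = c * dot x y.
Proof. by rewrite dotC dotZr dotC. Qed.

Lemma dotNl x y : dot (- x) y = - dot x y.
Proof. by rewrite -scaleN1r dotZl mulN1r. Qed.

Lemma dotNr x y : dot x (- y) = - dot x y.
Proof. by rewrite dotC dotNl dotC. Qed.

Lemma dot_delta x i : dot x (delta_mx 0 i) = x 0 i.
Proof.
rewrite /dot (bigD1 i)//= big1 ?addr0 ?mxE ?eqxx ?mulr1// => j ji.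
by rewrite mxE (negbTE ji) andbF mulr0.
Qed.

Lemma dot_ge0 x : 0 <= dot x x.
Proof. by apply: sumr_ge0 => i _; rewrite -expr2 sqr_ge0. Qed.

Lemma dot_eq0 x : (dot x x == 0) = (x == 0).
Proof.
apply/eqP/eqP => [|->]; last by rewrite /dot big1// => i _; rewrite mxE mul0r.
move/eqP; rewrite psumr_eq0 => [/allP x0|i _]; last by rewrite -expr2 sqr_ge0.
apply/rowP => i; rewrite mxE; apply/eqP.
by have := x0 i (mem_index_enum _); rewrite /= mulf_eq0 orbb.
Qed.

Lemma dot_gt0 x : x != 0 -> 0 < dot x x.
Proof. by move=> x0; rewrite lt_def dot_ge0 dot_eq0 x0. Qed.

Lemma enorm_gt0 x : x != 0 -> 0 < enorm x.
Proof. by move=> x0; rewrite sqrtr_gt0 dot_gt0. Qed.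

Lemma sqr_enorm x : enorm x ^+ 2 = dot x x.
Proof. by rewrite sqr_sqrtr// dot_ge0. Qed.

Lemma enormZ c x : 0 < c -> enorm (c *: x) = c * enorm x.
Proof.
move=> c0; rewrite /enorm dotZl dotZr mulrA -expr2 sqrtrM ?sqr_ge0//.
by rewrite sqrtr_sqr gtr0_norm.
Qed.

End Dot.

Section Radial.
Context {R : realType} {m : nat}.
Implicit Types (f : 'rV[R]_m -> R) (x : 'rV[R]_m).

Definition punctured : set 'rV[R]_m := [set x | x != 0].

Lemma open_punctured : open punctured.
Proof.
rewrite (_ : punctured = ~` [set 0]); last first.
  by apply/seteqP; split=> x /= /eqP.
apply: closed_openC; apply: accessible_closed_set1; apply: hausdorff_accessible.
exact: norm_hausdorff.
Qed.

Definition homogeneous0 f := forall (c : R) x, 0 < c -> f (c *: x) = f x.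

Lemma partial_homogeneous0 f (c : R) x i : homogeneous0 f -> 0 < c ->
  differentiable f (c *: x) -> partial i f (c *: x) = c^-1 * partial i f x.
Proof.
move=> hf c0 df.
have H : 'D_(delta_mx 0 i) (fun y => f (c *: y)) x = c * partial i f (c *: x).
  rewrite (@derive_val _ _ _ _ _ _ _ (@is_derive_comp_rV _ _ _
    (fun y => c *: y) f x (delta_mx 0 i) (fun j => c * (i == j)%:R) _ _ df)).
  - rewrite (bigD1 i)//= eqxx mulr1 big1 ?addr0// => j /negbTE ji.
    by rewrite eq_sym ji mulr0 mul0r.
  - move=> j; rewrite (_ : (fun y : 'rV[R]_m => (c *: y) 0 j) = fun y => c * y 0 j).
      exact/differentiableZ/differentiable_coord.
    by apply/funext => y; rewrite mxE.
  - move=> j; rewrite (_ : (fun y : 'rV[R]_m => (c *: y) 0 j) = fun y => c * y 0 j).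
      by rewrite -(partial_coord i j x); apply: partialZ; exact: differentiable_coord.
    by apply/funext => y; rewrite mxE.
apply: (mulfI (lt0r_neq0 c0)); rewrite -H mulVKf ?gt_eqF//.
by congr ('D_ _ _ _); apply/funext => y; exact: hf.
Qed.

Lemma euler f x : homogeneous0 f -> differentiable f x ->
  \sum_i x 0 i * partial i f x = 0.
Proof.
move=> hf df; rewrite -derive_sum_partial// /derive; apply: cvg_lim => //.
apply: cvg_near_cst; near=> h.
(* For |h| < 1 the factor h + 1 is positive, so homogeneity makes the difference quotient vanish
   identically near 0. *)
rewrite /= -[X in h *: x + X]scale1r -scalerDl hf ?subrr ?scaler0//.
have : `|h| < 1 by near: h; exact: dnbhs0_lt.
by rewrite ltr_norml => /andP[]; lra.
Unshelve. all: by end_near. Qed.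

End Radial.

Section SphereCalculus.
Context {R : realType} {n : nat}.
Implicit Types (f g : 'rV[R]_n.+1 -> R) (x : 'rV[R]_n.+1).
Local Notation U := (@punctured R n.+1).

Lemma Ck_dot k : Ck k U (fun x : 'rV[R]_n.+1 => dot x x).
Proof.
by apply: Ck_sum => [|i]; [|apply: CkM]; try exact: open_punctured; exact: Ck_coord.
Qed.

Lemma partial_dot i x : partial i (fun y : 'rV[R]_n.+1 => dot y y) x = 2 * x 0 i.
Proof.
have dc j y : differentiable (fun z : 'rV[R]_n.+1 => z 0 j) y.
  exact: differentiable_coord.
have -> : (fun y : 'rV[R]_n.+1 => dot y y) =
    \sum_j (fun y : 'rV[R]_n.+1 => y 0 j * y 0 j).
  by apply/funext => y; rewrite fct_sumE.
rewrite [LHS]derive_sum => [|j]; last first.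
  by apply: diff_derivable; apply: differentiableM.
rewrite (bigD1 i)//= big1 ?addr0 => [|j /negbTE ji].
  by rewrite [LHS](partialM i (dc i x) (dc i x)) partial_coord eqxx mulr1; ring.
by rewrite [LHS](partialM i (dc j x) (dc j x)) partial_coord eq_sym ji !mulr0 addr0.
Qed.

Lemma Ck_enorm k : Ck k U (@enorm R n.+1).
Proof.
apply: Ck_sqrt (Ck_dot k) => [|x]; [exact: open_punctured|exact: dot_gt0].
Qed.

Lemma sphere_punctured x : sphere x -> U x.
Proof.
rewrite /sphere /punctured /= => x1; apply/eqP => x0; move: x1; rewrite x0.
by move/eqP; rewrite (eqP (_ : dot 0 0 == 0)) ?dot_eq0// eq_sym oner_eq0.
Qed.

Lemma enorm_sphere x : sphere x -> enorm x = 1.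
Proof. by rewrite /enorm => ->; rewrite sqrtr1. Qed.

Lemma normalize_sphere x : U x -> sphere ((enorm x)^-1 *: x).
Proof.
move=> x0; rewrite /sphere /= dotZl dotZr -sqr_enorm mulrA -expr2 exprVn mulVf//.
by rewrite sqrf_eq0 gt_eqF// enorm_gt0.
Qed.

Lemma radial_homogeneous0 f : homogeneous0 (radial f).
Proof.
move=> c x c0; rewrite /radial enormZ// scalerA; congr (f (_ *: _)).
by rewrite invfM mulrAC mulVf ?mul1r// gt_eqF.
Qed.

Lemma radial_of_homogeneous0 f x : homogeneous0 f -> U x -> radial f x = f x.
Proof. by move=> hf x0; rewrite /radial hf// invr_gt0 enorm_gt0. Qed.

Lemma near_punctured x (P : 'rV[R]_n.+1 -> Prop) :
  U x -> (forall y, U y -> P y) -> \near x, P x.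
Proof.
move=> Ux UP; have nU : nbhs x U by apply: open_nbhs_nbhs; split=> //; exact: open_punctured.
by apply: filterS nU.
Qed.

(** The components of the Euclidean gradient have degree -1, so making them constant along rays
    multiplies them by [enorm]. Differentiating this factor yields only \sum_i x_i d_i f, which is 0
    by Euler's identity. *)
Lemma laplacian_homogeneous0 f x : homogeneous0 f -> Ck 2 U f -> sphere x ->
  laplacian f x = \sum_i partial i (partial i f) x.
Proof.
move=> hf f2 x1; have Ux := sphere_punctured x1.
have /CkSP[df pf] := f2.
have dp i y : U y -> differentiable (partial i f) y by have /CkSP[+ _] := pf i; exact.
have de y : U y -> differentiable (@enorm R n.+1) y.
  by have /CkSP[+ _] := Ck_enorm 1; exact.
have gE i y : U y -> radial (fun z => grad f z 0 i) y = enorm y * partial i f y.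
  move=> Uy; rewrite /radial mxE.
  have Uy' := sphere_punctured (normalize_sphere Uy).
  have -> : partial i (radial f) ((enorm y)^-1 *: y) = partial i f ((enorm y)^-1 *: y).
    by apply: near_eq_partial; apply: near_punctured => // z; exact: radial_of_homogeneous0.
  have e0 : 0 < (enorm y)^-1 by rewrite invr_gt0 enorm_gt0.
  by rewrite partial_homogeneous0 ?invrK//; exact: df.
rewrite /laplacian /div.
under eq_bigr => i _.
  rewrite (near_eq_partial i (near_punctured Ux (gE i))).
  rewrite partialM; [|exact: de|exact: dp].
  rewrite enorm_sphere// mul1r partial_sqrt ?dot_gt0//; last first.
    by have /CkSP[+ _] := Ck_dot 1; exact.
  rewrite x1 sqrtr1 mulr1 partial_dot mulKf ?pnatr_eq0//.
  over.
rewrite big_split /=; under [X in _ + X]eq_bigr do rewrite mulrC.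
by rewrite euler ?addr0//; exact: df.
Qed.

Lemma grad_homogeneous0 f x i : homogeneous0 f -> U x -> grad f x 0 i = partial i f x.
Proof.
move=> hf Ux; rewrite mxE; apply: near_eq_partial; apply: near_punctured => // z.
exact: radial_of_homogeneous0.
Qed.

End SphereCalculus.

(** * The iterated polar integral *)

Section IntervalIntegral.
Context {R : realType}.
Local Notation mu := (@lebesgue_measure R).

Lemma continuous_integrable_segment (f : R -> R) (a b : R) : continuous f ->
  mu.-integrable `[a, b] (EFin \o f).
Proof.
move=> cf; apply: continuous_compact_integrable; first exact: segment_compact.
exact: continuous_subspaceT.
Qed.

Lemma Rintegral_parameter_continuous (X : topologicalType) (g : X -> R -> R) (a b : R) :
  a <= b -> (forall x t, {for (x, t), continuous (fun p => g p.1 p.2)}) ->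
  continuous (fun x => \int[mu]_(t in `[a, b]) g x t).
Proof.
move=> ab cg x.
have cgx y : continuous (g y).
  move=> t; apply: (@continuous2_cvg _ _ _ _ (nbhs t) _ (fun=> y) id g y t).
  - exact: cg.
  - exact: cvg_cst.
  - exact: cvg_id.
have mu_ab : fine (mu `[a, b]) = b - a.
  by rewrite lebesgue_measure_itv/= lte_fin; case: ltgtP ab => //= ->; rewrite subrr.
apply/cvgrPdist_le => e e0.
(* The added 1 keeps the denominator positive when a = b. *)
have d0 : 0 < e / (b - a + 1) by rewrite divr_gt0// ltr_wpDl// subr_ge0.
(* Compactness of the segment provides one neighbourhood of x that works for every t; no metric on
   [X] enters. *)
have NC := (compact_near_coveringP `[a, b]).1 (@segment_compact _ a b)
  X (nbhs x) (fun y t => `|g x t - g y t| <= e / (b - a + 1)) (nbhs_filter x).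
apply: filterS (NC _) => [y Hy|t _]; last first.
  have d20 : 0 < e / (b - a + 1) / 2 by rewrite divr_gt0.
  have /cvgrPdist_lt/(_ _ d20) := cgx x t.
  have /cvgrPdist_lt/(_ _ d20) [[A B] /= [Ax Bt] AB] := cg x t.
  move=> H; exists (B `&` [set u | `|g x t - g x u| < e / (b - a + 1) / 2], A) => /=.
    by split=> //; exact: filterI.
  move=> [u y] /= [[Bu gu] Ay]; rewrite distrC in gu.
  rewrite (splitr (e / _)) -(subrKA (g x t)) (le_trans (ler_normD _ _))// lerD// ltW//.
  exact: (AB (y, u)).
rewrite -RintegralB//; [|exact: continuous_integrable_segment..].
have cB : continuous (fun t => g x t - g y t).
  by move=> t; apply: continuousB; exact: cgx.
apply: (le_trans (le_normr_Rintegral _ _)) => //; first exact: continuous_integrable_segment.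
apply: (@le_trans _ _ (\int[mu]_(t in `[a, b]) (e / (b - a + 1)))).
  apply: le_Rintegral => //.
  - apply: continuous_integrable_segment => t.
    by apply: cvg_norm; exact: cB.
  - by apply: continuous_integrable_segment => t; exact: cst_continuous.
rewrite Rintegral_cst// [fine _]mu_ab mulrAC ler_pdivrMr ?ltr_wpDl ?subr_ge0//.
by rewrite ler_pM2l// lerDl.
Qed.

Lemma Rintegral_parameter_is_derive (g dg : R -> R -> R) (a b t0 : R) :
  a <= b -> (forall t, continuous (g t)) ->
  (forall t s, {for (t, s), continuous (fun p => dg p.1 p.2)}) ->
  (forall t s : R, is_derive t 1 (g ^~ s) (dg t s)) ->
  is_derive t0 1 (fun t => \int[mu]_(s in `[a, b]) g t s)
    (\int[mu]_(s in `[a, b]) dg t0 s).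
Proof.
move=> ab cg cdg gd.
have I0 : t0 \in `]t0 - 1, t0 + 1[ by rewrite in_itv/= ltrBlDr ltrDl ltr01.
have cK : compact (`[t0 - 1, t0 + 1]%classic `*` `[a, b]%classic : set (R * R)).
  by apply: compact_setX; exact: segment_compact.
have cc : compact ((fun p : R * R => dg p.1 p.2) @`
    (`[t0 - 1, t0 + 1]%classic `*` `[a, b]%classic)).
  apply: continuous_compact => //; apply: continuous_subspaceT.
  by move=> [t s]; exact: cdg.
have [M [_ HM]] := compact_bounded cc.
(* The constant [B] dominates the derivative on the compact box: the maximum makes it nonnegative,
   and the 1 puts it strictly above [M], as [compact_bounded] demands. *)
pose B := Num.max M 0 + 1.
have MB : M < B by rewrite /B ltr_pwDr// le_max lexx.
have B0 : 0 <= B by rewrite addr_ge0// le_max lexx orbT.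
have D1 t s : partial1of2 g t s = dg t s.
  by rewrite partial1of2E derive_val.
have intg x : `]t0 - 1, t0 + 1[%classic x -> mu.-integrable `[a, b] (EFin \o g x).
  by move=> _; exact: continuous_integrable_segment.
have derg x y : `]t0 - 1, t0 + 1[%classic x -> `[a, b]%classic y ->
    derivable (g ^~ y) x 1 by move=> _ _; exact: ex_derive.
have intB : mu.-integrable `[a, b] (EFin \o (fun _ : R => B)).
  by apply: continuous_integrable_segment => ?; exact: cst_continuous.
have gB x y : `]t0 - 1, t0 + 1[%classic x -> `[a, b]%classic y -> `|partial1of2 g x y| <= B.
  move=> xI yI; rewrite D1; apply: (HM _ MB); exists (x, y) => //=; split => //.
  by apply: subset_itv_oo_cc.
have mI := measurable_itv `[a, b].
apply: DeriveDef.
  exact: (derivable_under_integral (mu := mu) mI I0 intg derg (fun=> B0) intB gB).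
rewrite -derive1E (differentiation_under_integral (mu := mu) mI I0 intg derg (fun=> B0) intB gB).
by apply: eq_Rintegral => s _; rewrite D1.
Qed.

Lemma Rintegral_derive (F f : R -> R) (a b : R) : a < b -> continuous f ->
  (forall t : R, is_derive t 1 F (f t)) ->
  \int[mu]_(t in `[a, b]) f t = F b - F a.
Proof.
move=> ab cf dF; have dF' t : derivable F t 1 by exact: ex_derive.
have cF t : {for t, continuous F}.
  by apply: differentiable_continuous; exact/derivable1_diffP.
rewrite /Rintegral (continuous_FTC2 ab (F := F))//.
- exact: continuous_subspaceT.
- split=> [t _||].
  + exact: dF'.
  + by apply: cvg_at_right_filter; exact: cF.
  + by apply: cvg_at_left_filter; exact: cF.
- by move=> t _; rewrite derive1E derive_val.
Qed.

Lemma Rintegral_eq0 (f : R -> R) (a b : R) : a < b -> continuous f ->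
  (forall t, t \in `[a, b] -> 0 <= f t) ->
  \int[mu]_(t in `[a, b]) f t = 0 -> forall t, t \in `[a, b] -> f t = 0.
Proof.
move=> ab cf f0 If t1 t1ab; apply/eqP; apply: contraT => ft1.
have {ft1} ft1 : 0 < f t1 by rewrite lt_def ft1 f0.
have e0 : 0 < f t1 / 2 by rewrite divr_gt0.
have /cvgrPdist_lt/(_ _ e0) := cf t1 => /nbhs_ballP[d /= d0 dB].
(* The interval of radius d/2 about t1 is clipped to [a, b]. It stays nondegenerate when t1 is an
   endpoint, and f is at least f t1 / 2 on it. *)
pose c := Num.max a (t1 - d / 2); pose c' := Num.min b (t1 + d / 2).
move: t1ab; rewrite in_itv/= => /andP[at1 t1b].
have d20 : 0 < d / 2 by rewrite divr_gt0.
have cc' : c < c'.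
  rewrite lt_min !gt_max ab/=; apply/andP; split; first lra.
  by apply/andP; split; lra.
have sub t : t \in `[c, c'] -> t \in `[a, b] /\ f t1 / 2 <= f t.
  rewrite !in_itv/= ge_max le_min => /andP[/andP[at_ tc] /andP[tb tc']].
  rewrite at_ tb; split=> //.
  have /dB /= : ball t1 d t.
    by rewrite -ball_normE/= ltr_norml; apply/andP; split; lra.
  by rewrite ltr_norml => /andP[]; lra.
have : 0 < \int[mu]_(t in `[c, c']) f t.
  apply: (@lt_le_trans _ _ (\int[mu]_(t in `[c, c']) (f t1 / 2))).
    rewrite Rintegral_cst// [X in fine X]lebesgue_measure_itv/= lte_fin cc'/=.
    by rewrite mulr_gt0// subr_gt0.
  apply: le_Rintegral => //.
  - by apply: continuous_integrable_segment => ?; exact: cst_continuous.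
  - exact: continuous_integrable_segment.
  - by move=> t /= /sub[].
move=> Icc'; suff Ile : \int[mu]_(t in `[c, c']) f t <= \int[mu]_(t in `[a, b]) f t.
  by move: (lt_le_trans Icc' Ile); rewrite If ltxx.
rewrite /Rintegral fine_le//.
- apply: integrable_fin_num => //; exact: continuous_integrable_segment.
- apply: integrable_fin_num => //; exact: continuous_integrable_segment.
- apply: ge0_subset_integral => //.
  + by apply: (measurable_int mu); exact: continuous_integrable_segment.
  + by move=> t /= /sub[].
Qed.

End IntervalIntegral.

(** * Continuity, linearity, positivity and parameter derivatives of the sphere integral *)

Section SphereIntegral.
Context {R : realType}.
Local Notation mu := (@lebesgue_measure R).

Definition polar {m} (t : R) (w : 'rV[R]_m.+1) : 'rV[R]_m.+2 :=
  row_mx (const_mx (cos t) : 'rV_1) (sin t *: w).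

Lemma sphere_intS m (f : 'rV[R]_m.+2 -> R) :
  sphere_int f = \int[mu]_(t in `[0%R, pi])
    (sin t ^+ m * sphere_int (fun w : 'rV[R]_m.+1 => f (polar t w))).
Proof. by []. Qed.

Lemma polar_ord0 m t (w : 'rV[R]_m.+1) : polar t w 0 ord0 = cos t.
Proof.
have := row_mxEl (const_mx (cos t) : 'rV[R]_1) (sin t *: w) 0 ord0.
by rewrite [RHS]mxE => <-; congr (row_mx _ _ _ _); exact: val_inj.
Qed.

Lemma polar_lift m t (w : 'rV[R]_m.+1) i : polar t w 0 (lift ord0 i) = sin t * w 0 i.
Proof.
have := row_mxEr (const_mx (cos t) : 'rV[R]_1) (sin t *: w) 0 i.
by rewrite [RHS]mxE => <-; congr (row_mx _ _ _ _); exact: val_inj.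
Qed.

Lemma dot_polar m t (w : 'rV[R]_m.+1) :
  dot (polar t w) (polar t w) = cos t ^+ 2 + sin t ^+ 2 * dot w w.
Proof.
rewrite {1}/dot big_ord_recl polar_ord0 -expr2; congr (_ + _).
rewrite mulr_sumr; apply: eq_bigr => i _; rewrite polar_lift; ring.
Qed.

Lemma sphere_polar m t (w : 'rV[R]_m.+1) : sphere w -> sphere (polar t w).
Proof. by rewrite /sphere /= dot_polar => ->; rewrite mulr1 cos2Dsin2. Qed.

Lemma polar_punctured m t (w : 'rV[R]_m.+1) : punctured w -> punctured (polar t w).
Proof.
rewrite /punctured /= => w0; rewrite -dot_eq0 dot_polar gt_eqF//.
have [s0|s0] := eqVneq (sin t) 0.
  by have := cos2Dsin2 t; rewrite s0 expr0n /= addr0 mul0r addr0 => ->.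
by rewrite ltr_wpDl ?sqr_ge0// mulr_gt0 ?dot_gt0// exprn_even_gt0.
Qed.

Lemma sphere_const (a : R) : a ^+ 2 = 1 -> sphere (const_mx a : 'rV[R]_1).
Proof. by rewrite /sphere /= /dot big_ord1 !mxE => <-. Qed.

Lemma eq_sphere_int m (f g : 'rV[R]_m.+1 -> R) :
  (forall w, sphere w -> f w = g w) -> sphere_int f = sphere_int g.
Proof.
elim: m f g => [|m IH] f g fg.
  by rewrite /= !fg//; apply: sphere_const; rewrite ?sqrrN expr1n.
rewrite !sphere_intS; apply: eq_Rintegral => t _; congr (_ * _).
by apply: IH => w w1; rewrite fg//; exact: sphere_polar.
Qed.

(** Joint continuity is asked only over the sphere, since the integrands are controlled only away
    from the origin. The parameter space is arbitrary so that it can absorb polar angles. *)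
Definition sphere_continuous (X : topologicalType) m (F : X -> 'rV[R]_m.+1 -> R) :=
  forall x w, sphere w ->
    {for (x, w), continuous (fun p : X * 'rV[R]_m.+1 => F p.1 p.2)}.

Lemma continuous_rV (X : topologicalType) m (H : X -> 'rV[R]_m) x :
  (forall i, {for x, continuous (fun y => H y 0 i)}) -> {for x, continuous H}.
Proof.
move=> cH; apply/cvgrPdist_le => e e0.
have K i : \forall y \near x, `|H x 0 i - H y 0 i| <= e.
  by have /cvgrPdist_le := cH i; exact.
have {}K : \forall y \near x, forall i, `|H x 0 i - H y 0 i| <= e.
  by apply: filter_forall => i; exact: K.
near=> y; have Hy : forall i, `|H x 0 i - H y 0 i| <= e by near: y.
rewrite /Num.Def.normr/= mx_normrE; apply: bigmax_le => [|[a i] _]; first exact: ltW.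
by rewrite !mxE /= ord1.
Unshelve. all: by end_near. Qed.

Lemma continuous_polar m (t : R) (w : 'rV[R]_m.+1) :
  {for (t, w), continuous (fun p : R * 'rV[R]_m.+1 => polar p.1 p.2)}.
Proof.
apply: continuous_rV => i; case: (unliftP ord0 i) => [j ->|->].
  rewrite (_ : (fun p : R * 'rV[R]_m.+1 => _) = fun p => sin p.1 * p.2 0 j).
    apply: cvgM.
      by apply: (@cvg_comp _ _ _ fst sin); [exact: cvg_fst|exact: continuous_sin].
    apply: (@cvg_comp _ _ _ snd (fun v : 'rV[R]_m.+1 => v 0 j)); first exact: cvg_snd.
    exact: coord_continuous.
  by apply/funext => p; rewrite polar_lift.
rewrite (_ : (fun p : R * 'rV[R]_m.+1 => _) = fun p => cos p.1).
  by apply: (@cvg_comp _ _ _ fst cos); [exact: cvg_fst|exact: continuous_cos].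
by apply/funext => p; rewrite polar_ord0.
Qed.

Lemma sphere_continuous_polar (X : topologicalType) m (F : X -> 'rV[R]_m.+2 -> R) :
  sphere_continuous F ->
  sphere_continuous (fun (p : X * R) (w : 'rV[R]_m.+1) => F p.1 (polar p.2 w)).
Proof.
move=> cF [x t] w w1 /=.
apply: (@continuous2_cvg _ _ _ _ (nbhs ((x, t), w)) _
  (fun p : X * R * 'rV[R]_m.+1 => p.1.1)
  (fun p : X * R * 'rV[R]_m.+1 => polar p.1.2 p.2) F x (polar t w)).
- exact/cF/sphere_polar.
- apply: (@cvg_comp _ _ _ (fun p : X * R * 'rV[R]_m.+1 => p.1) fst); exact: cvg_fst.
- apply: (@continuous2_cvg _ _ _ _ (nbhs ((x, t), w)) _
    (fun p : X * R * 'rV[R]_m.+1 => p.1.2) snd polar t w).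
  + exact: continuous_polar.
  + apply: (@cvg_comp _ _ _ (fun p : X * R * 'rV[R]_m.+1 => p.1) snd); first exact: cvg_fst.
    exact: cvg_snd.
  + exact: cvg_snd.
Qed.

(** The induction hypothesis is applied with parameter space [X * R]: the angle becomes a parameter,
    which gives the joint continuity needed to integrate over it. *)
Lemma continuous_sphere_int (X : topologicalType) m (F : X -> 'rV[R]_m.+1 -> R) :
  sphere_continuous F -> continuous (fun x => sphere_int (F x)).
Proof.
elim: m X F => [|m IH] X F cF x.
  have cc a : a ^+ 2 = 1 -> {for x, continuous (fun x => F x (const_mx a))}.
    move=> a1; apply: (@continuous2_cvg _ _ _ _ (nbhs x) _ id (fun=> const_mx a) F x).
    - exact/cF/sphere_const.
    - exact: cvg_id.
    - exact: cvg_cst.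
  by apply: cvgD; apply: cc; rewrite ?sqrrN expr1n.
have cg := IH _ _ (sphere_continuous_polar cF).
apply: Rintegral_parameter_continuous; first exact: pi_ge0.
move=> y t; apply: cvgM; last exact: cg.
apply: (@cvg_comp _ _ _ snd (fun t => sin t ^+ m)); first exact: cvg_snd.
apply: (@cvg_comp _ _ _ sin (fun t => t ^+ m)); first exact: continuous_sin.
exact: exprn_continuous.
Qed.

Definition continuous_on_sphere m (f : 'rV[R]_m.+1 -> R) :=
  forall w, sphere w -> {for w, continuous f}.

Lemma sphere_continuous_comp_polar m (f : 'rV[R]_m.+2 -> R) :
  continuous_on_sphere f ->
  sphere_continuous (fun t (w : 'rV[R]_m.+1) => f (polar t w)).
Proof.
move=> cf t w w1.
apply: (@cvg_comp _ _ _ (fun q : R * 'rV[R]_m.+1 => polar q.1 q.2) f).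
  exact: continuous_polar.
exact/cf/sphere_polar.
Qed.

Lemma sphere_continuous_slice (X : topologicalType) m (F : X -> 'rV[R]_m.+1 -> R) x :
  sphere_continuous F -> continuous_on_sphere (F x).
Proof.
move=> cF w w1.
apply: (@continuous2_cvg _ _ _ _ (nbhs w) _ (fun=> x) id F x w); first exact: cF.
- exact: cvg_cst.
- exact: cvg_id.
Qed.

Lemma continuous_sphere_int_polar m (f : 'rV[R]_m.+2 -> R) :
  continuous_on_sphere f ->
  continuous (fun t => sphere_int (fun w : 'rV[R]_m.+1 => f (polar t w))).
Proof. by move=> /sphere_continuous_comp_polar; exact: continuous_sphere_int. Qed.

Lemma continuous_sinX m : continuous (fun t : R => sin t ^+ m).
Proof.
move=> t; apply: (@cvg_comp _ _ _ sin (fun t => t ^+ m)); first exact: continuous_sin.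
exact: exprn_continuous.
Qed.

Lemma integrable_sphere_int_polar m (f : 'rV[R]_m.+2 -> R) :
  continuous_on_sphere f ->
  mu.-integrable `[0, pi] (EFin \o (fun t : R => sin t ^+ m *
     sphere_int (fun w : 'rV[R]_m.+1 => f (polar t w)))).
Proof.
move=> cf; apply: continuous_integrable_segment => t.
by apply: cvgM; [exact: continuous_sinX|exact: continuous_sphere_int_polar].
Qed.

Lemma sphere_intD m (f g : 'rV[R]_m.+1 -> R) :
  continuous_on_sphere f -> continuous_on_sphere g ->
  sphere_int (fun w => f w + g w) = sphere_int f + sphere_int g.
Proof.
elim: m f g => [|m IH] f g cf cg; first by rewrite /= addrACA.
rewrite !sphere_intS -RintegralD//; [|exact: integrable_sphere_int_polar..].
apply: eq_Rintegral => t _; rewrite -mulrDr IH//.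
- exact: sphere_continuous_slice (sphere_continuous_comp_polar cf).
- exact: sphere_continuous_slice (sphere_continuous_comp_polar cg).
Qed.

Lemma sphere_intZ m a (f : 'rV[R]_m.+1 -> R) :
  continuous_on_sphere f -> sphere_int (fun w => a * f w) = a * sphere_int f.
Proof.
elim: m f => [|m IH] f cf; first by rewrite /= mulrDr.
rewrite !sphere_intS -RintegralZl//; [|exact: integrable_sphere_int_polar].
apply: eq_Rintegral => t _; rewrite IH 1?mulrCA//.
exact: sphere_continuous_slice (sphere_continuous_comp_polar cf).
Qed.

Lemma sphere_int0 m : sphere_int (fun _ : 'rV[R]_m.+1 => 0) = 0.
Proof.
elim: m => [|m IH]; first by rewrite /= addr0.
rewrite sphere_intS IH; under eq_Rintegral do rewrite mulr0.
by rewrite Rintegral_cst ?mul0r//; exact: measurable_itv.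
Qed.

Lemma sphere_int_ge0 m (f : 'rV[R]_m.+1 -> R) :
  (forall w, sphere w -> 0 <= f w) -> 0 <= sphere_int f.
Proof.
elim: m f => [|m IH] f f0.
  by rewrite /= addr_ge0// f0//; apply: sphere_const; rewrite ?sqrrN expr1n.
rewrite sphere_intS; apply: Rintegral_ge0 => t /=; rewrite in_itv/= => tpi.
rewrite mulr_ge0 ?exprn_ge0 ?sin_ge0_pi//.
by apply: IH => w w1; apply: f0; exact: sphere_polar.
Qed.

Lemma polar_surj m (x : 'rV[R]_m.+2) : sphere x ->
  exists t w, [/\ t \in `[0, pi], sphere w & x = polar t w].
Proof.
move=> x1.
have xE : x 0 ord0 ^+ 2 + \sum_i x 0 (lift ord0 i) ^+ 2 = 1.
  by rewrite -x1 /dot [RHS]big_ord_recl -expr2; congr (_ + _); apply: eq_bigr.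
have s0 : 0 <= \sum_i x 0 (lift ord0 i) ^+ 2 by apply: sumr_ge0 => i _; exact: sqr_ge0.
have x01 : -1 <= x 0 ord0 <= 1.
  by apply/andP; split; nra.
exists (acos (x 0 ord0)).
have ti : acos (x 0 ord0) \in `[0, pi] by rewrite in_itv/= acos_ge0// acos_lepi.
have cE : cos (acos (x 0 ord0)) = x 0 ord0 by rewrite acosK.
have sE : sin (acos (x 0 ord0)) ^+ 2 = \sum_i x 0 (lift ord0 i) ^+ 2.
  have := cos2Dsin2 (acos (x 0 ord0)); rewrite cE -xE; exact: addrI.
have ext (w : 'rV[R]_m.+1) : (forall i, sin (acos (x 0 ord0)) * w 0 i = x 0 (lift ord0 i)) ->
   x = polar (acos (x 0 ord0)) w.
  move=> H; apply/rowP => i; case: (unliftP ord0 i) => [j ->|->].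
    by rewrite polar_lift H.
  by rewrite polar_ord0 cE.
have [s00|sn0] := eqVneq (sin (acos (x 0 ord0))) 0.
  (* At a pole the remaining coordinates vanish together with the sine, so any unit vector can serve
     as w. *)
  exists (delta_mx 0 ord0); split=> //.
    by rewrite /sphere /= dot_delta mxE !eqxx.
  apply: ext => i; rewrite s00 mul0r; move/esym/eqP : sE; rewrite s00 expr0n /=.
  rewrite psumr_eq0 => [/allP/(_ i (mem_index_enum _))|j _]; last exact: sqr_ge0.
  by rewrite /= sqrf_eq0 => /eqP.
exists (\row_i ((sin (acos (x 0 ord0)))^-1 * x 0 (lift ord0 i))); split=> //.
  rewrite /sphere /= /dot; under eq_bigr do rewrite !mxE mulrACA -!expr2.
  by rewrite -mulr_sumr -sE -exprMn mulVf// expr1n.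
by apply: ext => i; rewrite mxE mulrA mulfV// mul1r.
Qed.

Lemma sphere_int_eq0 m (f : 'rV[R]_m.+1 -> R) : continuous_on_sphere f ->
  (forall w, sphere w -> 0 <= f w) -> sphere_int f = 0 ->
  forall w, sphere w -> f w = 0.
Proof.
elim: m f => [|m IH] f cf f0.
  have p1 : 0 <= f (const_mx 1) by apply: f0; apply: sphere_const; rewrite expr1n.
  have p2 : 0 <= f (const_mx (-1)) by apply: f0; apply: sphere_const; rewrite sqrrN expr1n.
  rewrite /= => /eqP; rewrite paddr_eq0// => /andP[/eqP f1 /eqP fN1] w.
  rewrite /sphere /= /dot big_ord1 -expr2 => /eqP; rewrite sqrf_eq1 => w1.
  have -> : w = const_mx (w 0 0) by apply/rowP => i; rewrite mxE ord1.
  by case/orP : w1 => /eqP ->.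
rewrite sphere_intS => If.
pose H t := sphere_int (fun w : 'rV[R]_m.+1 => f (polar t w)).
have cH : continuous H by exact: continuous_sphere_int_polar.
have H0 t : 0 <= H t by apply: sphere_int_ge0 => w w1; apply: f0; exact: sphere_polar.
have Hz t : t \in `[0, pi] -> sin t ^+ m * H t = 0.
  apply: (@Rintegral_eq0 R (fun t => sin t ^+ m * H t) 0 pi (pi_gt0 R)) => //.
    by move=> s; apply: cvgM; [exact: continuous_sinX|exact: cH].
  by move=> s; rewrite in_itv/= => spi; rewrite mulr_ge0 ?exprn_ge0 ?sin_ge0_pi.
have Ho t : 0 < t < pi -> H t = 0.
  move=> /andP[t0 tp]; have := Hz t; rewrite in_itv/= !ltW// => /(_ isT)/eqP.
  by rewrite mulf_eq0 expf_eq0 gt_eqF ?andbF//= ?sin_gt0_pi ?t0//; move/eqP.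
have Hc t : t \in `[0, pi] -> H t = 0.
  rewrite in_itv/= => /andP[t0 tp].
  (* The weight sin^m may vanish at 0 and pi, so there H is recovered as a limit: for 0 < s < 1 the
     point t + s (pi/2 - t) lies in the open interval, where H is known to be 0. *)
  pose k (s : R) := H (t + s * (pi / 2 - t)).
  have ck : k s @[s --> 0^'+] --> k 0.
    apply: cvg_at_right_filter.
    apply: (@cvg_comp _ _ _ (fun s : R => t + s * (pi / 2 - t)) H); last exact: cH.
    by apply: cvgD; [exact: cvg_cst|exact: mulrr_continuous].
  have k0 : k s @[s --> 0^'+] --> 0.
    apply: cvg_near_cst; near=> s.
    have s0 : 0 < s by [].
    have s1 : s < 1 by near: s; exact: nbhs_right_lt.
    have p0 := pi_gt0 R.
    apply: Ho; apply/andP; split; nra.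
  have := cvg_unique _ ck k0; rewrite /k mul0r addr0; apply.
  exact: norm_hausdorff.
move=> x /polar_surj[t [w [tI w1 ->]]].
apply: (IH (fun w => f (polar t w))) => //.
- exact: sphere_continuous_slice (sphere_continuous_comp_polar cf).
- by move=> u u1; apply: f0; exact: sphere_polar.
- exact: Hc.
Unshelve. all: by end_near. Qed.

Lemma sphere_int_is_derive m (K dK : R -> 'rV[R]_m.+1 -> R) (t0 : R) :
  sphere_continuous K -> sphere_continuous dK ->
  (forall (t : R) w, sphere w -> is_derive t 1 (K ^~ w) (dK t w)) ->
  is_derive t0 1 (fun t => sphere_int (K t)) (sphere_int (dK t0)).
Proof.
elim: m K dK t0 => [|m IH] K dK t0 cK cdK Kd.
  by apply: is_deriveD; apply: Kd; apply: sphere_const; rewrite ?sqrrN expr1n.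
apply: (Rintegral_parameter_is_derive _
  (g := fun t s => sin s ^+ m * sphere_int (fun w : 'rV[R]_m.+1 => K t (polar s w)))
  (dg := fun t s => sin s ^+ m * sphere_int (fun w : 'rV[R]_m.+1 => dK t (polar s w)))).
- exact: pi_ge0.
- move=> t s; apply: cvgM; first exact: continuous_sinX.
  apply: (continuous_sphere_int_polar (f := K t)).
  exact: sphere_continuous_slice.
- move=> t s; apply: cvgM.
    apply: (@cvg_comp _ _ _ snd (fun t => sin t ^+ m)); first exact: cvg_snd.
    exact: continuous_sinX.
  exact: (continuous_sphere_int (sphere_continuous_polar cdK)).
move=> t s; apply: is_deriveZ.
apply: (IH (fun t (w : 'rV[R]_m.+1) => K t (polar s w))
           (fun t (w : 'rV[R]_m.+1) => dK t (polar s w))).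
- move=> t' w w1; apply: (@continuous2_cvg _ _ _ _ (nbhs (t', w)) _ fst
    (fun p : R * 'rV[R]_m.+1 => polar s p.2) K t' (polar s w)).
  + exact/cK/sphere_polar.
  + exact: cvg_fst.
  + apply: (@continuous2_cvg _ _ _ _ (nbhs (t', w)) _ (fun=> s) snd polar s w).
    * exact: continuous_polar.
    * exact: cvg_cst.
    * exact: cvg_snd.
- move=> t' w w1; apply: (@continuous2_cvg _ _ _ _ (nbhs (t', w)) _ fst
    (fun p : R * 'rV[R]_m.+1 => polar s p.2) dK t' (polar s w)).
  + exact/cdK/sphere_polar.
  + exact: cvg_fst.
  + apply: (@continuous2_cvg _ _ _ _ (nbhs (t', w)) _ (fun=> s) snd polar s w).
    * exact: continuous_polar.
    * exact: cvg_cst.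
    * exact: cvg_snd.
- by move=> t' w w1; apply: Kd; exact: sphere_polar.
Qed.

End SphereIntegral.

(** * Integration by parts on the sphere *)

Section GradientTheorem.
Context {R : realType}.
Local Notation U := punctured.

Lemma Ck1P m (f : 'rV[R]_m.+1 -> R) : Ck 1 U f ->
  (forall x, U x -> differentiable f x) /\
  (forall i x, U x -> {for x, continuous (partial i f)}).
Proof. by []. Qed.

Lemma continuous_on_sphere_Ck k m (f : 'rV[R]_m.+1 -> R) :
  Ck k U f -> continuous_on_sphere f.
Proof. by move=> cf w /sphere_punctured; exact: Ck_continuous cf w. Qed.

Definition radial_derivative m (f : 'rV[R]_m -> R) (x : 'rV[R]_m) : R :=
  \sum_i x 0 i * partial i f x.

Lemma is_derive_polar m (f : 'rV[R]_m.+2 -> R) (t : R) (w : 'rV[R]_m.+1) :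
  differentiable f (polar t w) ->
  is_derive t 1 (fun s => f (polar s w))
    (- sin t * partial ord0 f (polar t w) +
     cos t * \sum_i w 0 i * partial (lift ord0 i) f (polar t w)).
Proof.
move=> df.
pose v : 'rV[R]_m.+2 := row_mx (const_mx (- sin t) : 'rV_1) (cos t *: w).
have v0 : v 0 ord0 = - sin t.
  have := row_mxEl (const_mx (- sin t) : 'rV[R]_1) (cos t *: w) 0 ord0.
  by rewrite [RHS]mxE => <-; congr (row_mx _ _ _ _); exact: val_inj.
have vl i : v 0 (lift ord0 i) = cos t * w 0 i.
  have := row_mxEr (const_mx (- sin t) : 'rV[R]_1) (cos t *: w) 0 i.
  by rewrite [RHS]mxE => <-; congr (row_mx _ _ _ _); exact: val_inj.
have := @is_derive_curve R m.+2 (fun s => polar s w) f t v _ df.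
rewrite big_ord_recl v0; under eq_bigr do rewrite vl -mulrA.
rewrite -mulr_sumr; apply => i; case: (unliftP ord0 i) => [j ->|->].
  rewrite vl (_ : (fun y : R => _) = fun y => w 0 j * sin y); last first.
    by apply/funext => y; rewrite polar_lift mulrC.
  by rewrite mulrC; apply: is_deriveZ.
rewrite v0 (_ : (fun y : R => _) = cos); last first.
  by apply/funext => y; rewrite polar_ord0.
exact: is_derive_cos.
Qed.

Lemma differentiable_comp_polar m (f : 'rV[R]_m.+2 -> R) (t : R) (w : 'rV[R]_m.+1) :
  differentiable f (polar t w) -> differentiable (fun u => f (polar t u)) w.
Proof.
move=> df; apply: (@differentiable_comp_rV _ _ _ (polar t)) => // i.
case: (unliftP ord0 i) => [j ->|->].
  rewrite (_ : (fun y : 'rV[R]_m.+1 => _) = fun y => sin t * y 0 j).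
    exact/differentiableZ/differentiable_coord.
  by apply/funext => y; rewrite polar_lift.
rewrite (_ : (fun y : 'rV[R]_m.+1 => _) = fun y => cos t); first exact: differentiable_cst.
by apply/funext => y; rewrite polar_ord0.
Qed.

Lemma partial_comp_polar m (f : 'rV[R]_m.+2 -> R) (t : R) (w : 'rV[R]_m.+1) i :
  differentiable f (polar t w) ->
  partial i (fun u => f (polar t u)) w = sin t * partial (lift ord0 i) f (polar t w).
Proof.
move=> df; rewrite /partial.
have dc j y : differentiable (fun z : 'rV[R]_m.+1 => z 0 j) y.
  exact: differentiable_coord.
have pl j : (fun y : 'rV[R]_m.+1 => polar t y 0 (lift ord0 j)) = fun y => sin t * y 0 j.
  by apply/funext => y; rewrite polar_lift.
have p0 : (fun y : 'rV[R]_m.+1 => polar t y 0 ord0) = fun y => cos t.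
  by apply/funext => y; rewrite polar_ord0.
rewrite (@derive_val _ _ _ _ _ _ _ (@is_derive_comp_rV _ _ _
    (polar t) f w (delta_mx 0 i)
    (fun j => if unlift ord0 j is Some j' then sin t * (i == j')%:R else 0) _ _ df)).
- rewrite big_ord_recl unlift_none mul0r add0r (bigD1 i)//= liftK eqxx mulr1 big1 ?addr0//.
  by move=> j ji; rewrite liftK eq_sym (negbTE ji) mulr0 mul0r.
- move=> j; case: (unliftP ord0 j) => [j' ->|->]; last by rewrite p0; exact: differentiable_cst.
  by rewrite pl; exact: differentiableZ.
- move=> j; case: (unliftP ord0 j) => [j' ->|->].
    by rewrite pl -(partial_coord i j' w); apply: partialZ; exact: dc.
  by rewrite p0; exact: derive_cst.
Qed.

Lemma continuous_comp_polar m (f : 'rV[R]_m.+2 -> R) (t : R) (w : 'rV[R]_m.+1) :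
  {for polar t w, continuous f} -> {for w, continuous (fun u => f (polar t u))}.
Proof.
move=> cf; apply: (@cvg_comp _ _ _ (polar t) f); last exact: cf.
apply: (@continuous2_cvg _ _ _ _ (nbhs w) _ (fun=> t) id polar t w).
- exact: continuous_polar.
- exact: cvg_cst.
- exact: cvg_id.
Qed.

Lemma Ck1_comp_polar m (f : 'rV[R]_m.+2 -> R) (t : R) :
  Ck 1 U f -> Ck 1 U (fun w : 'rV[R]_m.+1 => f (polar t w)).
Proof.
move=> /Ck1P[df cf]; apply/CkSP; split=> [w Uw|i].
  by apply: differentiable_comp_polar; apply: df; exact: polar_punctured.
apply: (@Ck_ext _ _ _ _ (fun w => sin t * partial (lift ord0 i) f (polar t w))).
- exact: open_punctured.
- move=> w Uw; apply: continuousM; first exact: cst_continuous.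
  by apply: continuous_comp_polar; apply: cf; exact: polar_punctured.
- move=> w Uw; rewrite partial_comp_polar//; apply: df; exact: polar_punctured.
Qed.

Lemma sphere_int_total_derivative m (K dK : R -> 'rV[R]_m.+1 -> R) :
  sphere_continuous K -> sphere_continuous dK ->
  (forall (t : R) w, sphere w -> is_derive t 1 (K ^~ w) (dK t w)) ->
  sphere_int (K 0) = 0 -> sphere_int (K pi) = 0 ->
  \int[lebesgue_measure]_(t in `[0, pi]) sphere_int (dK t) = 0.
Proof.
move=> cK cdK Kd K0 Kpi.
have dH (t : R) : is_derive t 1 (fun t => sphere_int (K t)) (sphere_int (dK t)).
  exact: sphere_int_is_derive.
have cH := continuous_sphere_int cdK.
by have := Rintegral_derive (pi_gt0 R) cH dH; rewrite K0 Kpi subrr.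
Qed.

Lemma sphere_continuousM (X : topologicalType) m (F G : X -> 'rV[R]_m.+1 -> R) :
  sphere_continuous F -> sphere_continuous G ->
  sphere_continuous (fun x w => F x w * G x w).
Proof. by move=> cF cG x w w1; apply: cvgM; [exact: cF|exact: cG]. Qed.

Lemma sphere_continuousD (X : topologicalType) m (F G : X -> 'rV[R]_m.+1 -> R) :
  sphere_continuous F -> sphere_continuous G ->
  sphere_continuous (fun x w => F x w + G x w).
Proof. by move=> cF cG x w w1; apply: cvgD; [exact: cF|exact: cG]. Qed.

Lemma sphere_continuous_fst (X : topologicalType) m (f : X -> R) :
  continuous f -> sphere_continuous (fun x (_ : 'rV[R]_m.+1) => f x).
Proof.
by move=> cf x w w1; apply: (@cvg_comp _ _ _ fst f); [exact: cvg_fst|exact: cf].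
Qed.

Lemma sphere_continuous_snd (X : topologicalType) m (f : 'rV[R]_m.+1 -> R) :
  continuous_on_sphere f -> sphere_continuous (fun (_ : X) w => f w).
Proof.
by move=> cf x w w1; apply: (@cvg_comp _ _ _ snd f); [exact: cvg_snd|exact: cf].
Qed.

Lemma sphere_continuous_sum (X : topologicalType) m (I : Type) (r : seq I)
    (F : I -> X -> 'rV[R]_m.+1 -> R) :
  (forall i, sphere_continuous (F i)) ->
  sphere_continuous (fun x w => \sum_(i <- r) F i x w).
Proof.
move=> cF; elim: r => [|i r IH].
  rewrite (_ : (fun x w => _) = fun _ _ => 0).
    by apply: (sphere_continuous_fst (f := fun=> 0)); exact: cst_continuous.
  by apply/funext => x; apply/funext => w; rewrite big_nil.
rewrite (_ : (fun x w => _) = fun x w => F i x w + \sum_(i <- r) F i x w).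
  exact: sphere_continuousD.
by apply/funext => x; apply/funext => w; rewrite big_cons.
Qed.

Lemma sphere_continuousN (X : topologicalType) m (F : X -> 'rV[R]_m.+1 -> R) :
  sphere_continuous F -> sphere_continuous (fun x w => - F x w).
Proof. by move=> cF x w w1; apply: cvgN; exact: cF. Qed.

Lemma continuous_gradient_integrand m (G : 'rV[R]_m.+1 -> R) l : Ck 1 U G ->
  continuous_on_sphere (fun x => partial l G x - x 0 l * radial_derivative G x
    - m%:R * x 0 l * G x).
Proof.
move=> /[dup] /CkW c0 /CkSP[_ c1].
have oU := @open_punctured R m.+1; have cx k := @Ck_coord R m.+1 0 U k.
apply: (@continuous_on_sphere_Ck 0); apply: (CkB oU (CkB oU (c1 l) (CkM oU (cx l) _))).
  by apply: Ck_sum => // i; exact: CkM.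
by apply: CkM => //; exact: CkZ.
Qed.

Lemma is_derive_sinX k (t : R) :
  is_derive t 1 (fun t : R => sin t ^+ k) (k%:R * sin t ^+ k.-1 * cos t).
Proof.
case: k => [|k].
  rewrite !mul0r (_ : (fun _ => _) = cst 1); first exact: is_derive_cst.
  by apply/funext => s; rewrite expr0.
have -> : (fun t : R => sin t ^+ k.+1) = (sin : R -> R) ^+ k.+1.
  by apply/funext => s; rewrite exprfctE.
by apply: is_derive_eq; rewrite /GRing.scale.
Qed.

(* The integrand is the divergence on the sphere of the tangential part of G e_l,
   e_l the l-th basis vector.  By induction on the dimension: in polar
   coordinates it is the t-derivative of K, which vanishes at t = 0 and t = pi,
   plus, if l > 0, the same expression for G (polar t _) on the smaller sphere. *)
Lemma gradient_theorem m (G : 'rV[R]_m.+1 -> R) l : Ck 1 U G ->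
  sphere_int (fun x => partial l G x - x 0 l * radial_derivative G x
    - m%:R * x 0 l * G x) = 0.
Proof.
elim: m G l => [|m IH] G l cG.
  (* On S^0 nothing is tangential: x^2 = 1 makes the first two terms cancel, and the third has the
     factor 0. *)
  rewrite -[RHS](@sphere_int0 R 0); apply: eq_sphere_int => x.
  rewrite /sphere /= /dot big_ord1 /radial_derivative big_ord1 (ord1 l) => x1.
  by rewrite mulrA x1 !mul0r mul1r subrr subr0.
have [dG pG] := Ck1P cG.
pose g t (w : 'rV[R]_m.+1) := G (polar t w).
pose p i t (w : 'rV[R]_m.+1) := partial i G (polar t w).
pose S t (w : 'rV[R]_m.+1) := \sum_i w 0 i * p (lift ord0 i) t w.
have gd (t : R) w : sphere w ->
    is_derive t 1 (g ^~ w) (- sin t * p ord0 t w + cos t * S t w).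
  move=> w1; apply: is_derive_polar; apply: dG.
  exact/sphere_punctured/sphere_polar.
have cp i : sphere_continuous (p i).
  apply: sphere_continuous_comp_polar => w w1; apply: pG; exact: sphere_punctured.
have cg : sphere_continuous g.
  apply: sphere_continuous_comp_polar; exact: continuous_on_sphere_Ck cG.
have cw i : sphere_continuous (fun (_ : R) (w : 'rV[R]_m.+1) => w 0 i).
  by apply: sphere_continuous_snd => w _; exact: coord_continuous.
have cS : sphere_continuous S.
  by apply: sphere_continuous_sum => i; apply: sphere_continuousM.
have cs : continuous (@sin R) by exact: continuous_sin.
have cc : continuous (@cos R) by exact: continuous_cos.
have rE t w : radial_derivative G (polar t w) = cos t * p ord0 t w + sin t * S t w.
  rewrite /radial_derivative big_ord_recl polar_ord0; congr (_ + _).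
  by rewrite mulr_sumr; apply: eq_bigr => i _; rewrite polar_lift mulrA.
have csX k : sphere_continuous (fun t (_ : 'rV[R]_m.+1) => sin t ^+ k).
  by apply: (sphere_continuous_fst (f := fun t => sin t ^+ k)); exact: continuous_sinX.
have ccX : sphere_continuous (fun t (_ : 'rV[R]_m.+1) => cos t).
  by apply: (sphere_continuous_fst (f := cos)).
have cc2 : sphere_continuous (fun t (_ : 'rV[R]_m.+1) => cos t ^+ 2).
  exact: (sphere_continuousM ccX ccX).
have cs1 : sphere_continuous (fun t (_ : 'rV[R]_m.+1) => sin t).
  by apply: (sphere_continuous_fst (f := sin)).
have cst a : sphere_continuous (fun (_ : R) (_ : 'rV[R]_m.+1) => a).
  by apply: (sphere_continuous_fst (f := fun=> a)); exact: cst_continuous.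
have cI := @continuous_gradient_integrand _ _ l cG.
have cs2 t : 1 - sin t ^+ 2 - cos t ^+ 2 = 0 :> R by rewrite -(cos2Dsin2 t); ring.
rewrite sphere_intS.
under eq_Rintegral => t _.
  rewrite -sphere_intZ; last first.
    exact: sphere_continuous_slice (sphere_continuous_comp_polar cI).
  over.
case: (unliftP ord0 l) => [l' lE|lE]; subst l.
  (* [K] is the flux of G e_l along the meridians: G times the component w_l' cos t of e_l on the
     meridian direction, times the density sin^m. *)
  pose K t (w : 'rV[R]_m.+1) := w 0 l' * (cos t * sin t ^+ m * g t w).
  pose d t : R := - sin t ^+ m.+1 + m%:R * sin t ^+ m.-1 * cos t ^+ 2.
  pose dK t (w : 'rV[R]_m.+1) := w 0 l' * (d t * g t w +
     cos t * sin t ^+ m * (- sin t * p ord0 t w + cos t * S t w)).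
  (* [B] is sin^(m-1) times the gradient integrand of G (polar t _) on S^m; the chain rule supplies
     the extra factor sin t in its first two terms. For m = 0 the term with [m.-1] has coefficient
     0. *)
  pose B t (w : 'rV[R]_m.+1) := sin t ^+ m * p (lift ord0 l') t w
     - sin t ^+ m * w 0 l' * S t w - m%:R * sin t ^+ m.-1 * w 0 l' * g t w.
  have cK : sphere_continuous K.
    exact: (sphere_continuousM (cw l') (sphere_continuousM (sphere_continuousM ccX (csX m)) cg)).
  have cdK : sphere_continuous dK.
    exact: (sphere_continuousM (cw l') (sphere_continuousD (sphere_continuousM
      (sphere_continuousD (sphere_continuousN (csX m.+1))
        (sphere_continuousM (sphere_continuousM (cst m%:R) (csX m.-1)) cc2)) cg)
      (sphere_continuousM (sphere_continuousM ccX (csX m))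
        (sphere_continuousD (sphere_continuousM (sphere_continuousN cs1) (cp ord0))
          (sphere_continuousM ccX cS))))).
  have cB : sphere_continuous B.
    exact: (sphere_continuousD (sphere_continuousD
        (sphere_continuousM (csX m) (cp (lift ord0 l')))
        (sphere_continuousN (sphere_continuousM (sphere_continuousM (csX m) (cw l')) cS)))
      (sphere_continuousN (sphere_continuousM (sphere_continuousM
        (sphere_continuousM (cst m%:R) (csX m.-1)) (cw l')) cg))).
  have B0 t : sphere_int (B t) = 0.
    (* For m = 0 the slice consists of two points and [B t] vanishes on each because w^2 = 1;
       otherwise the induction hypothesis applies to the slice. *)
    rewrite /B {B cB}; case: m l' G cG @g @p @S IH {dG pG gd cp cg cw cS rE csX ccX cc2 cs1 cst cI K d dK cK cdK} => [|k] l' G cG g p S IH.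
      rewrite -[RHS](@sphere_int0 R 0); apply: eq_sphere_int => w.
      rewrite /sphere /= /dot big_ord1 /S big_ord1 (ord1 l') => w1.
      by rewrite !mul1r !mul0r subr0 mulrA w1 mul1r subrr.
    have cGt := Ck1_comp_polar t cG.
    rewrite -[RHS](mulr0 (sin t ^+ k)) -(IH _ l' cGt) -sphere_intZ; last first.
      exact: continuous_gradient_integrand.
    have [dG _] := Ck1P cG.
    apply: eq_sphere_int => w w1.
    have dGw : differentiable G (polar t w) by exact/dG/polar_punctured/sphere_punctured.
    rewrite /radial_derivative partial_comp_polar//.
    under eq_bigr do rewrite partial_comp_polar// mulrCA.
    by rewrite -mulr_sumr /= exprS -/(S t w) -/(p _ t w) -/(g t w); ring.
  (* For m = 0 the density does not vanish at the poles. There G (polar t w) no longer depends on w,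
     and the contributions of w = 1 and w = -1 cancel. *)
  have K0 (t : R) : sin t = 0 -> sphere_int (K t) = 0.
    move=> st; rewrite /K {K dK d B cB cK cdK B0 IH gd cp cg cw cS rE csX ccX cc2 cs1 cst}.
    case: m l' G {dG pG cI} cG @g @p @S => [|k] l' G cG g p S.
      have -> : (fun w : 'rV[R]_1 => w 0 l' * (cos t * sin t ^+ 0 * g t w)) =
                 fun w => w 0 l' * (cos t * sin t ^+ 0 * g t 0).
        by apply/funext => w; rewrite /g /polar st !scale0r.
      by rewrite /= !mxE mul1r mulN1r subrr.
    rewrite -[RHS](@sphere_int0 R k.+1); apply: eq_sphere_int => w _.
    by rewrite st expr0n mulr0 mul0r mulr0.
  rewrite -[RHS](@sphere_int_total_derivative m K dK) //.
  - apply: eq_Rintegral => t _; rewrite -[RHS]add0r -(B0 t) -sphere_intD.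
    + apply: eq_sphere_int => w w1; rewrite polar_lift rE /B /dK /d.
      rewrite -/(p (lift ord0 l') t w) -/(g t w).
      have E : m%:R * sin t ^+ m.-1 * sin t ^+ 2 = m%:R * (sin t * sin t ^+ m).
        by case: (m) => [|k]; [rewrite !mul0r|rewrite /= !exprS expr0; ring].
      apply/eqP; rewrite -subr_eq0; apply/eqP.
      (* The difference of the two sides is put in the ideal of two known relations, cos^2 + sin^2 =
         1 and [E], so that [ring] faces no trigonometry. *)
      transitivity ((1 - sin t ^+ 2 - cos t ^+ 2) * (sin t ^+ m * w 0 l' * S t w
         + m%:R * sin t ^+ m.-1 * w 0 l' * g t w)
         + (m%:R * sin t ^+ m.-1 * sin t ^+ 2 - m%:R * (sin t * sin t ^+ m)) * (w 0 l' * g t w)).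
        by rewrite -natr1 exprS; ring.
      by rewrite cs2 E subrr !mul0r addr0.
    + exact: sphere_continuous_slice.
    + exact: sphere_continuous_slice.
  - move=> t w w1; have := gd t w w1 => gdt.
    have sd := is_derive_sinX m t.
    rewrite /K /dK /d; apply: is_derive_eq; rewrite /GRing.scale /= exprS; ring.
  - exact: K0 (sin0 R).
  - exact: K0 (sinpi R).
(* The axis vector e_0 has meridian component - sin t and no component along the slice, so the whole
   integrand is a t-derivative. *)
pose K t (w : 'rV[R]_m.+1) := - (sin t ^+ m.+1 * g t w).
pose dK t (w : 'rV[R]_m.+1) := - (m.+1%:R * sin t ^+ m * cos t * g t w +
   sin t ^+ m.+1 * (- sin t * p ord0 t w + cos t * S t w)).
have K0 (t : R) : sin t = 0 -> sphere_int (K t) = 0.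
  move=> st; rewrite -[RHS](@sphere_int0 R m); apply: eq_sphere_int => w _.
  by rewrite /K st expr0n mul0r oppr0.
rewrite -[RHS](@sphere_int_total_derivative m K dK).
- apply: eq_Rintegral => t _; apply: eq_sphere_int => w w1.
  rewrite polar_ord0 rE /dK -/(p ord0 t w) -/(g t w).
  apply/eqP; rewrite -subr_eq0; apply/eqP.
  transitivity ((1 - sin t ^+ 2 - cos t ^+ 2) * (sin t ^+ m * p ord0 t w)).
    by rewrite exprS; ring.
  by rewrite cs2 mul0r.
- exact: (sphere_continuousN (sphere_continuousM (csX m.+1) cg)).
- exact: (sphere_continuousN (sphere_continuousD (sphere_continuousM
    (sphere_continuousM (sphere_continuousM (cst m.+1%:R) (csX m)) ccX) cg)
    (sphere_continuousM (csX m.+1) (sphere_continuousD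
      (sphere_continuousM (sphere_continuousN cs1) (cp ord0)) (sphere_continuousM ccX cS))))).
- move=> t w w1; have := gd t w w1 => gdt.
  have sd := is_derive_sinX m.+1 t.
  by rewrite /K /dK; apply: is_derive_eq; rewrite /GRing.scale /=; ring.
- exact: K0 (sin0 R).
- exact: K0 (sinpi R).
Qed.

End GradientTheorem.

(** * Divergence theorem and Green's formula *)

Section SphereDivergence.
Context {R : realType} {n : nat}.
Implicit Types (f g : 'rV[R]_n.+1 -> R).
Local Notation U := (@punctured R n.+1).

Lemma continuous_on_sphereD f g : continuous_on_sphere f -> continuous_on_sphere g ->
  continuous_on_sphere (fun x => f x + g x).
Proof. by move=> cf cg x x1; apply: continuousD; [exact: cf|exact: cg]. Qed.

Lemma continuous_on_sphereM f g : continuous_on_sphere f -> continuous_on_sphere g ->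
  continuous_on_sphere (fun x => f x * g x).
Proof. by move=> cf cg x x1; apply: continuousM; [exact: cf|exact: cg]. Qed.

Lemma continuous_on_sphere_cst (a : R) : continuous_on_sphere (fun _ : 'rV[R]_n.+1 => a).
Proof. by move=> x _; exact: cst_continuous. Qed.

Lemma continuous_on_sphere_sum (I : Type) (r : seq I) (F : I -> 'rV[R]_n.+1 -> R) :
  (forall i, continuous_on_sphere (F i)) ->
  continuous_on_sphere (fun x => \sum_(i <- r) F i x).
Proof.
move=> cF; elim: r => [|i r IH].
  under eq_fun do rewrite big_nil; exact: continuous_on_sphere_cst.
by under eq_fun do rewrite big_cons; exact: continuous_on_sphereD.
Qed.

Lemma sphere_int_sum (I : Type) (r : seq I) (F : I -> 'rV[R]_n.+1 -> R) :
  (forall i, continuous_on_sphere (F i)) ->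
  sphere_int (fun x => \sum_(i <- r) F i x) = \sum_(i <- r) sphere_int (F i).
Proof.
move=> cF; elim: r => [|i r IH].
  by under eq_fun do rewrite big_nil; rewrite big_nil sphere_int0.
under eq_fun do rewrite big_cons.
by rewrite sphere_intD ?big_cons ?IH//; exact: continuous_on_sphere_sum.
Qed.

(** W need not be tangent: the integrand is the divergence of its tangential part, whence the mean
    curvature term n <x, W>. *)
Lemma divergence_theorem (W : 'I_n.+1 -> 'rV[R]_n.+1 -> R) :
  (forall l, Ck 1 U (W l)) ->
  sphere_int (fun x => \sum_l (partial l (W l) x - x 0 l * radial_derivative (W l) x
    - n%:R * x 0 l * W l x)) = 0.
Proof.
move=> cW; rewrite sphere_int_sum => [|l]; last exact: continuous_gradient_integrand.
by rewrite big1// => l _; exact: gradient_theorem.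
Qed.

(** Euler's identity holds near x, so it may be differentiated in the j-th variable. *)
Lemma euler_gradient f x j : homogeneous0 f -> Ck 2 U f -> U x ->
  \sum_l x 0 l * partial j (partial l f) x = - partial j f x.
Proof.
move=> hf /CkSP[df pf] Ux; have oU := @open_punctured R n.+1.
have dp l y : U y -> differentiable (partial l f) y by have /CkSP[+ _] := pf l; exact.
have dx l y : differentiable (fun y : 'rV[R]_n.+1 => y 0 l) y by exact: differentiable_coord.
have : partial j (fun y => \sum_l y 0 l * partial l f y) x = 0.
  rewrite -[RHS](partial_cst 0 x j); apply: near_eq_partial.
  by apply: near_punctured Ux _ => y Uy; rewrite euler//; exact: df.
have -> : (fun y : 'rV[R]_n.+1 => \sum_l y 0 l * partial l f y) =
  \sum_l (fun y : 'rV[R]_n.+1 => y 0 l * partial l f y).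
  by apply/funext => y; rewrite fct_sumE.
rewrite /partial derive_sum => [|l]; last first.
  by apply: diff_derivable; apply: differentiableM => //; exact: dp.
rewrite -/(partial j f x).
under eq_bigr => l _.
  rewrite -/(partial j (fun y => y 0 l * partial l f y) x).
  rewrite partialM//; last exact: dp.
  rewrite partial_coord; over.
rewrite big_split /= [X in _ + X](bigD1 j)//= eqxx mulr1 [X in _ + (_ + X)]big1 ?addr0.
  by move/eqP; rewrite addr_eq0 => /eqP.
by move=> l /negbTE lj; rewrite eq_sym lj mulr0.
Qed.

(** This is the divergence theorem for f grad g. Euler's identity for g kills its normal component,
    and those for f, g and the derivatives of g kill the radial correction. *)
Lemma green f g : homogeneous0 f -> homogeneous0 g -> Ck 2 U f -> Ck 2 U g ->
  sphere_int (fun x => \sum_l partial l f x * partial l g x) =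
  - sphere_int (fun x => f x * \sum_l partial l (partial l g) x).
Proof.
move=> hf hg f2 g2; have oU := @open_punctured R n.+1.
have /CkSP[df pf] := f2; have /CkSP[dg pg] := g2.
have f1 := CkW f2.
have c0 k h : Ck k U h -> continuous_on_sphere h by exact: continuous_on_sphere_Ck.
have c1 : continuous_on_sphere (fun x => \sum_l partial l f x * partial l g x).
  by apply: continuous_on_sphere_sum => l; apply: continuous_on_sphereM; exact: (c0 1%N).
have c2 : continuous_on_sphere (fun x => f x * \sum_l partial l (partial l g) x).
  apply: continuous_on_sphereM; first exact: c0 f2.
  by apply: continuous_on_sphere_sum => l; have /CkSP[_ /(_ l)] := pg l; exact: c0.
have cW l : Ck 1 U (fun x => f x * partial l g x) by apply: CkM.
have := divergence_theorem cW => D.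
apply/eqP; rewrite -addr_eq0 -sphere_intD//; apply/eqP; rewrite -[RHS]D.
apply: eq_sphere_int => x /sphere_punctured Ux.
have dpg l : differentiable (partial l g) x by have /CkSP[+ _] := pg l; exact.
have pW i l : partial i (fun y => f y * partial l g y) x =
    f x * partial i (partial l g) x + partial l g x * partial i f x.
  by apply: partialM => //; exact: df.
rewrite !sumrB.
have -> : \sum_l n%:R * x 0 l * (f x * partial l g x) = 0.
  transitivity (n%:R * f x * \sum_l x 0 l * partial l g x).
    by rewrite mulr_sumr; apply: eq_bigr => l _; ring.
  by rewrite euler ?mulr0//; exact: dg.
have -> : \sum_l x 0 l * radial_derivative (fun y => f y * partial l g y) x = 0.
  rewrite /radial_derivative; under eq_bigr do under eq_bigr do rewrite pW.
  under eq_bigr => l _.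
    under eq_bigr do rewrite mulrDr mulrCA [X in _ + X]mulrCA.
    rewrite big_split /= -!mulr_sumr (euler hf (df _ Ux)) mulr0 addr0 mulrCA; over.
  rewrite -mulr_sumr; under eq_bigr do rewrite mulr_sumr.
  rewrite exchange_big /=.
  under eq_bigr => j _.
    under eq_bigr do rewrite mulrCA.
    rewrite -mulr_sumr euler_gradient// mulrN; over.
  by rewrite sumrN euler ?oppr0 ?mulr0//; exact: dg.
rewrite !subr0; under [RHS]eq_bigr do rewrite pW.
by rewrite big_split /= mulr_sumr addrC; congr (_ + _); apply: eq_bigr => l _; rewrite mulrC.
Qed.

(** A symmetric weight sees only F k j + F j k, which in the applications the Clifford relations
    make diagonal. *)
Lemma sym_sum (I : finType) (a F : I -> I -> R) (c : I -> R) :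
  (forall k j, a k j = a j k) ->
  (forall k j, F k j + F j k = - (c k *+ 2 *+ (k == j))) ->
  \sum_k \sum_j a k j * F k j = - \sum_k a k k * c k.
Proof.
move=> aC FC; apply/eqP; rewrite -(eqr_pMn2r (n := 2))//; apply/eqP.
rewrite mulr2n {2}exchange_big -big_split /= -sumrN -sumrMnl; apply: eq_bigr => k _.
rewrite -big_split /= (bigD1 k)//= big1 ?addr0.
  by rewrite -mulrDr FC eqxx mulr1n mulrN mulrnAr mulNrn.
by move=> j jk; rewrite (aC j k) -mulrDr FC eq_sym (negbTE jk) mulr0n oppr0 mulr0.
Qed.

End SphereDivergence.

(** * The Dirac equation for functions with values in C^N *)

Section RealPart.
Context {R : realType} {N : nat}.
Implicit Types (u w : 'rV[R[i]]_N) (v : 'cV[R[i]]_N).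

Lemma ReD (a b : R[i]) : complex.Re (a + b) = complex.Re a + complex.Re b.
Proof. by case: a b => [? ?] []. Qed.

Lemma ReM (a : R) (b : R[i]) : complex.Re (a%:C * b) = a * complex.Re b.
Proof. by case: b => ? ? /=; rewrite mul0r subr0. Qed.

(* Spinor-valued functions are differentiated through the real functions
   repair u Phi, where u runs over all complex covectors. *)
Definition repair u v : R := complex.Re ((u *m v) 0 0).

Lemma repairDl u w v : repair (u + w) v = repair u v + repair w v.
Proof. by rewrite /repair mulmxDl mxE ReD. Qed.

Lemma repairDr u v v' : repair u (v + v') = repair u v + repair u v'.
Proof. by rewrite /repair mulmxDr mxE ReD. Qed.

Lemma repairZl (a : R) u v : repair (a%:C *: u) v = a * repair u v.
Proof. by rewrite /repair -scalemxAl mxE ReM. Qed.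

Lemma repairZr (a : R) u v : repair u (a%:C *: v) = a * repair u v.
Proof. by rewrite /repair -scalemxAr mxE ReM. Qed.

Lemma repair_suml (I : Type) (r : seq I) (F : I -> 'rV[R[i]]_N) v :
  repair (\sum_(i <- r) F i) v = \sum_(i <- r) repair (F i) v.
Proof.
elim: r => [|i r IH]; first by rewrite !big_nil /repair mul0mx mxE.
by rewrite !big_cons repairDl IH.
Qed.

Lemma repair_sumr (I : Type) (r : seq I) u (F : I -> 'cV[R[i]]_N) :
  repair u (\sum_(i <- r) F i) = \sum_(i <- r) repair u (F i).
Proof.
elim: r => [|i r IH]; first by rewrite !big_nil /repair mulmx0 mxE.
by rewrite !big_cons repairDr IH.
Qed.

Lemma repair_mulmx u (M : 'M[R[i]]_N) v : repair (u *m M) v = repair u (M *m v).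
Proof. by rewrite /repair mulmxA. Qed.

(** Transports a Clifford relation through a functional of the covector. [T] will be a value, a
    first or a second partial derivative of [repair u Phi]; the scalar -2 is written as a natural
    multiple, so additivity suffices. *)
Lemma additive_anticommutator (T : 'rV[R[i]]_N -> R) u (M M' : 'M[R[i]]_N) (b : bool) :
  (forall u w, T (u + w) = T u + T w) -> M + M' = (- (2%:R *+ b))%:M ->
  T (u *m M) + T (u *m M') = - (T u *+ 2 *+ b).
Proof.
move=> TD MM'; rewrite -TD -mulmxDr MM' mul_mx_scalar.
have T0 : T 0 = 0 by apply: (addrI (T 0)); rewrite -TD !addr0.
case: b {MM'}; last by rewrite !mulr0n oppr0 scale0r T0 oppr0.
rewrite !mulr1n scaleNr scaler_nat; have -> : T u *+ 2 = T (u *+ 2) by rewrite !mulr2n TD.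
by apply/eqP; rewrite -addr_eq0 -TD addNr T0.
Qed.

End RealPart.

Lemma antisym_sum (R : realType) (I : finType) (x d : I -> R) (P Q : I -> I -> R) :
  (forall j m, P m j = - Q j m - d m *+ 2 *+ (m == j)) ->
  \sum_m \sum_j x j * P m j =
  - (\sum_j \sum_m x j * Q j m) - 2 * \sum_j x j * d j.
Proof.
move=> PQ; rewrite exchange_big -sumrN mulr_sumr -sumrB; apply: eq_bigr => j _.
under eq_bigr do rewrite PQ mulrDr mulrN.
rewrite big_split /= sumrN; congr (_ + _); rewrite (bigD1 j)//= eqxx mulr1n big1 ?addr0.
  by rewrite mulr2n; ring.
by move=> m /negbTE mj; rewrite mj mulr0n oppr0 mulr0.
Qed.

Section DiracEquation.
Context {R : realType} {n N : nat}.
Context (A At : 'I_n.+1 -> 'M[R[i]]_N).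
Context (AAt : forall j l, A j *m At l + A l *m At j = (- (2%:R *+ (j == l)))%:M).
Context (AtA : forall j l, At j *m A l + At l *m A j = (- (2%:R *+ (j == l)))%:M).
Context (Phi : 'rV[R]_n.+1 -> 'cV[R[i]]_N) (mu : R).

Local Notation U := (@punctured R n.+1).
Local Notation h u := (fun x => repair u (Phi x)).
Implicit Types (u w : 'rV[R[i]]_N) (x : 'rV[R]_n.+1).

Context (h_smooth : forall u k, Ck k U (h u)).
Context (h_homog : forall u, homogeneous0 (h u)).
Context (h_dirac : forall u x, U x ->
  \sum_j \sum_l x 0 j * partial l (h (u *m A j *m At l)) x = mu * repair u (Phi x)).

Lemma h_differentiable u x : U x -> differentiable (h u) x.
Proof. by have /CkSP[+ _] := h_smooth u 1; exact. Qed.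

Lemma dh_differentiable u l x : U x -> differentiable (partial l (h u)) x.
Proof. by have /CkSP[_ /(_ l)/CkSP[+ _]] := h_smooth u 2; exact. Qed.

Lemma partial_hD l u w x : U x ->
  partial l (h (u + w)) x = partial l (h u) x + partial l (h w) x.
Proof.
move=> Ux; rewrite -partialD//; [|exact: h_differentiable..].
by congr (partial _ _ _); apply/funext => y; exact: repairDl.
Qed.

Lemma partial2_hD m l u w x : U x -> partial m (partial l (h (u + w))) x =
  partial m (partial l (h u)) x + partial m (partial l (h w)) x.
Proof.
move=> Ux; rewrite -partialD//; [|exact: dh_differentiable..].
by apply: near_eq_partial; apply: near_punctured Ux _ => y; exact: partial_hD.
Qed.

Lemma partial_h_suml l (a : 'I_n.+1 -> R) (u : 'I_n.+1 -> 'rV[R[i]]_N) x : U x ->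
  partial l (h (\sum_k (a k)%:C *: u k)) x = \sum_k a k * partial l (h (u k)) x.
Proof.
move=> Ux; have -> : h (\sum_k (a k)%:C *: u k) = \sum_k (fun y => a k * repair (u k) (Phi y)).
  by apply/funext => y; rewrite fct_sumE repair_suml; apply: eq_bigr => k _; rewrite repairZl.
rewrite [LHS]derive_sum => [|k]; last first.
  by apply: diff_derivable; apply: differentiableZ; exact: h_differentiable.
by apply: eq_bigr => k _; apply: partialZ; exact: h_differentiable.
Qed.

(* This is the Dirac equation multiplied by \sum_k x_k At_k, since
   At(x) A(x) = - |x|^2. *)
Lemma dirac_linear u x : U x ->
  dot x x * \sum_l partial l (h (u *m At l)) x =
  - mu * \sum_k x 0 k * repair (u *m At k) (Phi x).
Proof.
move=> Ux.
have E : \sum_k x 0 k * \sum_j \sum_l x 0 j * partial l (h (u *m At k *m A j *m At l)) x =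
    mu * \sum_k x 0 k * repair (u *m At k) (Phi x).
  by rewrite mulr_sumr; apply: eq_bigr => k _; rewrite h_dirac// mulrCA.
rewrite mulNr -E mulr_sumr.
under [in RHS]eq_bigr => k _.
  rewrite exchange_big mulr_sumr /=.
  under eq_bigr do rewrite mulr_sumr.
  over.
rewrite exchange_big -sumrN; apply: eq_bigr => l _.
under eq_bigr do under eq_bigr do rewrite mulrA.
rewrite (@sym_sum _ _ (fun k j => x 0 k * x 0 j) _ (fun=> partial l (h (u *m At l)) x)).
- by rewrite opprK -mulr_suml.
- by move=> k j; rewrite mulrC.
- move=> k j; rewrite -(mulmxA u (At k)) -(mulmxA u (At j)).
  apply: (@additive_anticommutator _ _ (fun u => partial l (h (u *m At l)) x)) => [v w|].
    by rewrite mulmxDl partial_hD.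
  exact: AtA.
Qed.

(* Differentiate dirac_linear in x_m and contract with A_m. *)
Lemma laplacian_dirac u x : sphere x ->
  \sum_l partial l (partial l (h u)) x = - (mu * (mu + n%:R - 1)) * repair u (Phi x).
Proof.
move=> x1; have Ux := sphere_punctured x1; have oU := @open_punctured R n.+1.
have dx l y : differentiable (fun y : 'rV[R]_n.+1 => y 0 l) y by exact: differentiable_coord.
have dd y : differentiable (fun y : 'rV[R]_n.+1 => dot y y) y.
  rewrite (_ : (fun y => _) = \sum_j (fun y : 'rV[R]_n.+1 => y 0 j * y 0 j)).
    by apply: differentiable_sum => j; exact: differentiableM.
  by apply/funext => z; rewrite fct_sumE.
have dsum (F : 'I_n.+1 -> 'rV[R]_n.+1 -> R) : (forall l, differentiable (F l) x) ->
    differentiable (fun y => \sum_l F l y) x.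
  move=> dF; rewrite (_ : (fun y => _) = \sum_l F l); first exact: differentiable_sum.
  by apply/funext => z; rewrite fct_sumE.
have psum m (F : 'I_n.+1 -> 'rV[R]_n.+1 -> R) : (forall l, differentiable (F l) x) ->
    partial m (fun y => \sum_l F l y) x = \sum_l partial m (F l) x.
  move=> dF; rewrite (_ : (fun y => _) = \sum_l F l); last first.
    by apply/funext => z; rewrite fct_sumE.
  by apply: derive_sum => l; exact: diff_derivable.
have E m : 2 * x 0 m * (\sum_l partial l (h (u *m A m *m At l)) x) +
    \sum_l partial m (partial l (h (u *m A m *m At l))) x =
    - mu * (repair (u *m A m *m At m) (Phi x) +
      \sum_j x 0 j * partial m (h (u *m A m *m At j)) x).
  have := @near_eq_partial _ _ _ _ x m (near_punctured Ux (@dirac_linear (u *m A m))).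
  rewrite partialM//; last by apply: dsum => l; exact: dh_differentiable.
  rewrite psum; last by move=> l; exact: dh_differentiable.
  rewrite x1 mul1r partial_dot partialZ; last first.
    by apply: dsum => k; apply: differentiableM => //; exact: h_differentiable.
  rewrite psum => [|k]; last by apply: differentiableM => //; exact: h_differentiable.
  rewrite addrC [X in X + _]mulrC => ->; congr (_ * _).
  under eq_bigr => k _.
    rewrite partialM//; last exact: h_differentiable.
    rewrite partial_coord addrC; over.
  rewrite big_split /= (bigD1 m)//= eqxx mulr1 [X in _ + X + _]big1 ?addr0//.
  by move=> k /negbTE km; rewrite eq_sym km mulr0.
have : \sum_m (2 * x 0 m * (\sum_l partial l (h (u *m A m *m At l)) x) +
    \sum_l partial m (partial l (h (u *m A m *m At l))) x) =
    \sum_m - mu * (repair (u *m A m *m At m) (Phi x) +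
      \sum_j x 0 j * partial m (h (u *m A m *m At j)) x).
  by apply: eq_bigr => m _; exact: E.
rewrite big_split /= -mulr_sumr big_split /=.
have -> : \sum_m 2 * x 0 m * (\sum_l partial l (h (u *m A m *m At l)) x) =
    2 * mu * repair u (Phi x).
  rewrite -mulrA -h_dirac// mulr_sumr; apply: eq_bigr => m _.
  by rewrite -mulr_sumr mulrA.
(* Second derivatives commute, so only the anticommutator of the Clifford factors contributes, and
   it leaves the diagonal. *)
have -> : \sum_m \sum_l partial m (partial l (h (u *m A m *m At l))) x =
    - \sum_l partial l (partial l (h u)) x.
  transitivity (- \sum_m 1 * partial m (partial m (h u)) x); last first.
    by under eq_bigr do rewrite mul1r.
  rewrite -(@sym_sum R _ (fun _ _ => 1)
    (fun m l => partial m (partial l (h (u *m A m *m At l))) x)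
    (fun m => partial m (partial m (h u)) x)) //.
    by under [RHS]eq_bigr do under eq_bigr do rewrite mul1r.
  move=> m l; rewrite (partialC l m oU (h_smooth _ 2) Ux) -!(mulmxA u).
  have TD v w : partial m (partial l (h (v + w))) x =
      partial m (partial l (h v)) x + partial m (partial l (h w)) x by exact: partial2_hD.
  apply: (etrans (@additive_anticommutator _ _ (fun v => partial m (partial l (h v)) x)
    u _ _ _ TD (AAt m l))).
  have [->//|_] := eqVneq m l.
  have E0 (y z : R) : - (y *+ false) = - (z *+ false) by rewrite !mulr0n.
  exact: E0.
have -> : \sum_m repair (u *m A m *m At m) (Phi x) = - (n.+1%:R * repair u (Phi x)).
  rewrite (eq_bigr (fun=> - repair u (Phi x))) => [|m _].
    by rewrite sumrN sumr_const card_ord mulr_natl.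
  rewrite -mulmxA; have := additive_anticommutator u (fun v w => repairDl v w (Phi x)) (AAt m m).
  by rewrite eqxx mulr1n; lra.
have -> : \sum_m \sum_j x 0 j * partial m (h (u *m A m *m At j)) x =
    - (mu * repair u (Phi x)).
  have K j m : partial m (h (u *m A m *m At j)) x =
      - partial m (h (u *m A j *m At m)) x - partial m (h u) x *+ 2 *+ (m == j).
    rewrite -[u *m A m *m _]mulmxA -[u *m A j *m _]mulmxA.
    rewrite -(additive_anticommutator u (T := fun u => partial m (h u) x) _ (AAt m j)) ?opprD.
      by rewrite addrCA addNr addr0.
    by move=> v w; exact: partial_hD.
  rewrite (@antisym_sum _ _ (fun j => x 0 j) _ _ _ K) h_dirac//.
  by have := euler (@h_homog u) (h_differentiable u Ux) => ->; rewrite mulr0 subr0.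
(* With L the sum of second derivatives of h, the balance reads 2 mu h - L = mu (n + 1 + mu) h. *)
rewrite -natr1; move=> H; lra.
Qed.

End DiracEquation.

(** * Adjoints and the real inner product on C^N *)

Section Adjoint.
Context {R : realType}.
Local Notation C := R[i].

Lemma adjcM m n p (A : 'M[C]_(m, n)) (B : 'M[C]_(n, p)) : (A *m B)^t* = B^t* *m A^t*.
Proof. by rewrite trmx_mul map_mxM. Qed.

Lemma adjcD m n (A B : 'M[C]_(m, n)) : (A + B)^t* = A^t* + B^t*.
Proof. by rewrite linearD map_mxD. Qed.

Lemma adjcN m n (A : 'M[C]_(m, n)) : (- A)^t* = - A^t*.
Proof. by rewrite linearN map_mxN. Qed.

Lemma adjcZ m n (a : R) (A : 'M[C]_(m, n)) : (a%:C *: A)^t* = a%:C *: A^t*.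
Proof.
by apply/matrixP => i j; rewrite !mxE rmorphM; congr (_ * _); exact: conjc_real.
Qed.

Lemma adjc1 n : (1%:M : 'M[C]_n)^t* = 1%:M.
Proof. by rewrite trmx1 map_mx1. Qed.

Lemma adjc_sum m n (I : Type) (r : seq I) (F : I -> 'M[C]_(m, n)) :
  (\sum_(i <- r) F i)^t* = \sum_(i <- r) (F i)^t*.
Proof. by rewrite linear_sum map_mx_sum. Qed.

Definition hdot N (u v : 'cV[C]_N) : R := repair (u^t*) v.

Context {N : nat}.
Implicit Types (u v w : 'cV[C]_N).

Lemma hdotC u v : hdot u v = hdot v u.
Proof.
rewrite /hdot /repair.
have -> : u^t* *m v = (v^t* *m u)^t* by rewrite adjcM trmxCK.
by rewrite !mxE; case: (\sum_j _).
Qed.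

Lemma hdotDl u v w : hdot (u + v) w = hdot u w + hdot v w.
Proof. by rewrite /hdot adjcD repairDl. Qed.

Lemma hdotDr u v w : hdot u (v + w) = hdot u v + hdot u w.
Proof. by rewrite /hdot repairDr. Qed.

Lemma hdotZl (a : R) u v : hdot (a%:C *: u) v = a * hdot u v.
Proof. by rewrite /hdot adjcZ repairZl. Qed.

Lemma hdotZr (a : R) u v : hdot u (a%:C *: v) = a * hdot u v.
Proof. by rewrite /hdot repairZr. Qed.

Lemma hdotNl u v : hdot (- u) v = - hdot u v.
Proof. by rewrite -mulN1r -hdotZl; congr (hdot _ _); rewrite rmorphN1 scaleN1r. Qed.

Lemma hdotNr u v : hdot u (- v) = - hdot u v.
Proof. by rewrite hdotC hdotNl hdotC. Qed.

Lemma hdot_mulmxl (M : 'M[C]_N) u v : hdot (M *m u) v = hdot u (M^t* *m v).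
Proof. by rewrite /hdot adjcM repair_mulmx. Qed.

Lemma hdot_sum u v : hdot u v = \sum_a
  (complex.Re (u a 0) * complex.Re (v a 0) + complex.Im (u a 0) * complex.Im (v a 0)).
Proof.
rewrite /hdot /repair mxE.
have -> : complex.Re (\sum_j u^t* 0 j * v j 0) = \sum_j complex.Re (u^t* 0 j * v j 0).
  by elim/big_rec2 : _ => // i y z _ <-; rewrite ReD.
apply: eq_bigr => a _; rewrite !mxE.
by case: (u a 0) (v a 0) => [? ?] [? ?] /=; rewrite mulNr opprK.
Qed.

Lemma hdot_ge0 u : 0 <= hdot u u.
Proof.
by rewrite hdot_sum; apply: sumr_ge0 => a _; rewrite addr_ge0// -expr2 sqr_ge0.
Qed.

Lemma hdot_eq0 u : hdot u u = 0 -> u = 0.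
Proof.
rewrite hdot_sum => /eqP; rewrite psumr_eq0; last first.
  by move=> a _; rewrite addr_ge0// -expr2 sqr_ge0.
move=> /allP u0; apply/colP => a; rewrite mxE.
have := u0 a (mem_index_enum _); rewrite /= -!expr2 paddr_eq0 ?sqr_ge0// !sqrf_eq0.
by case: (u a 0) => x y /= /andP[/eqP -> /eqP ->].
Qed.

Lemma repair_inj u v : (forall w : 'rV[C]_N, repair w u = repair w v) -> u = v.
Proof.
move=> uv; apply/eqP; rewrite -subr_eq0; apply/eqP/hdot_eq0.
by rewrite hdotDr hdotNr /hdot uv subrr.
Qed.

End Adjoint.

Section Orthogonality.
Context {R : realType} {n : nat}.
Local Notation U := (@punctured R n.+1).

(** Green's formula evaluates the Dirichlet pairing of f and g once with the factor - a and once
    with - b. *)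
Lemma orthogonal_eigenfunctions (f g : 'rV[R]_n.+1 -> R) (a b : R) :
  homogeneous0 f -> homogeneous0 g -> Ck 2 U f -> Ck 2 U g -> a != b ->
  (forall x, sphere x -> \sum_l partial l (partial l f) x = a * f x) ->
  (forall x, sphere x -> \sum_l partial l (partial l g) x = b * g x) ->
  sphere_int (fun x => f x * g x) = 0.
Proof.
move=> hf hg f2 g2 ab Lf Lg.
have cfg : continuous_on_sphere (fun x => f x * g x).
  by apply: continuous_on_sphereM; [exact: continuous_on_sphere_Ck f2|
                                    exact: continuous_on_sphere_Ck g2].
have Gfg : sphere_int (fun x => \sum_l partial l f x * partial l g x) =
    - (b * sphere_int (fun x => f x * g x)).
  rewrite green// -sphere_intZ//; congr (- _); apply: eq_sphere_int => x x1.
  by rewrite Lg// mulrCA.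
have Ggf : sphere_int (fun x => \sum_l partial l f x * partial l g x) =
    - (a * sphere_int (fun x => f x * g x)).
  under eq_fun do under eq_bigr do rewrite mulrC.
  rewrite green// -sphere_intZ//; congr (- _); apply: eq_sphere_int => x x1.
  by rewrite Lf// mulrCA (mulrC (g x)).
apply/eqP; move: Gfg; rewrite Ggf => /eqP; rewrite eqr_opp -subr_eq0 -mulrBl.
by rewrite mulf_eq0 subr_eq0 (negbTE ab).
Qed.

End Orthogonality.

Lemma sum_delta (R : realType) (I : finType) (i : I) (F : I -> R) :
  \sum_j F j * (i == j)%:R = F i.
Proof.
rewrite (bigD1 i)//= eqxx mulr1 big1 ?addr0// => j /negbTE ij.
by rewrite eq_sym ij mulr0.
Qed.

(** * The integral identity for vector-valued solutions *)

Section FlatInequality.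
Context {R : realType} {n N : nat}.
Context (A At : 'I_n.+1 -> 'M[R[i]]_N).
Context (AAt : forall j l, A j *m At l + A l *m At j = (- (2%:R *+ (j == l)))%:M).
Context (AtA : forall j l, At j *m A l + At l *m A j = (- (2%:R *+ (j == l)))%:M).
Context (adjA : forall j, (A j)^t* = - At j).
Context (Phi : 'rV[R]_n.+1 -> 'cV[R[i]]_N) (mu : R).

Local Notation U := (@punctured R n.+1).
Local Notation h u := (fun x => repair u (Phi x)).
Implicit Types (u w : 'rV[R[i]]_N) (x : 'rV[R]_n.+1).

Context (h_smooth : forall u k, Ck k U (h u)).
Context (h_homog : forall u, homogeneous0 (h u)).
Context (h_dirac : forall u x, U x ->
  \sum_j \sum_l x 0 j * partial l (h (u *m A j *m At l)) x = mu * repair u (Phi x)).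
Context (v : 'cV[R[i]]_N) (v1 : hdot v v = 1).

Definition clin (B : 'I_n.+1 -> 'M[R[i]]_N) (x : 'rV[R]_n.+1) : 'M[R[i]]_N :=
  \sum_j (x 0 j)%:C *: B j.

Lemma adjAt j : (At j)^t* = - A j.
Proof. by have := adjA j => /(congr1 (fun M => - M^t*)); rewrite trmxCK adjcN opprK => ->. Qed.

Lemma clin_mulmx B B' x y :
  clin B x *m clin B' y = \sum_j \sum_l (x 0 j * y 0 l)%:C *: (B j *m B' l).
Proof.
rewrite mulmx_suml; apply: eq_bigr => j _; rewrite mulmx_sumr; apply: eq_bigr => l _.
by rewrite -scalemxAl -scalemxAr scalerA rmorphM.
Qed.

Lemma clin_anticommute B B' x y :
  (forall j l, B j *m B' l + B l *m B' j = (- (2%:R *+ (j == l)))%:M) ->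
  clin B x *m clin B' y + clin B y *m clin B' x = (- (2 * dot x y))%:C%:M.
Proof.
move=> BB; rewrite !clin_mulmx [X in _ + X]exchange_big -big_split /=.
transitivity (\sum_j (x 0 j * y 0 j)%:C *: ((- 2%:R)%:M : 'M[R[i]]_N)).
  apply: eq_bigr => j _; rewrite -big_split /= (bigD1 j)//= big1 ?addr0.
    by rewrite (mulrC (y 0 _)) -scalerDr BB eqxx.
  move=> l /negbTE jl; rewrite (mulrC (y 0 _)) -scalerDr BB eq_sym jl mulr0n oppr0.
  by apply/matrixP => a b; rewrite !mxE mul0rn mulr0.
rewrite -scaler_suml -rmorph_sum scale_scalar_mx -/(dot x y); congr scalar_mx.
by rewrite mulrN rmorphN rmorphM /= rmorph_nat mulrC.
Qed.

Lemma clin_sqr B B' x :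
  (forall j l, B j *m B' l + B l *m B' j = (- (2%:R *+ (j == l)))%:M) ->
  clin B x *m clin B' x = (- dot x x)%:C%:M.
Proof.
move=> BB; have := clin_anticommute x x BB => E.
apply: (@scalerI _ _ 2%:R); first by rewrite pnatr_eq0.
rewrite scaler_nat mulr2n E scale_scalar_mx; congr scalar_mx.
by rewrite !rmorphN rmorphM /= rmorph_nat mulrN.
Qed.

Lemma clin_adj B x : (clin B x)^t* = \sum_j (x 0 j)%:C *: (B j)^t*.
Proof. by rewrite adjc_sum; apply: eq_bigr => j _; rewrite adjcZ. Qed.

Lemma clinA_adj x : (clin A x)^t* = - clin At x.
Proof. by rewrite clin_adj -sumrN; apply: eq_bigr => j _; rewrite adjA scalerN. Qed.

Lemma clinAt_adj x : (clin At x)^t* = - clin A x.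
Proof. by rewrite clin_adj -sumrN; apply: eq_bigr => j _; rewrite adjAt scalerN. Qed.

(** The adjoint of A(x) A'(d) is A(d) A'(x), and orthogonal vectors anticommute. *)
Lemma clin_tangent_adj x d : dot x d = 0 ->
  (clin A x *m clin At d)^t* = - (clin A x *m clin At d).
Proof.
move=> xd; rewrite adjcM clinA_adj clinAt_adj mulNmx mulmxN opprK.
have := clin_anticommute x d AAt; rewrite xd mulr0 oppr0.
have -> : ((0 : R)%:C%:M : 'M[R[i]]_N) = 0 by apply/matrixP => a b; rewrite !mxE mul0rn.
by move/eqP; rewrite addrC addr_eq0 => /eqP.
Qed.

(** A skew-adjoint matrix has zero real quadratic form; hence f xi and df . xi are pointwise
    orthogonal. *)
Lemma hdot_clin_tangent x d (z : 'cV[R[i]]_N) : dot x d = 0 ->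
  hdot z (clin A x *m clin At d *m z) = 0.
Proof.
move=> /clin_tangent_adj BE; have : hdot z (clin A x *m clin At d *m z) =
    - hdot z (clin A x *m clin At d *m z).
  by rewrite {1}hdotC hdot_mulmxl BE mulNmx hdotNr.
lra.
Qed.

Let g x := repair (v^t*) (Phi x).
(** The vector field with <y, w> = Re <v, A(x) A'(y) Phi>. For tangent y this is - <A(x) A'(y) v,
    Phi>, so y = grad g gives the cross term of the residual. *)
Let w l x := \sum_j x 0 j * repair (v^t* *m A j *m At l) (Phi x).
Let dg x : 'rV[R]_n.+1 := \row_l partial l g x.
Let c := mu + n%:R - 1.

Let oU := @open_punctured R n.+1.

Lemma Ck_w l k : Ck k U (w l).
Proof. by apply: Ck_sum => // j; apply: CkM => //; exact: Ck_coord. Qed.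

Lemma sphere_int_grad2 :
  sphere_int (fun x => \sum_l partial l g x * partial l g x) =
  mu * c * sphere_int (fun x => g x ^+ 2).
Proof.
have cg : continuous_on_sphere g by apply: continuous_on_sphere_Ck (h_smooth _ 0).
have cg2 : continuous_on_sphere (fun x => g x ^+ 2).
  under eq_fun do rewrite expr2; exact: continuous_on_sphereM.
rewrite green//; [|exact: h_homog|exact: h_homog|exact: h_smooth|exact: h_smooth].
apply/eqP; rewrite eqr_oppLR -mulNr -sphere_intZ//; apply/eqP.
apply: eq_sphere_int => x x1.
by rewrite (laplacian_dirac AAt AtA h_smooth h_homog h_dirac _ x1) -/(g x) -/c; ring.
Qed.

Lemma partial_w i l x : U x -> partial i (w l) x =
  repair (v^t* *m A i *m At l) (Phi x)
    + \sum_j x 0 j * partial i (h (v^t* *m A j *m At l)) x.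
Proof.
move=> Ux.
have dx j : differentiable (fun y : 'rV[R]_n.+1 => y 0 j) x by exact: differentiable_coord.
have dhx j : differentiable (h (v^t* *m A j *m At l)) x.
  by have /CkSP[+ _] := h_smooth (v^t* *m A j *m At l) 1; exact.
have -> : w l = \sum_j (fun y : 'rV[R]_n.+1 => y 0 j * repair (v^t* *m A j *m At l) (Phi y)).
  by apply/funext => y; rewrite fct_sumE.
rewrite [LHS]derive_sum => [|j]; last by apply: diff_derivable; exact: differentiableM.
have pj j := partialM i (dx j) (dhx j).
rewrite (eq_bigr _ (fun j _ => pj j)) big_split addrC /=; congr (_ + _).
by under eq_bigr do rewrite partial_coord; exact: (sum_delta _ (fun j => repair _ _)).
Qed.

(** The field has degree one: a coordinate of x times functions of degree zero. *)
Lemma radial_w l x : U x -> radial_derivative (w l) x = w l x.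
Proof.
move=> Ux; rewrite /radial_derivative.
under eq_bigr do rewrite partial_w// mulrDr.
rewrite big_split /= [X in _ + X](_ : _ = 0) ?addr0//.
under eq_bigr do rewrite mulr_sumr.
rewrite exchange_big big1// => j _.
have dhx : differentiable (h (v^t* *m A j *m At l)) x.
  by have /CkSP[+ _] := h_smooth (v^t* *m A j *m At l) 1; exact.
transitivity (x 0 j * \sum_i x 0 i * partial i (h (v^t* *m A j *m At l)) x).
  by rewrite mulr_sumr; apply: eq_bigr => i _; exact: mulrCA.
by rewrite (euler (@h_homog _) dhx) mulr0.
Qed.

Lemma w_clin x (y : 'rV[R]_n.+1) :
  \sum_l y 0 l * w l x = repair (v^t* *m (clin A x *m clin At y)) (Phi x).
Proof.
rewrite clin_mulmx mulmx_sumr repair_suml.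
under [RHS]eq_bigr do rewrite mulmx_sumr repair_suml.
rewrite [RHS]exchange_big; apply: eq_bigr => l _; rewrite /w mulr_sumr.
apply: eq_bigr => j _; rewrite -scalemxAr repairZl mulmxA; ring.
Qed.

(** Differentiating the coefficient x_j produces \sum_l A_l A'_l = - (n + 1), and differentiating
    Phi produces the Dirac operator. *)
Lemma sum_partial_w x : sphere x -> \sum_l partial l (w l) x = (mu - n.+1%:R) * g x.
Proof.
move=> /sphere_punctured Ux.
under eq_bigr do rewrite partial_w//.
rewrite big_split /= [X in _ + X]exchange_big /= h_dirac//.
rewrite (eq_bigr (fun=> - g x)) => [|m _].
  by rewrite sumrN sumr_const card_ord -mulr_natl; rewrite /g; ring.
rewrite -mulmxA.
have := additive_anticommutator (v^t*) (fun v w => repairDl v w (Phi x)) (AAt m m).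
by rewrite eqxx mulr1n /g; lra.
Qed.

(** Divergence theorem for g w, which is not tangent: <x, w> = - g because A(x) A'(x) = -1. The
    resulting (n + 1) g^2 cancels the one in [sum_partial_w], and mu g^2 is left. *)
Lemma sphere_int_grad_w :
  sphere_int (fun x => \sum_l partial l g x * w l x) = - (mu * sphere_int (fun x => g x ^+ 2)).
Proof.
have g1 : Ck 1 U g by exact: h_smooth.
have cg : continuous_on_sphere g by apply: continuous_on_sphere_Ck (h_smooth _ 0).
have cg2 : continuous_on_sphere (fun x => g x ^+ 2).
  under eq_fun do rewrite expr2; exact: continuous_on_sphereM.
have cw : continuous_on_sphere (fun x => \sum_l partial l g x * w l x).
  apply: continuous_on_sphere_sum => l; apply: continuous_on_sphereM.
    by have /CkSP[_ /(_ l)] := g1; exact: continuous_on_sphere_Ck.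
  exact: continuous_on_sphere_Ck (Ck_w l 0).
have cW l : Ck 1 U (fun x => g x * w l x) by apply: CkM => //; exact: Ck_w.
apply/eqP; rewrite -addr_eq0 -sphere_intZ// -sphere_intD//; last first.
  by apply: continuous_on_sphereM => //; exact: continuous_on_sphere_cst.
apply/eqP; rewrite -[RHS](divergence_theorem cW); apply: eq_sphere_int => x x1.
have Ux := sphere_punctured x1.
have dgx : differentiable g x by have /CkSP[+ _] := g1; exact.
have dwx l : differentiable (w l) x by have /CkSP[+ _] := Ck_w l 1; exact.
have pW i l : partial i (fun y => g y * w l y) x =
    g x * partial i (w l) x + w l x * partial i g x by exact: partialM.
have rW l : radial_derivative (fun y => g y * w l y) x = g x * w l x.
  rewrite /radial_derivative.
  transitivity (g x * radial_derivative (w l) x + w l x * radial_derivative g x).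
    rewrite /radial_derivative !mulr_sumr -big_split; apply: eq_bigr => i _ /=.
    by rewrite pW; ring.
  by rewrite radial_w// /radial_derivative (euler (@h_homog _) dgx) mulr0 addr0.
have xw : \sum_l x 0 l * w l x = - g x.
  by rewrite w_clin clin_sqr// x1 mul_mx_scalar repairZl mulN1r.
transitivity (g x * (\sum_l partial l (w l) x) + \sum_l partial l g x * w l x
   - (1 + n%:R) * g x * \sum_l x 0 l * w l x).
  by rewrite sum_partial_w// xw -natr1; ring.
rewrite !mulr_sumr -big_split -sumrB; apply: eq_bigr => l _ /=.
by rewrite pW rW; ring.
Qed.

(** Expand the square with B = A(x) A'(grad g): B is skew, so B v is orthogonal to v, and B^t* B =
    |grad g|^2. *)
Lemma hdot_clin_residual x : sphere x ->
  hdot (Phi x - (g x)%:C *: v - (c^-1)%:C *: (clin A x *m clin At (dg x) *m v))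
       (Phi x - (g x)%:C *: v - (c^-1)%:C *: (clin A x *m clin At (dg x) *m v)) =
  hdot (Phi x) (Phi x) - g x ^+ 2
  + (c^-1 ^+ 2 * (\sum_l partial l g x * partial l g x)
     + 2 * c^-1 * \sum_l partial l g x * w l x).
Proof.
move=> x1; have Ux := sphere_punctured x1.
have dgx : differentiable g x by have /CkSP[+ _] := h_smooth (v^t*) 1; exact.
set B := clin A x *m clin At (dg x).
have xdg : dot x (dg x) = 0.
  by rewrite -(euler (@h_homog _) dgx); apply: eq_bigr => l _; rewrite mxE.
have BE : B^t* = - B := clin_tangent_adj xdg.
have BB : B^t* *m B = (dot (dg x) (dg x))%:C%:M.
  rewrite {1}/B adjcM clinA_adj clinAt_adj mulNmx mulmxN opprK /B.
  rewrite mulmxA -(mulmxA (clin A (dg x))) clin_sqr// x1.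
  rewrite -mulmxA mul_scalar_mx -scalemxAr clin_sqr// scale_scalar_mx -rmorphM.
  by congr (_%:C%:M); ring.
have vB : hdot v (B *m v) = 0 := hdot_clin_tangent v xdg.
have PB : hdot (Phi x) (B *m v) = - \sum_l partial l g x * w l x.
  rewrite hdotC hdot_mulmxl BE mulNmx hdotNr; congr (- _).
  transitivity (\sum_l dg x 0 l * w l x); last by apply: eq_bigr => l _; rewrite mxE.
  by rewrite w_clin repair_mulmx.
have Bv : hdot (B *m v) (B *m v) = \sum_l partial l g x * partial l g x.
  rewrite hdot_mulmxl mulmxA BB mul_scalar_mx hdotZr v1 mulr1.
  by apply: eq_bigr => l _; rewrite !mxE.
have gE : hdot (Phi x) v = g x by rewrite hdotC.
rewrite !(hdotDl, hdotDr, hdotNl, hdotNr, hdotZl, hdotZr) v1 vB PB Bv gE.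
rewrite (hdotC (B *m v) (Phi x)) PB (hdotC (B *m v) v) vB (hdotC v (Phi x)) gE; ring.
Qed.

Lemma Ck_hdot k : Ck k U (fun x => hdot (Phi x) (Phi x)).
Proof.
have ReE a x : complex.Re (Phi x a 0) = repair (delta_mx 0 a) (Phi x).
  by rewrite /repair -rowE mxE.
(* Multiplying by - i moves the imaginary part into the real part, the only one seen by [repair]. *)
have ImE a x : complex.Im (Phi x a 0) = repair (- 'i%C *: delta_mx 0 a) (Phi x).
  rewrite /repair -scalemxAl -rowE !mxE; case: (Phi x a 0) => y z /=; ring.
apply: (Ck_ext (f := fun x => \sum_a
    (repair (delta_mx 0 a) (Phi x) * repair (delta_mx 0 a) (Phi x) +
     repair (- 'i%C *: delta_mx 0 a) (Phi x) * repair (- 'i%C *: delta_mx 0 a) (Phi x)))) => //.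
  by apply: Ck_sum => // a; apply: CkD => //; exact: CkM.
by move=> x _; rewrite hdot_sum; apply: eq_bigr => a _; rewrite ReE ImE.
Qed.

Let residual x :=
  hdot (Phi x - (g x)%:C *: v - (c^-1)%:C *: (clin A x *m clin At (dg x) *m v))
       (Phi x - (g x)%:C *: v - (c^-1)%:C *: (clin A x *m clin At (dg x) *m v)).

Let Ck0_sphere f : Ck 0 U f -> continuous_on_sphere f.
Proof. exact: continuous_on_sphere_Ck. Qed.

Let Ck0_h2 : Ck 0 U (fun x => hdot (Phi x) (Phi x)).
Proof. exact: Ck_hdot. Qed.

Let Ck0_g2 : Ck 0 U (fun x => g x ^+ 2).
Proof. exact: (CkM oU (h_smooth _ 0) (h_smooth _ 0)). Qed.

Let Ck0_dg l : Ck 0 U (partial l g).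
Proof. by have /CkSP[_ /(_ l)] := h_smooth (v^t*) 1. Qed.

Let Ck0_dg2 : Ck 0 U (fun x => \sum_l partial l g x * partial l g x).
Proof. by apply: Ck_sum => // l; exact: (CkM oU). Qed.

Let Ck0_dgw : Ck 0 U (fun x => \sum_l partial l g x * w l x).
Proof. by apply: Ck_sum => // l; apply: (CkM oU) => //; exact: Ck_w. Qed.

Lemma sphere_int_residual : c != 0 ->
  sphere_int residual = sphere_int (fun x => hdot (Phi x) (Phi x))
   - (c + mu) / c * sphere_int (fun x => g x ^+ 2).
Proof.
move=> c0; rewrite (eq_sphere_int hdot_clin_residual).
under eq_fun do rewrite -mulN1r.
rewrite sphere_intD; [|exact: Ck0_sphere (CkD _ _ (CkZ _ _ _))|
  exact: Ck0_sphere (CkD _ (CkZ _ _ _) (CkZ _ _ _))].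
rewrite !sphere_intD ?sphere_intZ; try (by apply: Ck0_sphere; repeat apply: CkZ => //).
(* The factor of \int g^2 is - 1 + mu c / c^2 - 2 mu / c = - (c + mu) / c. *)
by rewrite sphere_int_grad2 sphere_int_grad_w; field.
Qed.

Lemma residual_eq0 : sphere_int residual = 0 ->
  forall x, sphere x ->
  Phi x = (g x)%:C *: v + (c^-1)%:C *: (clin A x *m clin At (dg x) *m v).
Proof.
rewrite (eq_sphere_int hdot_clin_residual) => r0 x x1.
have := sphere_int_eq0 _ _ r0 x1; rewrite -hdot_clin_residual// => H.
apply/eqP; rewrite -subr_eq0 opprD addrA; apply/eqP/hdot_eq0/H.
  apply: Ck0_sphere; apply: (CkD oU (CkB oU Ck0_h2 Ck0_g2)).
  exact: (CkD oU (CkZ _ oU Ck0_dg2) (CkZ _ oU Ck0_dgw)).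
by move=> y y1; rewrite -hdot_clin_residual//; exact: hdot_ge0.
Qed.

End FlatInequality.

(** * Spin(n+1) and its frames *)

Lemma mulmx_block_diag (K : pzSemiRingType) m n (A C : 'M[K]_m) (B D : 'M[K]_n) :
  block_mx A 0 0 B *m block_mx C 0 0 D = block_mx (A *m C) 0 0 (B *m D).
Proof. by rewrite mulmx_block !mulmx0 !mul0mx !addr0 !add0r. Qed.

Section CliffordSpin.
Context {R : realType} {n : nat} (gamma : 'I_n -> 'M[R[i]]_(2 ^ n./2)).
Context (hgamma : spinor_rep gamma).
Local Notation C := R[i].
Local Notation N := (2 ^ n./2)%N.
Local Notation cl := (cl gamma).
Local Notation e := (cl_basis gamma).
Local Notation Spin := (Spin gamma).
Local Notation frame := (frame gamma).
Local Notation base := (base gamma).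
Local Notation tframe := (tframe gamma).
Implicit Types (S T : 'M[C]_(N + N)) (x y v w : 'rV[R]_n.+1).

(* In the splitting of Sigma_n + Sigma_n, e_j is off-diagonal with blocks A_j and
   A'_j, while Spin(n+1) is block diagonal. *)
Definition half_spin (j : 'I_n.+1) : 'M[C]_N :=
  if unlift ord0 j is Some i then gamma i else 1%:M.
Definition half_spin' (j : 'I_n.+1) : 'M[C]_N :=
  if unlift ord0 j is Some i then gamma i else - 1%:M.
Local Notation A := half_spin.
Local Notation A' := half_spin'.

Lemma cl_basisE j : e j = block_mx 0 (A j) (A' j) 0.
Proof. by rewrite /cl_basis /half_spin /half_spin'; case: unlift. Qed.

Let scalarN2 (b : bool) : (- (2%:R *+ b))%:M = - ((1%:M : 'M[C]_N) *+ 2 *+ b).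
Proof.
have -> : (2%:R *+ b : C) = 1 *+ 2 *+ b by [].
by rewrite (raddfN (@scalar_mx C N)) /= !(raddfMn (@scalar_mx C N)).
Qed.

Lemma half_spin_anticommute j l :
  A j *m A' l + A l *m A' j = (- (2%:R *+ (j == l)))%:M.
Proof.
have [gg _] := hgamma; rewrite /half_spin /half_spin'.
case: (unliftP ord0 j) => [j' ->|->]; case: (unliftP ord0 l) => [l' ->|->].
- by rewrite (inj_eq lift_inj) gg.
- rewrite mulmxN mulmx1 mul1mx addNr eq_sym (negbTE (neq_lift _ _)) scalarN2.
  by rewrite mulr0n oppr0.
- rewrite mulmxN mulmx1 mul1mx addrN (negbTE (neq_lift _ _)) scalarN2.
  by rewrite mulr0n oppr0.
- by rewrite eqxx mulmxN mulmx1 scalarN2 mulr1n mulr2n opprD.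
Qed.

Lemma half_spin_anticommute' j l :
  A' j *m A l + A' l *m A j = (- (2%:R *+ (j == l)))%:M.
Proof.
have [gg _] := hgamma; rewrite /half_spin /half_spin'.
case: (unliftP ord0 j) => [j' ->|->]; case: (unliftP ord0 l) => [l' ->|->].
- by rewrite (inj_eq lift_inj) gg.
- rewrite mulNmx mulmx1 mul1mx addrN eq_sym (negbTE (neq_lift _ _)) scalarN2.
  by rewrite mulr0n oppr0.
- rewrite mulNmx mulmx1 mul1mx addNr (negbTE (neq_lift _ _)) scalarN2.
  by rewrite mulr0n oppr0.
- by rewrite eqxx mulNmx mulmx1 scalarN2 mulr1n mulr2n opprD.
Qed.

Lemma half_spin_adj j : (A j)^t* = - A' j.
Proof.
have [_ gadj] := hgamma; rewrite /half_spin /half_spin'.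
by case: unlift => [i|]; rewrite ?gadj// adjc1 opprK.
Qed.

Lemma clE v : cl v = block_mx 0 (clin A v) (clin A' v) 0.
Proof.
rewrite /Defs.cl /clin; apply: (big_rec3 (fun s a b => s = block_mx 0 a b 0)).
  by rewrite block_mx0.
move=> j s a b _ ->; rewrite cl_basisE scale_block_mx add_block_mx !scaler0 !addr0.
by [].
Qed.

Lemma cl_mul v w : cl v *m cl w =
  block_mx (clin A v *m clin A' w) 0 0 (clin A' v *m clin A w).
Proof. by rewrite !clE mulmx_block !mulmx0 !mul0mx !addr0 !add0r. Qed.

Lemma cl_anticommute v w : cl v *m cl w + cl w *m cl v = (- (2 * dot v w))%:C%:M.
Proof.
rewrite !cl_mul add_block_mx !addr0 (clin_anticommute _ _ half_spin_anticommute).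
by rewrite (clin_anticommute _ _ half_spin_anticommute') -scalar_mx_block.
Qed.

Lemma cl_sqr v : sphere v -> cl v *m cl v = - 1%:M.
Proof.
move=> v1; rewrite cl_mul (clin_sqr _ half_spin_anticommute).
by rewrite (clin_sqr _ half_spin_anticommute') -scalar_mx_block v1 rmorphN1 raddfN.
Qed.

Lemma clD v w : cl (v + w) = cl v + cl w.
Proof.
by rewrite /Defs.cl -big_split; apply: eq_bigr => j _ /=; rewrite mxE rmorphD scalerDl.
Qed.

Lemma clZ a v : cl (a *: v) = a%:C *: cl v.
Proof.
rewrite /Defs.cl scaler_sumr; apply: eq_bigr => j _ /=.
by rewrite mxE rmorphM scalerA.
Qed.

Lemma clN v : cl (- v) = - cl v.
Proof. by rewrite -scaleN1r clZ rmorphN1 scaleN1r. Qed.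

Lemma cl_delta j : cl (delta_mx 0 j) = e j.
Proof.
rewrite /Defs.cl (bigD1 j)//= big1 ?addr0 => [|l /negbTE lj].
  by rewrite mxE !eqxx scale1r.
by rewrite mxE lj andbF scale0r.
Qed.

Lemma sphere_delta j : sphere (delta_mx 0 j : 'rV[R]_n.+1).
Proof. by rewrite /sphere /= dot_delta mxE !eqxx. Qed.

Lemma sphereN v : sphere v -> sphere (- v).
Proof. by rewrite /sphere /= dotNl dotNr opprK. Qed.

Lemma Spin_mulmx S T : Spin S -> Spin T -> Spin (S *m T).
Proof.
elim=> [|v w S' v1 w1 _ IH] sT; first by rewrite mul1mx.
by rewrite -mulmxA; apply: Spin_mul => //; exact: IH.
Qed.

Lemma Spin_cl2 v w : sphere v -> sphere w -> Spin (cl v *m cl w).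
Proof. by move=> v1 w1; rewrite -[_ *m _]mulmx1; apply: Spin_mul => //; exact: Spin_one. Qed.

Lemma Spin_inv S : Spin S -> exists T, Spin T /\ S *m T = 1%:M.
Proof.
elim=> [|v w S' v1 w1 sS' [T [sT ST]]].
  by exists 1%:M; split; [exact: Spin_one|rewrite mulmx1].
exists (T *m (cl w *m cl v)); split; first exact: Spin_mulmx sT (Spin_cl2 w1 v1).
rewrite -!mulmxA (mulmxA S') ST mul1mx (mulmxA (cl w) (cl w)) cl_sqr//.
by rewrite mulNmx mul1mx mulmxN cl_sqr// opprK.
Qed.

Lemma Spin_unit S : Spin S -> S \in unitmx.
Proof. by move=> /Spin_inv[T [_ /mulmx1_unit[]]]. Qed.

Lemma Spin_invmx S : Spin S -> Spin (invmx S).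
Proof.
move=> sS; have [T [sT ST]] := Spin_inv sS.
suff -> : invmx S = T by [].
by rewrite -[RHS](mulKmx (Spin_unit sS)) ST mulmx1.
Qed.

(** A product of two off-diagonal matrices is diagonal, and the upper block A(v) A'(w) is unitary
    for unit v and w. *)
Lemma Spin_block S : Spin S -> S = block_mx (ulsubmx S) 0 0 (drsubmx S) /\
  (ulsubmx S)^t* *m ulsubmx S = 1%:M.
Proof.
elim=> [|v w S' v1 w1 _ [SE SU]].
  by rewrite (scalar_mx_block N N) block_mxKul block_mxKdr adjc1 mulmx1.
move: (ulsubmx S') (drsubmx S') SE SU => P Q -> SU.
rewrite cl_mul mulmx_block_diag block_mxKul block_mxKdr; split => //.
rewrite !adjcM (clinA_adj half_spin_adj) (clinAt_adj half_spin_adj).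
rewrite mulmxN mulNmx opprK.
rewrite -!mulmxA (mulmxA (clin A' v)) (clin_sqr _ half_spin_anticommute').
rewrite (mulmxA (clin A w)) -!mulmxA.
rewrite v1 mul_scalar_mx -!scalemxAr (mulmxA (clin A w)) (clin_sqr _ half_spin_anticommute) w1.
by rewrite mul_scalar_mx -scalemxAr scalerA -rmorphM mulrNN mulr1 scale1r.
Qed.

Local Notation up S := (ulsubmx S : 'M[C]_N).

Lemma up_mulmx S T : Spin S -> up (S *m T) = up S *m up T.
Proof.
move=> /Spin_block[SE _].
have -> : S *m T = block_mx (up S) 0 0 (drsubmx S) *m
    block_mx (up T) (ursubmx T) (dlsubmx T) (drsubmx T) by rewrite -SE submxK.
by rewrite mulmx_block !mul0mx !addr0 block_mxKul.
Qed.

Lemma up_adjK S : Spin S -> (up S)^t* *m up S = 1%:M.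
Proof. by move=> /Spin_block[]. Qed.

Lemma up_adjVK S : Spin S -> up S *m (up S)^t* = 1%:M.
Proof. by move=> /up_adjK; exact: mulmx1C. Qed.

Lemma invmx_up S : Spin S -> invmx (up S) = (up S)^t*.
Proof.
move=> sS; have [_ u] := mulmx1_unit (up_adjK sS).
by rewrite -[LHS]mul1mx -(up_adjK sS) mulmxK.
Qed.

(** Cyclicity of the trace symmetrises the product, and the anticommutator is scalar. *)
Lemma trace_cl i y : complex.Re (\tr (e i *m cl y)) = - (N + N)%:R * y 0 i.
Proof.
have : \tr (e i *m cl y) *+ 2 = (- (2 * y 0 i))%:C *+ (N + N).
  rewrite mulr2n -{1}(mxtrace_mulC (cl y)) -mxtraceD addrC.
  by rewrite -{1 2}(cl_delta i) cl_anticommute dotC dot_delta mxtrace_scalar.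
have ReMn m (z : C) : complex.Re (z *+ m) = complex.Re z *+ m.
  by elim: m => [//|m IH]; rewrite !mulrSr ReD IH.
move=> /(congr1 (@complex.Re R)); rewrite [LHS]ReMn [RHS]ReMn -[RHS]mulr_natl.
move: (\tr _) ((N + N)%:R : R) => z k /= E.
by move: E; move: (complex.Re z) => r E; lra.
Qed.

Lemma spinor_dim_gt0 : 0 < (N + N)%:R :> R.
Proof. by rewrite ltr0n addn_gt0 expn_gt0. Qed.

(** Replaces the trace formula defining [frame] by the intertwining relation from which frames are
    computed below. *)
Lemma frameP S j y : Spin S -> S *m e j = cl y *m S -> frame S j = y.
Proof.
move=> sS SE; apply/rowP => i; rewrite mxE -(mulmxA (e i)) SE mulmxA mulmxK ?Spin_unit//.
by rewrite trace_cl mulNr opprK mulrAC mulfV ?mul1r// gt_eqF// spinor_dim_gt0.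
Qed.

(** Conjugation by a unit vector is minus the reflection in its orthogonal hyperplane; in an even
    product the signs cancel. *)
Lemma cl_reflect w y : sphere w -> cl w *m cl y = cl ((2 * dot w y) *: w - y) *m cl w.
Proof.
move=> w1; rewrite clD clZ clN mulmxDl mulNmx -scalemxAl cl_sqr//.
apply/eqP; rewrite eq_sym subr_eq eq_sym cl_anticommute scalerN.
by rewrite rmorphN raddfN /= scale_scalar_mx mulr1.
Qed.

Lemma Spin_rotation S y : Spin S -> exists y', S *m cl y = cl y' *m S.
Proof.
move=> sS; elim: sS y => [|v w S' v1 w1 _ IH] y; first by exists y; rewrite mulmx1 mul1mx.
have [y' E] := IH y; exists ((2 * dot v ((2 * dot w y') *: w - y')) *: v - ((2 * dot w y') *: w - y')).
by rewrite -mulmxA E mulmxA -(mulmxA (cl v)) cl_reflect// mulmxA cl_reflect// -!mulmxA.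
Qed.

Lemma Spin_frame S j : Spin S -> S *m e j = cl (frame S j) *m S.
Proof.
move=> sS; have [y] := Spin_rotation (delta_mx 0 j) sS; rewrite cl_delta => E.
by rewrite (frameP sS E).
Qed.

(** Conjugation by S preserves the scalar anticommutators; one diagonal entry of the matrices
    carries all the information. *)
Lemma frame_orthonormal S j l : Spin S -> dot (frame S j) (frame S l) = (j == l)%:R.
Proof.
move=> sS.
have E k k' : S *m (e k *m e k') = (cl (frame S k) *m cl (frame S k')) *m S.
  by rewrite mulmxA (Spin_frame k sS) -!mulmxA (Spin_frame k' sS).
have : S *m (e j *m e l + e l *m e j) =
   (cl (frame S j) *m cl (frame S l) + cl (frame S l) *m cl (frame S j)) *m S.
  by rewrite mulmxDr mulmxDl !E.
rewrite -{1 2}(cl_delta j) -{1 2}(cl_delta l) !cl_anticommute.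
rewrite mul_mx_scalar mul_scalar_mx -!mul_scalar_mx => /(congr1 (mulmx^~ (invmx S))).
rewrite !mulmxK ?Spin_unit// => /matrixP.
have p : (0 < N + N)%N by rewrite addn_gt0 expn_gt0.
move=> /(_ (Ordinal p) (Ordinal p)); rewrite !mxE eqxx !mulr1n => /(congr1 (@complex.Re R)) /=.
rewrite dot_delta mxE eqxx /= eq_sym => ?; lra.
Qed.

(** The matrix of the frame is square, so orthonormal rows force orthonormal columns. *)
Lemma frame_complete S a b : Spin S -> \sum_j frame S j 0 a * frame S j 0 b = (a == b)%:R.
Proof.
move=> sS; pose F : 'M[R]_n.+1 := \matrix_(j, a) frame S j 0 a.
have FE j k : F j k = frame S j 0 k by rewrite mxE.
have FF : F *m F^T = 1%:M.
  apply/matrixP => j l; rewrite [RHS]mxE -(frame_orthonormal j l sS) mxE.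
  by apply: eq_bigr => k _; rewrite [F^T _ _]mxE !FE.
have /matrixP/(_ a b) := mulmx1C FF; rewrite [RHS]mxE mxE => <-.
by apply: eq_bigr => k _; rewrite [F^T _ _]mxE !FE.
Qed.

(** [gamma i] is the upper block of e_0 e_i, and S conjugates this product to that of the base point
    and the frame vector. So Clifford multiplication by a tangent X at x becomes A(x) A'(X) in the
    trivialisation. *)
Lemma up_gamma S i : Spin S ->
  up S *m gamma i = clin A (base S) *m clin A' (tframe S i) *m up S.
Proof.
move=> sS.
have : S *m (e ord0 *m e (lift ord0 i)) = (cl (base S) *m cl (tframe S i)) *m S.
  by rewrite mulmxA (Spin_frame ord0 sS) -!mulmxA (Spin_frame _ sS).
have [SE _] := Spin_block sS.
move: (base S) (tframe S i) (ulsubmx S) (drsubmx S) SE => b X P Q ->.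
rewrite !cl_basisE cl_mul mulmx_block !mulmx0 !mul0mx !addr0 !add0r.
rewrite !mulmx_block_diag => /eq_block_mx[+ _ _ _].
by rewrite /half_spin unlift_none /half_spin' liftK mul1mx.
Qed.

Lemma sphere_base S : Spin S -> sphere (base S).
Proof. by move=> sS; rewrite /sphere /= frame_orthonormal// eqxx. Qed.

Lemma same_base S T : Spin S -> Spin T -> base S = base T ->
  structure_group gamma (invmx S *m T).
Proof.
move=> sS sT bST; split; first exact: Spin_mulmx (Spin_invmx sS) sT.
have uS := Spin_unit sS.
have E : invmx S *m cl (base S) = e ord0 *m invmx S.
  by rewrite -[LHS](mulmxK uS) -(mulmxA (invmx S)) -(Spin_frame ord0 sS) mulKmx.
by rewrite -mulmxA (Spin_frame ord0 sT) -[frame T ord0]bST mulmxA E -mulmxA.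
Qed.

Lemma up_equivariant (phi : spinor_fun R n) S T : equivariant gamma phi ->
  Spin S -> Spin T -> base S = base T -> up S *m phi S = up T *m phi T.
Proof.
move=> ephi sS sT bST; have gh := same_base sS sT bST; have [sh _] := gh.
have TE : T = S *m (invmx S *m T) by rewrite mulKVmx ?Spin_unit.
move: (invmx S *m T) gh sh TE => h gh sh ->.
rewrite (ephi S h sS gh) (up_mulmx h sS) /spin_rep (invmx_up sh) -!mulmxA.
by rewrite (mulmxA (up h)) (up_adjVK sh) mul1mx.
Qed.

(** The factor [cl (- y)] leaves y in place and makes the product even; with this sign v = y gives
    back S itself. *)
Lemma base_reflect S v : Spin S -> sphere v ->
  let y := base S in
  Spin (cl v *m cl (- y) *m S) /\ base (cl v *m cl (- y) *m S) = (2 * dot v y) *: v - y.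
Proof.
move=> sS v1 y; have y1 : sphere y := sphere_base sS.
have sT : Spin (cl v *m cl (- y) *m S) by apply: Spin_mul => //; exact: sphereN.
split=> //; apply: frameP => //.
rewrite -!mulmxA (Spin_frame ord0 sS) -/(base S) -/y (mulmxA (cl (- y))) clN mulNmx cl_sqr// opprK mul1mx.
rewrite !mulmxA -cl_reflect// -!mulmxA (mulmxA (cl y)) mulmxN cl_sqr// opprK mul1mx.
by [].
Qed.

Lemma Spin_horizontal S i t : Spin S -> Spin (horizontal gamma S i t).
Proof.
move=> sS; apply: Spin_mulmx => //.
(* Since e_0^2 = -1, the unit vector w = - cos e_0 + sin e_i satisfies e_0 w = cos + sin e_0 e_i,
   which exhibits the factor as a product of two unit vectors. *)
pose w : 'rV[R]_n.+1 := - (cos (t / 2) *: delta_mx 0 ord0) + sin (t / 2) *: delta_mx 0 (lift ord0 i).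
have w1 : sphere w.
  rewrite /sphere /= /w !(dotDl, dotDr, dotNl, dotNr, dotZl, dotZr, dot_delta) !mxE !eqxx /=.
  rewrite -[RHS](cos2Dsin2 (t / 2)). ring.
suff -> : (cos (t / 2))%:C%:M + (sin (t / 2))%:C *: (e ord0 *m e (lift ord0 i)) =
   cl (delta_mx 0 ord0) *m cl w by apply: Spin_cl2 => //; exact: sphere_delta.
rewrite /w clD clN !clZ mulmxDr mulmxN -!scalemxAr cl_sqr; last exact: sphere_delta.
by rewrite !cl_delta scalerN opprK scale_scalar_mx mulr1.
Qed.

(** Once S is cancelled, this is a computation in the algebra generated by a = e_0 and b = e_i,
    where conjugation doubles the half angle. *)
Lemma base_horizontal S i t : Spin S ->
  base (horizontal gamma S i t) = cos t *: base S + sin t *: tframe S i.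
Proof.
move=> sS; apply: frameP; first exact: Spin_horizontal.
have E0 : cl (base S) *m S = S *m e ord0 by rewrite (Spin_frame ord0 sS).
have E1 : cl (tframe S i) *m S = S *m e (lift ord0 i) by rewrite (Spin_frame (lift ord0 i) sS).
rewrite /horizontal; move: (base S) (tframe S i) E0 E1 => y X E0 E1.
rewrite clD (clZ (cos t)) (clZ (sin t)).
rewrite mulmxA mulmxDl -!scalemxAl E0 E1 !scalemxAr -!mulmxDr -!mulmxA; congr (S *m _).
set a := e ord0; set b := e (lift ord0 i).
have aa : a *m a = - 1%:M by rewrite /a -cl_delta cl_sqr//; exact: sphere_delta.
have bb : b *m b = - 1%:M by rewrite /b -cl_delta cl_sqr//; exact: sphere_delta.
have ba : b *m a = - (a *m b).
  apply/eqP; rewrite -addr_eq0 /a /b -!cl_delta cl_anticommute dot_delta mxE eqxx /=.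
  rewrite mulr0 oppr0; by apply/eqP/matrixP => ? ?; rewrite !mxE mul0rn.
have aba : a *m b *m a = b by rewrite -mulmxA ba mulmxN mulmxA aa mulNmx mul1mx opprK.
have bab : b *m (a *m b) = a by rewrite mulmxA ba mulNmx -mulmxA bb mulmxN mulmx1 opprK.
have aab : a *m (a *m b) = - b by rewrite mulmxA aa mulNmx mul1mx.
rewrite -[a *m (_ *: b)]scalemxAr [LHS]mulmxDl mul_scalar_mx -scalemxAl aba.
rewrite mulmxDl !mulmxDr -!scalemxAl !mul_mx_scalar -!scalemxAr bab aab.
have t2 : t = t / 2 + t / 2 by rewrite -splitr.
have c2 := cos2Dsin2 (t / 2).
have ct : cos t = cos (t / 2) ^+ 2 - sin (t / 2) ^+ 2 by rewrite {1}t2 cosD; ring.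
have st : sin t = 2 * (sin (t / 2) * cos (t / 2)) by rewrite {1}t2 sinD; ring.
(* The half angle is written as t - t/2, matching the product with cos t a + sin t b on the other
   side. *)
have Ec : cos (t / 2) = cos t * cos (t / 2) + sin t * sin (t / 2).
  by rewrite -[LHS](mul1r (cos (t / 2))) -[X in X * _]c2 ct st; ring.
have Es : sin (t / 2) = sin t * cos (t / 2) - cos t * sin (t / 2).
  by rewrite -[LHS](mul1r (sin (t / 2))) -[X in X * _]c2 ct st; ring.
rewrite [X in X%:C *: a + _ = _]Ec [X in _ + X%:C *: b = _]Es rmorphD rmorphB /= !rmorphM /= scalerDl scalerBl -!scalerA !scalerN.
rewrite -!addrA; congr (_ + _); rewrite [LHS]addrC [RHS]addrA; congr (_ + _).
by rewrite addrC.
Qed.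

Lemma up_horizontal_adj S i t : Spin S ->
  (up (horizontal gamma S i t))^t* =
  ((cos (t / 2))%:C%:M - (sin (t / 2))%:C *: gamma i) *m (up S)^t*.
Proof.
have [_ gadj] := hgamma; move=> sS; rewrite /horizontal up_mulmx// adjcM; congr (_ *m _).
rewrite !cl_basisE mulmx_block !mulmx0 !mul0mx !addr0 !add0r scale_block_mx.
rewrite (scalar_mx_block N N) add_block_mx block_mxKul adjcD adjcZ.
rewrite {1}/half_spin unlift_none /half_spin' liftK mul1mx gadj scalerN.
by congr (_ + _); rewrite -scalemx1 adjcZ adjc1.
Qed.

End CliffordSpin.

(** * Trivialisation of the spinor bundle *)

Section ComplexSmooth.
Context {R : realType} {m : nat}.
Local Notation C := R[i].
Implicit Types (V : set 'rV[R]_m) (f g : 'rV[R]_m -> C).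

Definition cCk k V f := Ck k V (fun x => complex.Re (f x)) /\ Ck k V (fun x => complex.Im (f x)).

Lemma cCk_cst k V (z : C) : cCk k V (fun _ => z).
Proof. by split; exact: Ck_cst. Qed.

Lemma cCk_real k V (f : 'rV[R]_m -> R) : Ck k V f -> cCk k V (fun x => (f x)%:C).
Proof. by split => //; exact: Ck_cst. Qed.

Lemma cCkM k V f g : open V -> cCk k V f -> cCk k V g -> cCk k V (fun x => f x * g x).
Proof.
move=> oV [fr fi] [gr gi]; split.
  apply: (Ck_ext oV (CkB oV (CkM oV fr gr) (CkM oV fi gi))) => x _.
  by case: (f x) (g x) => [? ?] [].
apply: (Ck_ext oV (CkD oV (CkM oV fr gi) (CkM oV fi gr))) => x _.
by case: (f x) (g x) => [? ?] [].
Qed.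

Lemma cCkD k V f g : open V -> cCk k V f -> cCk k V g -> cCk k V (fun x => f x + g x).
Proof.
move=> oV [fr fi] [gr gi]; split.
  by apply: (Ck_ext oV (CkD oV fr gr)) => x _; case: (f x) (g x) => [? ?] [].
by apply: (Ck_ext oV (CkD oV fi gi)) => x _; case: (f x) (g x) => [? ?] [].
Qed.

Lemma cCk_sum (I : Type) (r : seq I) k V (F : I -> 'rV[R]_m -> C) :
  open V -> (forall i, cCk k V (F i)) -> cCk k V (fun x => \sum_(i <- r) F i x).
Proof.
move=> oV cF; elim: r => [|i r IH].
  by under eq_fun do rewrite big_nil; exact: cCk_cst.
by under eq_fun do rewrite big_cons; exact: cCkD.
Qed.

End ComplexSmooth.

Section Trivialization.
Context {R : realType} {n : nat} (gamma : 'I_n -> 'M[R[i]]_(2 ^ n./2)).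
Context (hgamma : spinor_rep gamma) (hn : (0 < n)%N).
Local Notation C := R[i].
Local Notation N := (2 ^ n./2)%N.
Local Notation cl := (cl gamma).
Local Notation e := (cl_basis gamma).
Local Notation Spin := (Spin gamma).
Local Notation base := (base gamma).
Local Notation U := (@punctured R n.+1).
Local Notation up S := (ulsubmx S : 'M[C]_N).
Implicit Types (S T : 'M[C]_(N + N)) (x y v w : 'rV[R]_n.+1).

(* The product of the reflections in y = base S and in the bisector of x and y
   rotates y to the direction of x, smoothly away from the ray through - y. *)
Definition local_section S x : 'M[C]_(N + N) :=
  let z := x + enorm x *: base S in
  cl ((Num.sqrt (dot z z))^-1 *: z) *m cl (- base S) *m S.

Definition section_domain S : set 'rV[R]_n.+1 :=
  [set x | 0 < enorm x + dot x (base S)].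

Lemma section_domain_punctured S : section_domain S `<=` U.
Proof.
move=> x; rewrite /section_domain /punctured /= => H; apply/eqP => x0; move: H.
have d0 z : dot 0 z = 0 :> R by rewrite -(scale0r z) dotZl mul0r.
by rewrite x0 /enorm !d0 sqrtr0 addr0 ltxx.
Qed.

Lemma dot_section x y : sphere y ->
  dot (x + enorm x *: y) (x + enorm x *: y) = 2 * enorm x * (enorm x + dot x y).
Proof.
move=> y1; rewrite !(dotDl, dotDr, dotZl, dotZr) (dotC y x) y1 -sqr_enorm; ring.
Qed.

Lemma dot_section_gt0 S x : Spin S -> section_domain S x ->
  0 < dot (x + enorm x *: base S) (x + enorm x *: base S).
Proof.
move=> sS xS; rewrite (dot_section x (sphere_base hgamma sS)).
by rewrite !mulr_gt0// enorm_gt0//; exact: section_domain_punctured xS.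
Qed.

(** With y = base S and z = x + |x| y, one has <z, z> = 2 |x| <z, y>. Hence the image of y is z /
    |x| - y = x / |x|. *)
Lemma local_sectionP S x : Spin S -> section_domain S x ->
  Spin (local_section S x) /\ base (local_section S x) = (enorm x)^-1 *: x.
Proof.
move=> sS xS; have r0 : 0 < enorm x by apply/enorm_gt0/(@section_domain_punctured S).
have q0 := dot_section_gt0 sS xS; rewrite /local_section.
have y1 := sphere_base hgamma sS; have := dot_section x y1.
have BR v := @base_reflect _ _ _ hgamma S v sS.
move: xS q0 y1 BR; rewrite /section_domain /=.
move: (base S) => y xy; set z := x + enorm x *: y => q0 y1 BR q.
have v1 : sphere ((Num.sqrt (dot z z))^-1 *: z).
  rewrite /sphere /= dotZl dotZr mulrA -invfM -expr2 sqr_sqrtr ?mulVf// ?gt_eqF//.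
  exact: ltW.
have [sT ->] := BR _ v1; split => //.
rewrite dotZl scalerA.
have -> (a d : R) : 2 * (a * d) * a = 2 * (d * a ^+ 2) by ring.
rewrite exprVn sqr_sqrtr ?(ltW q0)//.
have -> : 2 * (dot z y * (dot z z)^-1) = (enorm x)^-1.
  have -> : dot z y = enorm x + dot x y by rewrite /z dotDl dotZl y1 mulr1 addrC.
  by rewrite q; field; rewrite !gt_eqF.
by rewrite /z scalerDr scalerA mulVf ?gt_eqF// scale1r addrK.
Qed.

Lemma Spin1_base : base 1%:M = delta_mx 0 ord0.
Proof.
apply: frameP => //; first exact: Spin_one.
by rewrite mul1mx mulmx1 cl_delta.
Qed.

(** The local section through 1 misses only the antipode of e_0. A second one, through a lift of
    e_1, reaches it; this is where a second coordinate is needed. *)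
Lemma base_surj x : sphere x -> exists S, Spin S /\ base S = x.
Proof.
have s1 : Spin 1%:M := Spin_one gamma.
have key S y : Spin S -> sphere y -> 0 < 1 + dot y (base S) ->
    exists T, Spin T /\ base T = y.
  move=> sS y1 H; exists (local_section S y).
  have := @local_sectionP S y sS; rewrite /section_domain /= enorm_sphere// invr1 scale1r.
  exact.
move=> x1; have [H|H] := ltP 0 (1 + dot x (base 1%:M)); first exact: key H.
pose i1 : 'I_n.+1 := lift ord0 (Ordinal hn).
have [T [sT bT]] : exists T, Spin T /\ base T = delta_mx 0 i1.
  apply: (key 1%:M) => //; first exact: sphere_delta.
  by rewrite Spin1_base dot_delta mxE /= addr0.
apply: (key T) => //; rewrite bT dot_delta.
rewrite Spin1_base dot_delta in H.
have : x 0 ord0 ^+ 2 + x 0 i1 ^+ 2 <= 1.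
  rewrite -x1 /dot big_ord_recl -expr2 lerD2l (bigD1 (Ordinal hn))//= -expr2 lerDl.
  by apply: sumr_ge0 => j _; rewrite -expr2 sqr_ge0.
by nra.
Qed.

(** An arbitrary choice, with no continuity in x; the default 0 does not occur off the origin. *)
Definition lift_at x : 'M[C]_(N + N) :=
  xget 0 [set S | Spin S /\ base S = (enorm x)^-1 *: x].

Lemma lift_atP x : U x -> Spin (lift_at x) /\ base (lift_at x) = (enorm x)^-1 *: x.
Proof.
move=> Ux; have [S HS] := base_surj (normalize_sphere Ux).
exact: (@xgetPex _ 0 [set T | Spin T /\ base T = (enorm x)^-1 *: x] (ex_intro _ S HS)).
Qed.

(* Independent of the lift, because [ulsubmx] is multiplicative on Spin(n+1) and
   restricts to the spin representation on the structure group. *)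
Definition trivialize (phi : spinor_fun R n) x : 'cV[C]_N :=
  up (lift_at x) *m phi (lift_at x).

Lemma trivialize_homogeneous phi (a : R) x : 0 < a -> trivialize phi (a *: x) = trivialize phi x.
Proof.
move=> a0; rewrite /trivialize /lift_at enormZ// scalerA invfM mulrAC mulVf ?mul1r//.
by rewrite gt_eqF.
Qed.

Lemma trivializeE phi S x : equivariant gamma phi -> Spin S -> U x ->
  base S = (enorm x)^-1 *: x -> trivialize phi x = up S *m phi S.
Proof.
move=> ephi sS Ux bS; have [sT bT] := lift_atP Ux.
exact: (@up_equivariant _ _ _ hgamma phi _ _ ephi sT sS (etrans bT (esym bS))).
Qed.

Lemma trivialize_base phi S : equivariant gamma phi -> Spin S ->
  trivialize phi (base S) = up S *m phi S.
Proof.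
move=> ephi sS; have b1 := sphere_base hgamma sS.
by apply: trivializeE => //; [exact: sphere_punctured|rewrite enorm_sphere// invr1 scale1r].
Qed.

Lemma spinor_of_trivialize phi S : equivariant gamma phi -> Spin S ->
  phi S = (up S)^t* *m trivialize phi (base S).
Proof. by move=> ephi sS; rewrite trivialize_base// mulmxA (up_adjK hgamma sS) mul1mx. Qed.

(** The lift chosen inside [integral_S] is immaterial for a function of the base point, and it
    exists because [base] is onto the sphere. *)
Lemma integral_SE (F : 'M[C]_(N + N) -> R) (g : 'rV[R]_n.+1 -> R) :
  (forall S, Spin S -> F S = g (base S)) -> integral_S gamma F = sphere_int g.
Proof.
move=> Fg; apply: eq_sphere_int => x x1; have [S HS] := base_surj x1.
have [sT bT] := @xgetPex _ 0 [set S | Spin S /\ base S = x] (ex_intro _ S HS).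
by rewrite Fg// bT.
Qed.

Lemma open_section_domain S : open (section_domain S).
Proof.
have d2 : Ck 0 setT (fun x : 'rV[R]_n.+1 => \sum_i x 0 i * x 0 i).
  apply: Ck_sum => [|i]; first exact: openT.
  by apply: CkM; [exact: openT|exact: Ck_coord|exact: Ck_coord].
have d1 : Ck 0 setT (fun x : 'rV[R]_n.+1 => \sum_i x 0 i * base S 0 i).
  apply: Ck_sum => [|i]; first exact: openT.
  by apply: CkM; [exact: openT|exact: Ck_coord|exact: Ck_cst].
have c : continuous (fun x : 'rV[R]_n.+1 => enorm x + dot x (base S)).
  move=> x; apply: (continuousD (f := @enorm R n.+1)); last exact: (d1 x I).
  by apply: continuous_comp; [exact: (d2 x I)|exact: sqrt_continuous].
rewrite (_ : section_domain S = (fun x : 'rV[R]_n.+1 => enorm x + dot x (base S)) @^-1` [set r | 0 < r])//.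
apply: open_comp => [x _|]; [exact: c|exact: open_gt].
Qed.

Lemma smooth_local_section S k a b : Spin S ->
  cCk k (section_domain S) (fun x => local_section S x a b).
Proof.
move=> sS; have oV := @open_section_domain S; have VU := @section_domain_punctured S.
pose z x := x + enorm x *: base S.
have zj j : Ck k (section_domain S) (fun x => z x 0 j).
  apply: (Ck_ext (f := fun x => x 0 j + enorm x * base S 0 j)) => // [|x _].
    apply: CkD => //; [exact: Ck_coord|apply: CkM => //; last exact: Ck_cst].
    exact: Ck_sub VU (Ck_enorm k).
  by rewrite /z; move: (base S) => y; rewrite !mxE.
have qV : Ck k (section_domain S) (fun x => (Num.sqrt (dot (z x) (z x)))^-1).
  apply: CkV => // [x xS|]; first by rewrite gt_eqF// sqrtr_gt0 dot_section_gt0.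
  apply: Ck_sqrt => // [x xS|]; first by rewrite dot_section_gt0.
  by apply: Ck_sum => // j; exact: CkM.
have E x : local_section S x a b = \sum_j ((Num.sqrt (dot (z x) (z x)))^-1 * z x 0 j)%:C *
    (e j *m (cl (- base S) *m S)) a b.
  rewrite /local_section -/(z x) -mulmxA; move: (cl (- base S) *m S) (z x) => M v.
  rewrite /Defs.cl mulmx_suml summxE; apply: eq_bigr => j _.
  by rewrite -scalemxAl !mxE.
suff : cCk k (section_domain S) (fun x => \sum_j ((Num.sqrt (dot (z x) (z x)))^-1 * z x 0 j)%:C *
    (e j *m (cl (- base S) *m S)) a b) by under eq_fun do rewrite -E.
apply: cCk_sum => // j; apply: cCkM => //; last exact: cCk_cst.
by apply: cCk_real; exact: CkM.
Qed.

(** Near each point the chosen lifts may be replaced by the local section through one of them, since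
    the value is independent of the lift; along this section phi is smooth by hypothesis. *)
Lemma smooth_trivialize phi k u : spinor_field gamma phi ->
  Ck k U (fun x => repair u (trivialize phi x)).
Proof.
move=> [sphi ephi]; apply: Ck_local => x1 Ux1.
have [sS bS] := lift_atP Ux1; set S := lift_at x1 in sS bS.
have oV := @open_section_domain S; have VU := @section_domain_punctured S.
exists (section_domain S); split.
  rewrite /section_domain /= bS dotZr -sqr_enorm expr2 mulKf ?gt_eqF ?enorm_gt0//.
  by rewrite addr_gt0 ?enorm_gt0.
have sm a b j : cCk j (section_domain S) (fun x => local_section S x a b).
  exact: smooth_local_section.
have phis a : cCk k (section_domain S) (fun x => phi (local_section S x) a 0).
  have [||fr fi] := sphi n.+1 (section_domain S) (local_section S) oV _ _ a.
  - by move=> x xS; have [] := local_sectionP sS xS.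
  - by move=> a' b; split=> j; have [] := sm a' b j.
  - by split; [exact: fr|exact: fi].
have cS : cCk k (section_domain S) (fun x => \sum_a u 0 a * \sum_b
     local_section S x (lshift _ a) (lshift _ b) * phi (local_section S x) b 0).
  apply: cCk_sum => // a; apply: cCkM => //; first exact: cCk_cst.
  by apply: cCk_sum => // b; exact: cCkM.
apply: (Ck_ext oV cS.1) => x xS.
have [sT bT] := local_sectionP sS xS.
rewrite (trivializeE ephi sT (VU _ xS) bT) /repair mxE; congr (complex.Re _).
by apply: eq_bigr => a _; rewrite mxE; congr (_ * _); apply: eq_bigr => b _; rewrite !mxE.
Qed.

Lemma homogeneous0_trivialize phi u : homogeneous0 (fun x => repair u (trivialize phi x)).
Proof. by move=> a x a0; rewrite trivialize_homogeneous. Qed.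

End Trivialization.

(** The coefficient 2^-1 is the derivative of sin (t/2) at 0: this is where the Killing constant 1/2
    arises. *)
Lemma is_derive_half_angle (R : realType) (f g : R -> R) (f' g' : R) :
  is_derive (0 : R) 1 f f' -> is_derive (0 : R) 1 g g' ->
  is_derive (0 : R) 1 (fun t => cos (t / 2) * f t - sin (t / 2) * g t) (f' - 2^-1 * g 0).
Proof.
move=> df dg.
have dt : is_derive (0 : R) 1 (fun t => t / 2) 2^-1.
  rewrite (_ : (fun t : R => t / 2) = 2^-1 *: id); last first.
    by apply/funext => t; rewrite /= mulrC.
  by apply: is_derive_eq; rewrite /GRing.scale /= mulr1.
have dc := @is_derive1_comp R cos (fun t => t / 2) 0 _ _ (is_derive_cos _) dt.
have ds := @is_derive1_comp R sin (fun t => t / 2) 0 _ _ (is_derive_sin _) dt.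
have [Dd De] := is_deriveB (is_deriveM dc df) (is_deriveM ds dg).
apply: DeriveDef; first exact: Dd.
rewrite [LHS]De /= mul0r cos0 sin0 /GRing.scale /=; ring.
Qed.

(** * The spin connection in the trivialisation *)

Section HorizontalDerivative.
Context {R : realType} {n : nat} (gamma : 'I_n -> 'M[R[i]]_(2 ^ n./2)).
Context (hgamma : spinor_rep gamma) (hn : (0 < n)%N).
Local Notation C := R[i].
Local Notation N := (2 ^ n./2)%N.
Local Notation Spin := (Spin gamma).
Local Notation base := (base gamma).
Local Notation tframe := (tframe gamma).
Local Notation U := (@punctured R n.+1).
Local Notation up S := (ulsubmx S : 'M[C]_N).
Implicit Types (S T : 'M[C]_(N + N)) (x y v w : 'rV[R]_n.+1) (u : 'rV[C]_N).

Lemma cmul_tframe S j (w : 'cV[C]_N) : Spin S -> cmul gamma S (tframe S j) w = gamma j *m w.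
Proof.
move=> sS; rewrite /cmul (bigD1 j)//= big1 ?addr0 => [|i ij].
  by rewrite frame_orthonormal// eqxx scale1r.
by rewrite frame_orthonormal// (inj_eq lift_inj) eq_sym (negbTE ij) scale0r.
Qed.

Definition horizontal_derivative (phi : spinor_fun R n) S i : 'cV[C]_N :=
  \col_a cderive (fun t => phi (horizontal gamma S i t) a 0) 0.

Lemma nabla_tframe phi S j : Spin S ->
  nabla gamma phi (tframe S j) S = horizontal_derivative phi S j.
Proof.
move=> sS; rewrite /nabla (bigD1 j)//= big1 ?addr0 => [|i ij].
  by rewrite frame_orthonormal// eqxx scale1r.
by rewrite frame_orthonormal// (inj_eq lift_inj) eq_sym (negbTE ij) scale0r.
Qed.

Lemma dirac_horizontal phi S : Spin S ->
  Defs.dirac gamma phi S = \sum_j gamma j *m horizontal_derivative phi S j.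
Proof.
by move=> sS; apply: eq_bigr => j _; rewrite nabla_tframe// cmul_tframe.
Qed.

Lemma repair_cderive m (f : R -> 'cV[C]_m) (t : R) (u : 'rV[C]_m) :
  (forall w : 'rV[C]_m, derivable (fun s : R => repair w (f s)) t 1) ->
  repair u (\col_a cderive (fun s => f s a 0) t) = 'D_1 (fun s : R => repair u (f s)) t.
Proof.
move=> df.
have ReE a : (fun s => complex.Re (f s a 0)) = fun s => repair (delta_mx 0 a) (f s).
  by apply/funext => s; rewrite /repair -rowE mxE.
have ImE a : (fun s => complex.Im (f s a 0)) = fun s => repair (- 'i%C *: delta_mx 0 a) (f s).
  apply/funext => s; rewrite /repair -scalemxAl -rowE !mxE; case: (f s a 0) => y z /=; ring.
have uE s : repair u (f s) = \sum_a (complex.Re (u 0 a) * complex.Re (f s a 0) -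
    complex.Im (u 0 a) * complex.Im (f s a 0)).
  rewrite /repair mxE; elim/big_rec2 : _ => [//|a y z _ <-].
  by rewrite ReD; congr (_ + _); case: (u 0 a) (f s a 0) => [? ?] [].
have dR a : derivable (fun s => complex.Re (f s a 0)) t 1 by rewrite ReE.
have dI a : derivable (fun s => complex.Im (f s a 0)) t 1 by rewrite ImE.
have -> : (fun s : R => repair u (f s)) = \sum_a (fun s : R =>
    complex.Re (u 0 a) * complex.Re (f s a 0) - complex.Im (u 0 a) * complex.Im (f s a 0)).
  by apply/funext => s; rewrite fct_sumE.
rewrite derive_sum => [|a]; last by apply: derivableB; apply: derivableZ.
rewrite /repair mxE; elim/big_rec2 : _ => [//|a y z _ <-].
rewrite ReD; congr (_ + _).
rewrite deriveB; [|exact: derivableZ|exact: derivableZ].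
rewrite !deriveZ// mxE /cderive !derive1E.
by case: (u 0 a).
Qed.

Section Field.
Context (phi : spinor_fun R n) (sphi : spinor_field gamma phi).
Local Notation Phi := (trivialize gamma phi).
Local Notation h u := (fun x => repair u (Phi x)).

Lemma repair_horizontal S i t u : Spin S ->
  repair u (phi (horizontal gamma S i t)) =
  cos (t / 2) * repair (u *m (up S)^t*) (Phi (cos t *: base S + sin t *: tframe S i)) -
  sin (t / 2) * repair (u *m gamma i *m (up S)^t*) (Phi (cos t *: base S + sin t *: tframe S i)).
Proof.
move=> sS; have [_ ephi] := sphi.
rewrite (spinor_of_trivialize hgamma hn ephi (Spin_horizontal hgamma i t sS)).
rewrite (base_horizontal hgamma)// (up_horizontal_adj hgamma)//.
move: (Phi _) (up S) => w P.
rewrite -repair_mulmx mulmxA mulmxBr mulmxBl mul_mx_scalar -scalemxAl -scalemxAr -scalemxAl.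
by rewrite repairDl -scaleNr -rmorphN !repairZl mulNr.
Qed.

Lemma differentiable_trivialize u x : U x -> differentiable (h u) x.
Proof. by have /CkSP[+ _] := smooth_trivialize hgamma hn 1 u sphi; exact. Qed.

(** The connection is d_X - (1/2) X in the trivialisation: the first term differentiates Phi along
    the great circle, the second the half-angle factor of the lift. *)
Lemma is_derive_horizontal S i u : Spin S ->
  is_derive (0 : R) 1 (fun t : R => repair u (phi (horizontal gamma S i t)))
    (\sum_l tframe S i 0 l * partial l (h (u *m (up S)^t*)) (base S)
     - 2^-1 * repair (u *m gamma i *m (up S)^t*) (Phi (base S))).
Proof.
move=> sS; have Ub := sphere_punctured (sphere_base hgamma sS).
have -> : (fun t : R => repair u (phi (horizontal gamma S i t))) = _ :=
  funext (fun t => repair_horizontal i t u sS).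
move: (base S) (tframe S i) Ub => b X Ub.
pose H (t : R) : 'rV[R]_n.+1 := cos t *: b + sin t *: X.
have H0 : H 0 = b by rewrite /H cos0 sin0 scale1r scale0r addr0.
have dH (w : 'rV[C]_N) : is_derive (0 : R) 1 (fun t => repair w (Phi (H t)))
    (\sum_l X 0 l * partial l (h w) b).
  rewrite -H0; apply: (is_derive_curve (H := H) (f := h w)); last first.
    by rewrite H0; exact: differentiable_trivialize.
  move=> l; rewrite (_ : (fun y : R => H y 0 l) = fun s => b 0 l * cos s + X 0 l * sin s).
    by apply: is_derive_eq; rewrite sin0 cos0 /GRing.scale /=; ring.
  by apply/funext => y; rewrite /H !mxE mulrC [X in _ + X]mulrC.
have d1 := dH (u *m (up S)^t*); have d2 := dH (u *m gamma i *m (up S)^t*).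
have := is_derive_half_angle d1 d2.
by rewrite H0.
Qed.

End Field.
End HorizontalDerivative.

Section FrameSums.
Context {R : realType} {n : nat}.

Lemma sum_complete_frame (F : 'I_n.+1 -> 'rV[R]_n.+1) (a b : 'I_n.+1 -> R) :
  (forall p l, \sum_j F j 0 p * F j 0 l = (p == l)%:R) ->
  \sum_j (\sum_p F j 0 p * a p) * (\sum_l F j 0 l * b l) = \sum_l a l * b l.
Proof.
move=> FF; transitivity (\sum_p \sum_l a p * b l * \sum_j F j 0 p * F j 0 l).
  transitivity (\sum_j \sum_p \sum_l a p * b l * (F j 0 p * F j 0 l)).
    apply: eq_bigr => j _; rewrite mulr_suml; apply: eq_bigr => p _.
    by rewrite mulr_sumr; apply: eq_bigr => l _; ring.
  rewrite exchange_big; apply: eq_bigr => p _; rewrite exchange_big.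
  by apply: eq_bigr => l _; rewrite mulr_sumr.
apply: eq_bigr => p _; under eq_bigr do rewrite FF.
exact: sum_delta.
Qed.

Lemma sum_complete_frame2 (F : 'I_n.+1 -> 'rV[R]_n.+1) (M : 'I_n.+1 -> 'I_n.+1 -> R) :
  (forall p l, \sum_j F j 0 p * F j 0 l = (p == l)%:R) ->
  \sum_j \sum_l F j 0 l * (\sum_p F j 0 p * M p l) = \sum_l M l l.
Proof.
move=> FF; transitivity (\sum_l \sum_p M p l * \sum_j F j 0 l * F j 0 p).
  rewrite exchange_big; apply: eq_bigr => l _.
  transitivity (\sum_j \sum_p M p l * (F j 0 l * F j 0 p)).
    apply: eq_bigr => j _; rewrite mulr_sumr; apply: eq_bigr => p _; ring.
  by rewrite exchange_big; apply: eq_bigr => p _; rewrite mulr_sumr.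
apply: eq_bigr => l _; under eq_bigr do rewrite FF.
exact: (sum_delta l (fun p => M p l)).
Qed.

End FrameSums.

Section ConstantOnSphere.
Context {R : realType} {n : nat}.
Local Notation U := (@punctured R n.+1).

(* The segment from x to y avoids the origin because dot x y >= 0. *)
Lemma eq_of_partial0 (f : 'rV[R]_n.+1 -> R) (x y : 'rV[R]_n.+1) : Ck 1 U f ->
  (forall l z, U z -> partial l f z = 0) -> U x -> U y -> 0 <= dot x y -> f x = f y.
Proof.
move=> /CkSP[df _] pf Ux Uy xy.
have sU t : 0 <= t <= 1 -> U (x + t *: (y - x)).
  move=> /andP[t0 t1]; rewrite /punctured /= -dot_eq0 gt_eqF//.
  have x2 := dot_gt0 Ux; have y2 := dot_gt0 Uy.
  rewrite !(dotDl, dotDr, dotZl, dotZr, dotNl, dotNr) (dotC y x).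
  rewrite [ltRHS](_ : _ = (1 - t) ^+ 2 * dot x x + 2 * t * (1 - t) * dot x y
    + t ^+ 2 * dot y y); last by ring.
  have [->|tn0] := eqVneq t 0; first by rewrite subr0 expr1n; lra.
  rewrite ltr_wpDl//; last by rewrite mulr_gt0// exprn_gt0// lt_def tn0.
  have t1' : 0 <= 1 - t by rewrite subr_ge0.
  have xx := ltW x2.
  by rewrite addr_ge0// ?mulr_ge0// ?exprn_ge0.
pose g (t : R) := f (x + t *: (y - x)).
have dg (t : R) : 0 <= t <= 1 -> is_derive t 1 g 0.
  move=> ht; have := @is_derive_curve R n.+1 (fun t => x + t *: (y - x)) f t (y - x).
  have -> : \sum_i (y - x) 0 i * partial i f (x + t *: (y - x)) = 0.
    by apply: big1 => i _; rewrite pf ?mulr0//; exact: sU.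
  apply; last by apply: df; exact: sU.
  move=> i; rewrite (_ : (fun s : R => _) = fun s => x 0 i + (y - x) 0 i * s).
    by apply: is_derive_eq; rewrite add0r mul1r [_%:A]mulr1.
  by apply/funext => s; rewrite !mxE mulrC.
have [|| t _] := @MVT_segment _ g (fun=> 0) 0 1 ler01.
- move=> t /subset_itv_oo_cc; rewrite in_itv/=; exact: dg.
- apply: derivable_within_continuous => t; rewrite in_itv/= => /dg ?; exact: ex_derive.
rewrite mul0r /g scale1r scale0r addr0 (addrC x) subrK => /eqP.
by rewrite subr_eq0 eq_sym => /eqP.
Qed.

(** Go from x to e_1 or - e_1, according to the sign of x_1, and then to e_0: consecutive points
    have nonnegative scalar product. *)
Lemma constant_of_partial0 (f : 'rV[R]_n.+1 -> R) (x : 'rV[R]_n.+1) : (0 < n)%N -> Ck 1 U f ->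
  (forall l z, U z -> partial l f z = 0) -> U x -> f x = f (delta_mx 0 ord0).
Proof.
move=> hn f1 pf Ux; pose i1 : 'I_n.+1 := lift ord0 (Ordinal hn).
have Ud j (s : R) : s ^+ 2 = 1 -> U (s *: delta_mx 0 j).
  move=> s2; rewrite /punctured /= -dot_eq0 dotZl dotZr mulrA -expr2 s2 mul1r.
  by rewrite dot_delta mxE !eqxx oner_eq0.
have U0 : U (delta_mx 0 ord0) by rewrite -[delta_mx _ _]scale1r; apply: Ud; rewrite expr1n.
have step (s : R) : s ^+ 2 = 1 -> 0 <= s * x 0 i1 -> f x = f (delta_mx 0 ord0).
  move=> s2 sx; transitivity (f (s *: delta_mx 0 i1)).
    by apply: eq_of_partial0 => //; [exact: Ud|rewrite dotZr dot_delta].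
  by apply: eq_of_partial0 => //; [exact: Ud|rewrite dotZl dot_delta mxE /= mulr0].
have [x0|x0] := leP 0 (x 0 i1); first by apply: (step 1); rewrite ?expr1n// mul1r.
by apply: (step (-1)); rewrite ?sqrrN ?expr1n// mulN1r oppr_ge0 ltW.
Qed.

End ConstantOnSphere.

(** * The Dirac and Killing equations in the trivialisation *)

Section TrivializedEquations.
Context {R : realType} {n : nat} (gamma : 'I_n -> 'M[R[i]]_(2 ^ n./2)).
Context (hgamma : spinor_rep gamma) (hn : (0 < n)%N).
Local Notation C := R[i].
Local Notation N := (2 ^ n./2)%N.
Local Notation Spin := (Spin gamma).
Local Notation base := (base gamma).
Local Notation frame := (frame gamma).
Local Notation tframe := (tframe gamma).
Local Notation U := (@punctured R n.+1).
Local Notation up S := (ulsubmx S : 'M[C]_N).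
Local Notation A := (half_spin gamma).
Local Notation A' := (half_spin' gamma).
Implicit Types (S T : 'M[C]_(N + N)) (x y v w : 'rV[R]_n.+1) (u : 'rV[C]_N).
Context (phi : spinor_fun R n) (sphi : spinor_field gamma phi).
Local Notation Phi := (trivialize gamma phi).
Local Notation h u := (fun x => repair u (Phi x)).

Lemma repair_horizontal_derivative S i u : Spin S ->
  repair u (horizontal_derivative gamma phi S i) =
  \sum_l tframe S i 0 l * partial l (h (u *m (up S)^t*)) (base S)
     - 2^-1 * repair (u *m gamma i *m (up S)^t*) (Phi (base S)).
Proof.
move=> sS; have D (w : 'rV[C]_N) := is_derive_horizontal hgamma hn sphi i w sS.
rewrite /horizontal_derivative (repair_cderive u (f := fun t => phi (horizontal gamma S i t))).
  by have [_ ->] := D u.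
by move=> w; have [] := D w.
Qed.

Lemma partial_trivialize_suml l (a : 'I_n.+1 -> R) (u : 'I_n.+1 -> 'rV[R[i]]_N) x : U x ->
  partial l (h (\sum_k (a k)%:C *: u k)) x = \sum_k a k * partial l (h (u k)) x.
Proof. by apply: partial_h_suml => w k; exact: smooth_trivialize. Qed.

Lemma euler_trivialize u x : U x -> \sum_l x 0 l * partial l (h u) x = 0.
Proof.
move=> Ux; apply: euler; first exact: homogeneous0_trivialize.
exact: differentiable_trivialize.
Qed.

(** The base point completes the tangent frame to an orthonormal basis of R^(n+1), in which the
    contraction is a trace; the added term is a radial derivative and vanishes. *)
Lemma sum_tframe_dirac u S : Spin S ->
  \sum_j \sum_l tframe S j 0 l *
    partial l (h (u *m clin A (base S) *m clin A' (tframe S j))) (base S) =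
  \sum_j \sum_l base S 0 j * partial l (h (u *m A j *m A' l)) (base S).
Proof.
move=> sS; have b1 := sphere_base hgamma sS; have Ub := sphere_punctured b1.
have FF p l := frame_complete hgamma p l sS.
pose M p l := partial l (h (u *m clin A (base S) *m A' p)) (base S).
have E y l : partial l (h (u *m clin A (base S) *m clin A' y)) (base S) =
    \sum_p y 0 p * M p l.
  have -> : u *m clin A (base S) *m clin A' y =
      \sum_p (y 0 p)%:C *: (u *m clin A (base S) *m A' p).
    by rewrite {2}/clin mulmx_sumr; apply: eq_bigr => p _; rewrite scalemxAr.
  exact: (partial_trivialize_suml l (fun p => y 0 p)
     (fun p => u *m clin A (base S) *m A' p) Ub).
have -> : \sum_j \sum_l tframe S j 0 l *
    partial l (h (u *m clin A (base S) *m clin A' (tframe S j))) (base S) = \sum_l M l l.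
  have := sum_complete_frame2 M FF.
  rewrite big_ord_recl [X in X + _](_ : _ = 0) ?add0r.
    by move=> <-; apply: eq_bigr => j _; apply: eq_bigr => l _; rewrite E.
  under eq_bigr do rewrite mulr_sumr.
  rewrite exchange_big; apply: big1 => p _.
  transitivity (base S 0 p * \sum_l base S 0 l * M p l).
    by rewrite mulr_sumr; apply: eq_bigr => l _; rewrite mulrCA.
  by rewrite euler_trivialize ?mulr0.
rewrite exchange_big; apply: eq_bigr => l _.
rewrite /M; have -> : u *m clin A (base S) *m A' l =
    \sum_p (base S 0 p)%:C *: (u *m A p *m A' l).
  rewrite /clin mulmx_sumr mulmx_suml; apply: eq_bigr => p _.
  by rewrite -scalemxAr -scalemxAl.
exact: (partial_trivialize_suml l (fun j => base S 0 j) (fun j => u *m A j *m A' l) Ub).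
Qed.

(** Each of the n terms - (1/2) gamma_j gamma_j equals 1/2, whence the shift of the eigenvalue by
    n/2. *)
Lemma trivialize_dirac_sphere lambda u S :
  (forall S, Spin S -> Defs.dirac gamma phi S = lambda%:C *: phi S) -> Spin S ->
  \sum_j \sum_l base S 0 j * partial l (h (u *m A j *m A' l)) (base S) =
  (lambda - n%:R / 2) * repair u (Phi (base S)).
Proof.
move=> Dphi sS; have [_ ephi] := sphi; have [gg _] := hgamma.
have := Dphi S sS; rewrite (dirac_horizontal hgamma)// => /(congr1 (repair (u *m up S))).
rewrite repair_sumr repairZr repair_mulmx -(trivialize_base hgamma hn ephi sS).
have g2 j : gamma j *m gamma j = - 1%:M.
  have := gg j j; rewrite eqxx mulr1n -mulr2n => E.
  apply: (@scalerI _ _ 2%:R); first by rewrite pnatr_eq0.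
  by rewrite scaler_nat E scalerN scale_scalar_mx mulr1 raddfN.
have upu j : up S *m gamma j *m (up S)^t* = clin A (base S) *m clin A' (tframe S j).
  by rewrite (up_gamma hgamma)// -mulmxA (up_adjVK hgamma)// mulmx1.
under eq_bigr => j _.
  rewrite -repair_mulmx repair_horizontal_derivative//.
  rewrite -(mulmxA (u *m up S) (gamma j) (gamma j)) g2 mulmxN mulmx1 mulNmx.
  rewrite -(mulmxA u (up S) ((up S)^t*)) (up_adjVK hgamma)// mulmx1.
  rewrite -(mulmxA u (up S) (gamma j)) -(mulmxA u _ ((up S)^t*)) upu mulmxA; over.
rewrite sumrB sum_tframe_dirac// sumr_const card_ord => E.
have rN (v : 'rV[C]_N) (w : 'cV[C]_N) : repair (- v) w = - repair v w.
  by rewrite -[- v]scaleN1r -(rmorphN1 (@real_complex R)) repairZl mulN1r.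
move: E; rewrite rN -mulr_natl; lra.
Qed.

(** Both sides have degree zero: the factor x_j compensates the degree -1 of the partial
    derivatives. *)
Lemma trivialize_dirac lambda u x :
  (forall S, Spin S -> Defs.dirac gamma phi S = lambda%:C *: phi S) -> U x ->
  \sum_j \sum_l x 0 j * partial l (h (u *m A j *m A' l)) x =
  (lambda - n%:R / 2) * repair u (Phi x).
Proof.
move=> Dphi Ux; have [S [sS bS]] := base_surj hgamma hn (normalize_sphere Ux).
have := trivialize_dirac_sphere u Dphi sS; rewrite bS.
have r0 : 0 < (enorm x)^-1 by rewrite invr_gt0 enorm_gt0.
have -> : Phi ((enorm x)^-1 *: x) = Phi x by exact: trivialize_homogeneous.
move=> E; rewrite -[RHS]E.
have Ux' := sphere_punctured (normalize_sphere Ux).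
apply: eq_bigr => j _; apply: eq_bigr => l _.
rewrite (partial_homogeneous0 l (homogeneous0_trivialize _ _ _) r0); last first.
  exact: differentiable_trivialize.
by move: (partial l _ _) => d; rewrite mxE invrK; field; rewrite gt_eqF// enorm_gt0.
Qed.

(** The Killing equation cancels the zeroth-order term of the connection, so tangential derivatives
    vanish; radial ones vanish by homogeneity. *)
Lemma trivialize_killing :
  (forall S X, Spin S -> dot X (base S) = 0 ->
    nabla gamma phi X S = (- 2^-1)%:C *: cmul gamma S X (phi S)) ->
  forall x, U x -> Phi x = Phi (delta_mx 0 ord0).
Proof.
move=> K; have [_ ephi] := sphi.
have T0 S i u : Spin S -> \sum_l tframe S i 0 l * partial l (h u) (base S) = 0.
  move=> sS; have := K S (tframe S i) sS.
  rewrite (frame_orthonormal hgamma)// => /(_ erefl).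
  rewrite (nabla_tframe hgamma)// (cmul_tframe hgamma)// => /(congr1 (repair (u *m up S))).
  rewrite repairZr repair_horizontal_derivative//.
  rewrite {1}(spinor_of_trivialize hgamma hn ephi sS) -!repair_mulmx.
  rewrite -(mulmxA u) (up_adjVK hgamma)// mulmx1; lra.
have P0 l u x : sphere x -> partial l (h u) x = 0.
  move=> x1; have [S [sS bS]] := base_surj hgamma hn x1.
  have FF p q := frame_complete hgamma p q sS.
  (* Completeness of the frame expresses the l-th partial derivative through derivatives along frame
     vectors, base point included. *)
  have := sum_complete_frame (fun p => (l == p)%:R) (fun p => partial p (h u) x) FF.
  rewrite [LHS]big1 => [|j _].
    move=> /esym; under eq_bigr do rewrite mulrC.
    by rewrite sum_delta.
  suff Z : \sum_l frame S j 0 l * partial l (h u) x = 0 by rewrite Z mulr0.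
  case: (unliftP ord0 j) => [i ->|->].
    by rewrite -bS; exact: T0.
  rewrite -[frame S ord0]/(base S) bS; apply: euler_trivialize; exact: sphere_punctured.
have P1 l u x : U x -> partial l (h u) x = 0.
  move=> Ux; have r0 : 0 < (enorm x)^-1 by rewrite invr_gt0 enorm_gt0.
  have Ux' := sphere_punctured (normalize_sphere Ux).
  have := partial_homogeneous0 l (homogeneous0_trivialize gamma phi u) r0
    (differentiable_trivialize hgamma hn sphi u Ux').
  rewrite P0; last exact: normalize_sphere.
  by move=> /esym/eqP; rewrite invrK mulf_eq0 gt_eqF ?enorm_gt0//= => /eqP.
move=> x Ux; apply: repair_inj => u.
apply: (@constant_of_partial0 _ _ (h u)) => //; first exact: smooth_trivialize.
by move=> l z Uz; exact: P1.
Qed.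

End TrivializedEquations.

(** To be read with P = S_+, Q its adjoint, G = [gamma i], and B, D the Clifford blocks of the base
    point and of a frame vector. *)
Lemma intertwine_scaled (K : comPzRingType) m (P Q B D G : 'M[K]_m) (z : 'cV[K]_m) (a : K) :
  Q *m P = 1%:M -> P *m Q = 1%:M -> P *m G = B *m D *m P ->
  a *: (G *m (Q *m z)) = Q *m (B *m (a *: D) *m z).
Proof.
move=> QP PQ PG; rewrite -scalemxAr -scalemxAl -scalemxAr; congr (_ *: _).
have -> : B *m D = P *m G *m Q by rewrite PG -mulmxA PQ mulmx1.
by rewrite !mulmxA QP mul1mx.
Qed.

(** * The component along a Killing spinor *)

Section KillingComponent.
Context {R : realType} {n : nat} (gamma : 'I_n -> 'M[R[i]]_(2 ^ n./2)).
Context (hgamma : spinor_rep gamma) (hn : (0 < n)%N).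
Context (xi : spinor_fun R n) (hxi : killing gamma xi).
Context (hxi1 : forall S, Spin gamma S -> Num.sqrt (inner (xi S) (xi S)) = 1).
Local Notation C := R[i].
Local Notation N := (2 ^ n./2)%N.
Local Notation Spin := (Spin gamma).
Local Notation base := (base gamma).
Local Notation frame := (frame gamma).
Local Notation tframe := (tframe gamma).
Local Notation U := (@punctured R n.+1).
Local Notation up S := (ulsubmx S : 'M[C]_N).
Local Notation A := (half_spin gamma).
Local Notation A' := (half_spin' gamma).
Implicit Types (S T : 'M[C]_(N + N)) (x y X : 'rV[R]_n.+1).

Let v : 'cV[C]_N := trivialize gamma xi (delta_mx 0 ord0).

Lemma innerE (a b : 'cV[C]_N) : inner a b = hdot a b. Proof. by []. Qed.

Lemma hdot_up S (a b : 'cV[C]_N) : Spin S ->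
  hdot ((up S)^t* *m a) ((up S)^t* *m b) = hdot a b.
Proof. by move=> sS; rewrite hdot_mulmxl trmxCK mulmxA (up_adjVK hgamma)// mul1mx. Qed.

Lemma killing_form S : Spin S -> xi S = (up S)^t* *m v.
Proof.
move=> sS; have [sxi K] := hxi; have [_ exi] := sxi.
rewrite (spinor_of_trivialize hgamma hn exi sS); congr (_ *m _).
apply: (trivialize_killing hgamma hn sxi K); apply: sphere_punctured.
exact: sphere_base.
Qed.

Lemma killing_unit : hdot v v = 1.
Proof.
have s1 : Spin 1%:M := Spin_one gamma.
have := hxi1 s1; rewrite innerE killing_form// hdot_up// => E.
by rewrite -(sqr_sqrtr (hdot_ge0 v)) E expr1n.
Qed.

Lemma clin_sum (B : 'I_n.+1 -> 'M[C]_N) (I : finType) (a : I -> R) (X : I -> 'rV[R]_n.+1) :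
  clin B (\sum_i a i *: X i) = \sum_i (a i)%:C *: clin B (X i).
Proof.
rewrite /clin; under [RHS]eq_bigr do rewrite scaler_sumr.
rewrite exchange_big; apply: eq_bigr => j _.
rewrite summxE rmorph_sum scaler_suml; apply: eq_bigr => i _.
by rewrite mxE rmorphM scalerA.
Qed.

Lemma tangent_frame_sum S X : Spin S -> dot (base S) X = 0 ->
  \sum_i dot X (tframe S i) *: tframe S i = X.
Proof.
move=> sS bX; have FF p l := frame_complete hgamma p l sS.
apply/rowP => l; have := sum_complete_frame (fun p => X 0 p) (fun p => (l == p)%:R) FF.
rewrite sum_delta => <-; rewrite big_ord_recl [X in X + _](_ : _ = 0) ?add0r; last first.
  suff -> : \sum_p frame S ord0 0 p * X 0 p = 0 by rewrite mul0r.
  exact: bX.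
rewrite summxE; apply: eq_bigr => i _; rewrite sum_delta.
by rewrite -/(tframe S i); move: (tframe S i) => y; rewrite mxE dotC.
Qed.

Lemma cmul_killing S X : Spin S -> dot (base S) X = 0 ->
  cmul gamma S X (xi S) = (up S)^t* *m (clin A (base S) *m clin A' X *m v).
Proof.
move=> sS bX; rewrite /cmul killing_form//.
rewrite -{2}(tangent_frame_sum sS bX) clin_sum mulmx_sumr mulmx_suml mulmx_sumr.
apply: eq_bigr => i _.
exact: intertwine_scaled (up_adjK hgamma sS) (up_adjVK hgamma sS) (up_gamma hgamma i sS).
Qed.

Section Eigenspinor.
Context (phi : spinor_fun R n) (lambda : R) (ephi : eigenspinor gamma lambda phi).
Let mu := lambda - n%:R / 2.
Let c := mu + n%:R - 1.
Local Notation Phi := (trivialize gamma phi).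
Let g x := repair (v^t*) (Phi x).
Let dg x : 'rV[R]_n.+1 := \row_l partial l g x.

Let sphi : spinor_field gamma phi. Proof. by case: ephi. Qed.
Let equi : equivariant gamma phi. Proof. by case: sphi. Qed.

Let h_smooth (u : 'rV[C]_N) k : Ck k U (fun x => repair u (Phi x)).
Proof. exact: smooth_trivialize. Qed.

Let h_homog (u : 'rV[C]_N) : homogeneous0 (fun x => repair u (Phi x)).
Proof. exact: homogeneous0_trivialize. Qed.

Let h_dirac (u : 'rV[C]_N) x : U x ->
  \sum_j \sum_l x 0 j * partial l (fun x => repair (u *m A j *m A' l) (Phi x)) x =
  mu * repair u (Phi x).
Proof. by have [_ Dphi] := ephi; exact: trivialize_dirac. Qed.

Lemma component_smooth k : Ck k U g. Proof. exact: h_smooth. Qed.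

Lemma component_homogeneous : homogeneous0 g. Proof. exact: h_homog. Qed.

Lemma component_laplacian x : sphere x ->
  \sum_l partial l (partial l g) x = - (mu * c) * g x.
Proof.
exact: (laplacian_dirac (half_spin_anticommute hgamma) (half_spin_anticommute' hgamma)
  h_smooth h_homog h_dirac).
Qed.

Lemma inner_killing S : Spin S -> inner (xi S) (phi S) = g (base S).
Proof.
move=> sS; rewrite innerE killing_form// (spinor_of_trivialize hgamma hn equi sS).
by rewrite hdot_up.
Qed.

Lemma integral_component :
  integral_S gamma (fun S => inner (xi S) (phi S) ^+ 2) = sphere_int (fun x => g x ^+ 2).
Proof. by apply: integral_SE => // S sS; rewrite inner_killing. Qed.

Lemma integral_norm :
  integral_S gamma (fun S => inner (phi S) (phi S)) =
  sphere_int (fun x => hdot (Phi x) (Phi x)).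
Proof.
apply: integral_SE => // S sS; rewrite innerE (spinor_of_trivialize hgamma hn equi sS).
by rewrite hdot_up.
Qed.

Let residual x := Phi x - (g x)%:C *: v - (c^-1)%:C *: (clin A x *m clin A' (dg x) *m v).

Lemma integral_residual : c != 0 ->
  sphere_int (fun x => hdot (residual x) (residual x)) =
  sphere_int (fun x => hdot (Phi x) (Phi x)) - (c + mu) / c * sphere_int (fun x => g x ^+ 2).
Proof.
exact: (sphere_int_residual (half_spin_anticommute hgamma) (half_spin_anticommute' hgamma)
  (half_spin_adj hgamma) h_smooth h_homog h_dirac killing_unit).
Qed.

Lemma grad_scaled_component : c != 0 -> forall x, U x ->
  grad (fun y => c^-1 * g y) x = c^-1 *: dg x.
Proof.
move=> c0 x Ux; have hf : homogeneous0 (fun y => c^-1 * g y).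
  by move=> a y a0; rewrite /g h_homog.
apply/rowP => l; rewrite (grad_homogeneous0 l hf Ux).
rewrite [RHS]mxE [dg x _ _]mxE; apply: partialZ.
by have /CkSP[+ _] := component_smooth 1; exact.
Qed.

Lemma harmonics_scaled_component k : c != 0 -> mu * c = (k * (n + k - 1))%:R ->
  harmonics k (fun y => c^-1 * g y).
Proof.
move=> c0 mc; have oU := @open_punctured R n.+1.
have hf : homogeneous0 (fun y => c^-1 * g y) by move=> a y a0; rewrite /g h_homog.
have fk j : Ck j U (fun y => c^-1 * g y) by apply: CkZ => //; exact: component_smooth.
split.
  move=> j; apply: (Ck_ext oU (fk j)) => x Ux.
  by rewrite radial_of_homogeneous0.
move=> x x1; rewrite laplacian_homogeneous0//.
have Ux := sphere_punctured x1.
have /CkSP[dgx pg] := component_smooth 2.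
have E l : partial l (partial l (fun y => c^-1 * g y)) x = c^-1 * partial l (partial l g) x.
  rewrite -partialZ; last by have /CkSP[+ _] := pg l; exact.
  apply: near_eq_partial; apply: near_punctured Ux _ => y Uy; apply: partialZ; exact: dgx.
under eq_bigr do rewrite E.
by rewrite -mulr_sumr component_laplacian// mc; ring.
Qed.

(** Since df . xi is orthogonal to xi, pairing with v gives g = c f, hence grad g = c grad f, and
    the residual cancels term by term. *)
Lemma residual_of_harmonics (f : 'rV[R]_n.+1 -> R) k : c != 0 -> harmonics k f ->
  (forall S, Spin S -> phi S = (c * f (base S))%:C *: xi S
                        + cmul gamma S (grad f (base S)) (xi S)) ->
  forall x, sphere x -> residual x = 0.
Proof.
move=> c0 [sf _] phiE.
have fd x : U x -> differentiable (radial f) x by have /CkSP[+ _] := sf 1%N; exact.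
have xgrad x : sphere x -> dot x (grad f x) = 0.
  move=> x1; rewrite -(euler (radial_homogeneous0 f) (fd x (sphere_punctured x1))).
  by apply: eq_bigr => l _; rewrite mxE.
have PhiE x : sphere x ->
    Phi x = (c * f x)%:C *: v + clin A x *m clin A' (grad f x) *m v.
  move=> x1; have [S [sS bS]] := base_surj hgamma hn x1.
  rewrite -bS (trivialize_base hgamma hn equi sS) phiE// cmul_killing//; last first.
    by rewrite bS xgrad.
  rewrite killing_form// scalemxAr -mulmxDr mulmxA (up_adjVK hgamma)// mul1mx.
  by [].
have gE x : sphere x -> g x = c * f x.
  move=> x1; rewrite /g -/(hdot v (Phi x)) PhiE// hdotDr hdotZr killing_unit mulr1.
  rewrite (hdot_clin_tangent (half_spin_anticommute hgamma) (half_spin_adj hgamma))//.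
    by rewrite addr0.
  exact: xgrad.
have gU x : U x -> g x = c * radial f x.
  move=> Ux; rewrite -(radial_of_homogeneous0 component_homogeneous Ux).
  by rewrite /radial gE//; exact: normalize_sphere.
have dgE x : sphere x -> dg x = c *: grad f x.
  move=> /sphere_punctured Ux; apply/rowP => l; rewrite !mxE -partialZ; last exact: fd.
  by apply: near_eq_partial; apply: near_punctured Ux _ => y Uy; exact: gU.
move=> x x1; rewrite /residual PhiE// gE// dgE//.
have -> : clin A' (c *: grad f x) = c%:C *: clin A' (grad f x).
  rewrite /clin scaler_sumr; apply: eq_bigr => j _.
  by move: (grad f x) => y; rewrite mxE rmorphM scalerA.
rewrite -scalemxAr -scalemxAl scalerA -rmorphM mulVf// scale1r.
by rewrite addrAC addrK subrr.
Qed.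

(** Positivity is asked of the ratio, not of c, because c and c + mu are both negative on E_-k. The
    gap in the inequality is this ratio times the integral of the squared residual. *)
Lemma killing_component_estimate k : c != 0 -> 0 < c / (c + mu) ->
  mu * c = (k * (n + k - 1))%:R ->
  integral_S gamma (fun S => inner (xi S) (phi S) ^+ 2)
    <= c / (c + mu) * integral_S gamma (fun S => inner (phi S) (phi S)) /\
  (integral_S gamma (fun S => inner (xi S) (phi S) ^+ 2)
     = c / (c + mu) * integral_S gamma (fun S => inner (phi S) (phi S)) <->
   exists f : 'rV[R]_n.+1 -> R, harmonics k f /\
     forall S, Spin S -> phi S = (c * f (base S))%:C *: xi S
                        + cmul gamma S (grad f (base S)) (xi S)).
Proof.
move=> c0 r0 mc; rewrite integral_component integral_norm.
have cmu : c + mu != 0 by apply: contraTneq r0 => ->; rewrite invr0 mulr0 ltxx.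
have Res := integral_residual c0.
have E : c / (c + mu) * sphere_int (fun x => hdot (Phi x) (Phi x)) -
    sphere_int (fun x => g x ^+ 2) =
    c / (c + mu) * sphere_int (fun x => hdot (residual x) (residual x)).
  by rewrite Res; field; rewrite cmu c0.
split.
  rewrite -subr_ge0 E mulr_ge0 ?(ltW r0)//.
  by apply: sphere_int_ge0 => x _; exact: hdot_ge0.
split=> [I0|[f [hf phiE]]].
  have res0 : sphere_int (fun x => hdot (residual x) (residual x)) = 0.
    move: E; rewrite -I0 subrr => /esym/eqP; rewrite mulf_eq0 gt_eqF//= => /eqP.
    exact.
  have PhiE x : sphere x ->
      Phi x = (g x)%:C *: v + (c^-1)%:C *: (clin A x *m clin A' (dg x) *m v).
    exact: (residual_eq0 (half_spin_anticommute hgamma) (half_spin_anticommute' hgamma)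
      (half_spin_adj hgamma) h_smooth h_homog killing_unit res0).
  exists (fun y => c^-1 * g y); split; first exact: harmonics_scaled_component.
  move=> S sS; have b1 := sphere_base hgamma sS; have Ub := sphere_punctured b1.
  rewrite grad_scaled_component// cmul_killing//; last first.
    rewrite dotZr [X in _ * X](_ : _ = 0) ?mulr0//.
    have dgb : differentiable g (base S) by have /CkSP[+ _] := component_smooth 1; exact.
    rewrite -(euler component_homogeneous dgb).
    by apply: eq_bigr => l _; move: (base S) => y; rewrite mxE.
  rewrite (spinor_of_trivialize hgamma hn equi sS) PhiE// killing_form//.
  rewrite mulVKf// [LHS]mulmxDr; congr (_ + _); first by rewrite -scalemxAr.
  congr (_ *m _).
  have -> : clin A' (c^-1 *: dg (base S)) = (c^-1)%:C *: clin A' (dg (base S)).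
    move: (dg (base S)) => y; rewrite /clin scaler_sumr; apply: eq_bigr => j _.
    by rewrite mxE rmorphM scalerA.
  by rewrite -scalemxAr -scalemxAl.
apply/eqP; rewrite eq_sym -subr_eq0 E.
rewrite (eq_sphere_int (g := fun=> 0)) ?sphere_int0 ?mulr0// => x x1.
by rewrite (residual_of_harmonics c0 hf phiE x1) /hdot /repair mulmx0 mxE.
Qed.

End Eigenspinor.
End KillingComponent.

(** * Eigenvalues and conclusion *)

Lemma eigenvalue_index_nat (R : realType) (n k : nat) : (1 <= k)%N ->
  @eigenvalue_index R n k%:Z = n%:R / 2 + k%:R.
Proof. by move=> k1; rewrite /eigenvalue_index ltz_nat k1. Qed.

Lemma eigenvalue_index_oppnat (R : realType) (n k : nat) :
  @eigenvalue_index R n (- k%:Z) = - (n%:R / 2 + k%:R - 1).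
Proof. by rewrite /eigenvalue_index oppr_gt0 ltz_nat ltn0 mulrNz opprK. Qed.

Local Close Scope classical_set_scope.

Theorem proposition1p4 (R : realType) (n : nat) (hn : (2 <= n)%N)
    (gamma : 'I_n -> 'M[R[i]]_(2 ^ n./2)) (hgamma : spinor_rep gamma)
    (xi : spinor_fun R n)
    (hxi : killing gamma xi)
    (hxi1 : forall S, Spin gamma S -> Num.sqrt (inner (xi S) (xi S)) = 1) :
  (forall (k : nat) (phi : spinor_fun R n),
    (1 <= k)%N -> E gamma k%:Z phi ->
    integral_S gamma (fun S => inner (xi S) (phi S) ^+ 2)
      <= (n + k - 1)%:R / (n + 2 * k - 1)%:R
         * integral_S gamma (fun S => inner (phi S) (phi S))
    /\ (integral_S gamma (fun S => inner (xi S) (phi S) ^+ 2)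
          = (n + k - 1)%:R / (n + 2 * k - 1)%:R
            * integral_S gamma (fun S => inner (phi S) (phi S))
        <-> exists f : 'rV[R]_n.+1 -> R, harmonics k f /\
              forall S, Spin gamma S ->
                phi S = ((n + k - 1)%:R * f (base gamma S))%:C *: xi S
                        + cmul gamma S (grad f (base gamma S)) (xi S)))
  /\
  (forall (k : nat) (phi : spinor_fun R n),
    (1 <= k)%N -> E gamma (- k%:Z) phi ->
    integral_S gamma (fun S => inner (xi S) (phi S) ^+ 2)
      <= k%:R / (n + 2 * k - 1)%:R
         * integral_S gamma (fun S => inner (phi S) (phi S))
    /\ (integral_S gamma (fun S => inner (xi S) (phi S) ^+ 2)
          = k%:R / (n + 2 * k - 1)%:R
            * integral_S gamma (fun S => inner (phi S) (phi S))
        <-> exists f : 'rV[R]_n.+1 -> R, harmonics k f /\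
              forall S, Spin gamma S ->
                phi S = (- k%:R * f (base gamma S))%:C *: xi S
                        + cmul gamma S (grad f (base gamma S)) (xi S)))
  /\
  (forall (k j : nat) (a b : int)
      (phi psi : spinor_fun R n),
    (1 <= k)%N -> (1 <= j)%N -> k <> j ->
    a = k%:Z \/ a = - k%:Z -> b = j%:Z \/ b = - j%:Z ->
    E gamma a phi -> E gamma b psi ->
    integral_S gamma (fun S => inner (xi S) (phi S) * inner (xi S) (psi S)) = 0).
Proof.
have n0 : (0 < n)%N by exact: ltnW.
(* The differences in the statement are natural-number subtractions; 1 <= k prevents truncation. *)
have cE (k : nat) : (1 <= k)%N -> (n + k - 1)%:R = n%:R + k%:R - 1 :> R.
  by move=> k1; rewrite natrB ?natrD// (leq_trans k1)// leq_addl.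
have dE (k : nat) : (1 <= k)%N -> (n + 2 * k - 1)%:R = n%:R + 2 * k%:R - 1 :> R.
  have nk : (1 <= n + 2 * k)%N by exact: leq_trans n0 (leq_addr _ _).
  by move=> k1; rewrite (natrB _ nk) natrD natrM.
have n2 : 2 <= n%:R :> R by rewrite ler_nat.
have k1R (k : nat) : (1 <= k)%N -> 1 <= k%:R :> R by rewrite ler1n.
split; last split.
- move=> k phi k1; rewrite /E eigenvalue_index_nat// => ephi.
  have kR := k1R k k1.
  pose mu : R := n%:R / 2 + k%:R - n%:R / 2; pose c : R := mu + n%:R - 1.
  have muE : mu = k%:R by rewrite /mu; ring.
  have c_E : c = (n + k - 1)%:R by rewrite /c muE cE//; ring.
  have dcE : c + mu = (n + 2 * k - 1)%:R by rewrite c_E muE cE// dE//; ring.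
  have := @killing_component_estimate _ _ _ hgamma n0 _ hxi hxi1 _ _ ephi k.
  rewrite -/mu -/c dcE c_E muE; apply.
  + by rewrite cE// gt_eqF//; lra.
  + by apply: divr_gt0; [rewrite cE//|rewrite dE//]; lra.
  + by rewrite natrM.
- move=> k phi k1; rewrite /E eigenvalue_index_oppnat => ephi.
  have kR := k1R k k1.
  pose mu : R := - (n%:R / 2 + k%:R - 1) - n%:R / 2; pose c : R := mu + n%:R - 1.
  have muE : mu = - (n + k - 1)%:R by rewrite /mu cE//; field.
  have c_E : c = - k%:R by rewrite /c muE cE//; ring.
  have dcE : c + mu = - (n + 2 * k - 1)%:R by rewrite c_E muE cE// dE//; ring.
  have rE : - k%:R / - (n + 2 * k - 1)%:R = k%:R / (n + 2 * k - 1)%:R :> R.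
    by rewrite invrN mulrNN.
  have := @killing_component_estimate _ _ _ hgamma n0 _ hxi hxi1 _ _ ephi k.
  rewrite -/mu -/c dcE c_E muE rE; apply.
  + by rewrite oppr_eq0 gt_eqF//; lra.
  + by apply: divr_gt0; rewrite ?dE//; lra.
  + by rewrite mulrNN natrM mulrC.
move=> k j a b phi psi k1 j1 kj ak bj ephi epsi.
have kR := k1R k k1; have jR := k1R j j1.
(* Both signs yield the same Laplace eigenvalue l (n + l - 1), so all choices of signs are treated
   at once. *)
have muc (l : nat) (d : int) : (1 <= l)%N -> d = l%:Z \/ d = - l%:Z ->
    (@eigenvalue_index R n d - n%:R / 2) * (@eigenvalue_index R n d - n%:R / 2 + n%:R - 1) =
    l%:R * (n%:R + l%:R - 1).
  by move=> l1 [->|->]; rewrite ?eigenvalue_index_nat// ?eigenvalue_index_oppnat; field.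
pose v := trivialize gamma xi (delta_mx 0 ord0).
pose g (f : spinor_fun R n) x := repair (v^t*) (trivialize gamma f x).
rewrite (@integral_SE _ _ _ hgamma n0 _ (fun x => g phi x * g psi x)); last first.
  move=> S sS; congr (_ * _).
    exact: (@inner_killing _ _ _ hgamma n0 _ hxi _ _ ephi).
  exact: (@inner_killing _ _ _ hgamma n0 _ hxi _ _ epsi).
have La (f : spinor_fun R n) (d : int) (l : nat) (l1 : (1 <= l)%N)
    (dl : d = l%:Z \/ d = - l%:Z) (ef : E gamma d f) x (x1 : sphere x) :
    \sum_i partial i (partial i (g f)) x = - (l%:R * (n%:R + l%:R - 1)) * g f x.
  by rewrite -(muc l d l1 dl) (component_laplacian hgamma n0 xi ef x1).
have gh (f : spinor_fun R n) : homogeneous0 (g f) by exact: component_homogeneous.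
apply: (orthogonal_eigenfunctions (gh phi) (gh psi) _ _ _ (La _ _ _ k1 ak ephi)
  (La _ _ _ j1 bj epsi)).
- exact: (component_smooth hgamma n0 xi ephi 2).
- exact: (component_smooth hgamma n0 xi epsi 2).
have kj' : k%:R != j%:R :> R by rewrite eqr_nat; exact/eqP.
rewrite eqr_opp -subr_eq0.
(* The difference of the two Laplace eigenvalues factors; its second factor is positive, so they
   differ as soon as k and j do. *)
have -> : k%:R * (n%:R + k%:R - 1) - j%:R * (n%:R + j%:R - 1) =
  (k%:R - j%:R) * (n%:R + k%:R + j%:R - 1) :> R by ring.
by rewrite mulf_neq0 ?subr_eq0// gt_eqF//; lra.
Qed.
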